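(* Let $k$ be an algebraically closed field of arbitrary characteristic, $\mathbf{P}^2=\mathbf{P}^2_k$, and let $C\subset\mathbf{P}^2$ be a reduced curve of degree $d$ and total Tjurina number $\tau$. Let $m$ be the least degree of a foliation of $\mathbf{P}^2$ with $C$ as leaf. Then $$m\le d-1\quad\text{and}\quad\tau\le(d-1)(d-m-1)+m^2.$$ Moreover, if $d\le 2m$ and if $C$ is irreducible, then $$\tau\le(d-1)(d-m-1)+m^2-\binom{2m+2-d}{2}.$$
   Context: A curve in $\mathbf{P}^2$ means a nonzero effective divisor. A (singular) foliation of $\mathbf{P}^2$ is a nonzero map $\eta:\Omega^1_{\mathbf{P}^2}\to\mathcal{L}$ of $\mathcal{O}_{\mathbf{P}^2}$-modules with $\mathcal{L}$ an invertible sheaf. Its singular locus is the closed subscheme $S\subset\mathbf{P}^2$ whose ideal sheaf is $\operatorname{Im}(\eta\otimes\mathcal{L}^{-1}:\Omega^1_{\mathbf{P}^2}\otimes\mathcal{L}^{-1}\to\mathcal{O}_{\mathbf{P}^2})$; it is not assumed finite. The degree of $\eta$ is $\deg\mathcal{L}+1$, so a foliation of degree $m$ has $\mathcal{L}\cong\mathcal{O}_{\mathbf{P}^2}(m-1)$; the degree is always $\ge0$. A reduced curve $C\subset\mathbf{P}^2$ is a leaf of $\eta$ if no irreducible component of $C$ is contained in $S$ and the restriction $\eta|C:\Omega^1_{\mathbf{P}^2}|C\to\mathcal{L}|C$ factors through the natural surjection $\Omega^1_{\mathbf{P}^2}|C\to\Omega^1_C$. The singular locus of a reduced curve $C\subset\mathbf{P}^2$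 is the (finite) closed subscheme $\Sigma\subset C$ whose ideal is the first Fitting ideal of $\Omega^1_C$. For $P\in\Sigma$, with local coordinates $x,y$ for $\mathbf{P}^2$ at $P$ and a local equation $f(x,y)=0$ for $C$, the Tjurina number $\tau_P$ is the colength in $\mathcal{O}_{\mathbf{P}^2,P}$ of the ideal $(f,f_x,f_y)$. The total Tjurina number is $\tau:=\sum_{P\in\Sigma}\tau_P=\deg\Sigma$. The claim $m\le d-1$ includes the assertion that some foliation of $\mathbf{P}^2$ has $C$ as a leaf, so that $m$ is well defined. *)

(* Defs.v *)
From mathcomp Require Import all_boot all_order all_algebra.
From mathcomp Require Import mpoly.

Set Implicit Arguments.
Unset Strict Implicit.
Unset Printing Implicit Defensive.

Import Order.TTheory GRing.Theory Num.Theory.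
Local Open Scope ring_scope.

(* The sheaves on P^2 that occur here are subsheaves of (or ideals with values
   in) the invertible sheaves O(e), so all their sections are represented inside
   the fraction field of the homogeneous coordinate ring k[X_0, X_1, X_2]:
   a rational section of O(e) is a fraction of homogeneous polynomials whose
   degrees differ by e.  The standard chart U_i is the locus X_i != 0. *)
Notation coord_ring k := {mpoly k[3]}.
Notation hfrac k := {fraction {mpoly k[3]}}.

Section PlaneFoliations.
Variable k : closedFieldType.
Local Notation R := (coord_ring k).
Local Notation K := (hfrac k).
Implicit Types (F G H : R) (s t : K) (e : int) (i : 'I_3) (P Q : 'rV[k]_3).

Definition const (c : k) : K := tofrac (c%:MP : R).
Definition Xf (i : 'I_3) : K := tofrac ('X_i : R).

(* k(P^2) *)
Definition ratfun (s : K) : Prop :=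
  exists (n : nat) (A B : R),
    [/\ A \is n.-homog, B \is n.-homog, B != 0 & s = tofrac A / tofrac B].

(* O(e)(U_i) *)
Definition section (e : int) (i : 'I_3) (s : K) : Prop :=
  exists (n p : nat) (A : R),
    [/\ p%:Z = n%:Z + e, A \is p.-homog & s = tofrac A / Xf i ^+ n].

(* {A/B : A, B homogeneous of the same degree, B(P) != 0}, the local ring of
   P^2 at the point with homogeneous coordinates P. *)
Definition local_ring (P : 'rV[k]_3) (s : K) : Prop :=
  exists (n : nat) (A B : R),
    [/\ A \is n.-homog, B \is n.-homog, B.@[P 0] != 0
      & s = tofrac A / tofrac B].

(* An effective divisor of degree d is the class up to scalars of a nonzero
   form of degree d; it is nonzero when d > 0. *)
Definition curve (d : nat) (F : R) : Prop :=
  [/\ (0 < d)%N, F != 0 & F \is d.-homog].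

Definition mpdvd (G F : R) : Prop := exists H : R, F = G * H.

Definition reduced (F : R) : Prop :=
  forall G : R, mpdvd (G ^+ 2) F -> G \is a GRing.unit.

Definition irreducible (F : R) : Prop :=
  F \isn't a GRing.unit /\
  forall G H : R, F = G * H -> G \is a GRing.unit \/ H \is a GRing.unit.

(* Sections over U_i of I_C O(e), where I_C = F O(-d) is the ideal sheaf of the
   curve C of degree d with equation F. *)
Definition curve_ideal (d : nat) (F : R) (e : int) (i : 'I_3) (s : K) : Prop :=
  exists2 t : K, section (e - d%:Z) i t & s = tofrac F * t.

(* A map eta : Omega^1 -> O(e) is, by the universal property of Kaehler
   differentials, a k-derivation D from the structure sheaf to O(e), with
   D a = eta (da).  Since P^2 is integral and O(e) is torsion free, D amounts to
   a k-derivation on k(P^2) that is regular on every chart, i.e. maps O(U_i) to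
   O(e)(U_i).  Values of D outside k(P^2) are irrelevant.  Every invertible
   sheaf on P^2 is some O(e). *)
Record foliation := Foliation {
  twist : int;
  der :> K -> K;
  der_add : forall a b, ratfun a -> ratfun b -> der (a + b) = der a + der b;
  der_mul : forall a b, ratfun a -> ratfun b ->
    der (a * b) = a * der b + b * der a;
  der_const : forall c : k, der (const c) = 0;
  der_regular : forall i a, section 0 i a -> section twist i (der a);
  der_neq0 : exists2 a, ratfun a & der a != 0
}.

Definition fol_degree (D : foliation) : int := twist D + 1.

(* Sections over U_i of the image of eta (x) L^-1 : Omega^1 (x) L^-1 -> O. *)
Definition sing_ideal (D : foliation) (i : 'I_3) (s : K) : Prop :=
  exists2 l : seq (K * K),
    forall p, p \in l -> section 0 i p.1 /\ section (- twist D) i p.2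
    & s = \sum_(p <- l) D p.1 * p.2.

(* The curve G = 0, with G of degree g, is a closed subscheme of the
   singular locus of D. *)
Definition contained_in_sing (D : foliation) (g : nat) (G : R) : Prop :=
  forall i s, sing_ideal D i s -> curve_ideal g G 0 i s.

(* The irreducible components of C are the curves cut out by the irreducible
   factors of F.  The kernel of Omega^1|C -> Omega^1_C is generated by the da
   with a in I_C, so that eta|C factors through Omega^1_C if and only if
   D a vanishes in L|C = L / I_C L for all a in I_C. *)
Definition leaf (D : foliation) (d : nat) (F : R) : Prop :=
  (forall (g : nat) (G : R), G \is g.-homog -> irreducible G -> mpdvd G F ->
     ~ contained_in_sing D g G) /\
  (forall i a, curve_ideal d F 0 i a -> curve_ideal d F (twist D) i (D a)).

Definition least_leaf_degree (d : nat) (F : R) (m : int) : Prop :=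
  (exists2 D : foliation, leaf D d F & fol_degree D = m) /\
  (forall D : foliation, leaf D d F -> m <= fol_degree D).

(* The ideal (f, f_x, f_y) of the local ring at a point P of U_i.  The local
   coordinates are the X_j / X_i - P_j / P_i for j != i.  The local equation is
   f = F / X_i^d, that is, F with X_i set to 1 and X_j to X_j / X_i; hence its
   partial derivatives are the (dF/dX_j) / X_i^(d-1), for j != i. *)
Definition tjurina_ideal (d : nat) (F : R) (i : 'I_3) (P : 'rV[k]_3) (s : K)
    : Prop :=
  exists (a : K) (b : 'I_3 -> K),
    [/\ local_ring P a, forall j, local_ring P (b j)
      & s = a * (tofrac F / Xf i ^+ d)
            + \sum_(j < 3 | j != i) b j * (tofrac F^`M(j) / Xf i ^+ d.-1)].

(* The k-dimension of O / I is n.  For an ideal I of the local ring O of a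
   closed point, this is its colength, as the residue field is k. *)
Definition colength (O I : K -> Prop) (n : nat) : Prop :=
  exists u : 'I_n -> K,
    [/\ forall l, O (u l),
        forall c : 'I_n -> k, I (\sum_l const (c l) * u l) -> forall l, c l = 0
      & forall s, O s ->
          exists c : 'I_n -> k, I (s - \sum_l const (c l) * u l)].

Definition tjurina (d : nat) (F : R) (i : 'I_3) (P : 'rV[k]_3) (n : nat)
    : Prop :=
  colength (local_ring P) (tjurina_ideal d F i P) n.

(* P lies in Sigma.  The first Fitting ideal of Omega^1_C, with its local
   presentation O_C -> O_C^2 given by (f_x, f_y), is (f_x, f_y) O_C; so Sigma is
   locally the subscheme defined by (f, f_x, f_y). *)
Definition singular_at (d : nat) (F : R) (i : 'I_3) (P : 'rV[k]_3) : Prop :=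
  ~ tjurina_ideal d F i P 1.

(* For nonzero vectors of homogeneous coordinates. *)
Definition same_point (P Q : 'rV[k]_3) : Prop := exists c : k, Q = c *: P.

(* P enumerates the points of Sigma without repetition, P l lies in the chart
   U_(ch l), and t l is its Tjurina number. *)
Definition total_tjurina (d : nat) (F : R) (tau : nat) : Prop :=
  exists (r : nat) (P : 'I_r -> 'rV[k]_3) (ch : 'I_r -> 'I_3) (t : 'I_r -> nat),
    [/\ forall l, P l 0 (ch l) != 0 /\ singular_at d F (ch l) (P l),
        forall l l', same_point (P l) (P l') -> l = l',
        forall Q i, Q 0 i != 0 -> singular_at d F i Q ->
          exists l, same_point (P l) Q,
        forall l, tjurina d F (ch l) (P l) (t l)
      & tau = (\sum_l t l)%N].

End PlaneFoliations.

(* Main.v *)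
Require Import Defs.
From HB Require Import structures.
From mathcomp Require Import all_boot all_order all_algebra.
From mathcomp Require Import mpoly.
From mathcomp Require Import ring zify.
From Stdlib Require Import Classical.

(** By the Euler sequence, a foliation of degree [n] is the derivation along a
    vector [A] of three forms of degree [n], taken modulo the multiples of the
    Euler field [X] ([vec_of_foliation], [foliation_of_vec]). The curve [F =
    0] is a leaf if and only if [F] divides the derivative of [F] along [A],
    that is, [A] is logarithmic, and no component divides all minors of the
    pair [X], [A] ([leaf_vec_leaf], [leaf_leaf_vec]). The fields [v x grad F]
    with [v] constant have [F] as a first integral, and a suitable one has the
    curve as leaf; so [m <= d - 1] ([hamiltonian_leaf_vec]).

    The total Tjurina number is at most the dimension of the quotient of the
    forms of a large degree by the Jacobian ideal [(F, F_0, F_1, F_2)]: forms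
    that lie in the local ideal of one singular point and do not vanish at
    another glue independent elements of the local algebras to forms
    independent modulo the Jacobian ideal ([independent_count]). The same
    inequality shows that the singular points are finitely many and have
    finite Tjurina numbers ([total_tjurina_exists]).

    That dimension is bounded through the syzygies of [F, F_0, F_1, F_2]. They
    are the logarithmic fields [B]. If [A] is a logarithmic field of least
    degree [l] that is not a multiple of [X], the form [det (X, A, B)] is
    divisible by [F], and vanishes only if [B] is a combination of [X] and [A]
    with polynomial coefficients ([log_det], [minimal_log_span]). Thus the map
    [B |-> det (X, A, B) / F] has a kernel of known dimension, and bounding
    its image by all forms of the right degree gives the codimension [(d - 1)
    (d - l - 1) + l ^ 2] as an upper bound ([hilbert_jacobian],
    [jacobian_codim]). It may happen that [l < m], because some component
    divides all minors of [X] and the field of degree [l]; but then [d <= l +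
    m + 1], and in this range the bound only grows when [l] is replaced by [m]
    ([minimal_log_degree], [jacobian_codim_leaf]).

    If the curve is irreducible, then [l = m] and the minors of [X] and [A]
    are coprime. A general line [L] avoids their finitely many common zeros,
    and is therefore not a zero divisor modulo the ideal of the forms [det (X,
    A, B) / F] ([general_line]). In degree [2 m - d] this ideal is zero,
    because the fields [B] that occur there have degree [m - 1] and are
    multiples of [X]. Multiplication by powers of [L] then gives, in every
    larger degree, a space of forms of dimension [binomial (2 m + 2 - d, 2)]
    that meets the image only in zero, which improves the bound by this number
    ([jacobian_codim_irreducible]). *)

Set Implicit Arguments.
Unset Strict Implicit.
Unset Printing Implicit Defensive.

Import Order.TTheory GRing.Theory Num.Theory.
Local Open Scope ring_scope.

(** * Unique factorization *)

Section Factorial.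
Variable R : idomainType.
Implicit Types (a b c p q u : R) (s : seq R).

Definition divides a b := exists c, b = a * c.

Definition prime_elt p :=
  [/\ p != 0, p \isn't a GRing.unit
    & forall a b, divides p (a * b) -> divides p a \/ divides p b].

Definition irred p :=
  p \isn't a GRing.unit /\
  forall a b, p = a * b -> a \is a GRing.unit \/ b \is a GRing.unit.

Definition prime_fact a u s :=
  [/\ u \is a GRing.unit, forall p, p \in s -> prime_elt p
    & a = u * \prod_(p <- s) p].

Definition factorial_ring := forall a, a != 0 -> exists u s, prime_fact a u s.

Lemma divides_refl a : divides a a.
Proof. by exists 1; rewrite mulr1. Qed.

Lemma divides_trans b a c : divides a b -> divides b c -> divides a c.
Proof. by move=> [x ->] [y ->]; exists (x * y); rewrite mulrA. Qed.

Lemma divides0 a : divides a 0.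
Proof. by exists 0; rewrite mulr0. Qed.

Lemma dividesMl a b c : divides a b -> divides a (c * b).
Proof. by move=> [x ->]; exists (c * x); rewrite mulrCA. Qed.

Lemma dividesMr a b c : divides a b -> divides a (b * c).
Proof. by rewrite mulrC; apply: dividesMl. Qed.

Lemma dividesD a b c : divides a b -> divides a c -> divides a (b + c).
Proof. by move=> [x ->] [y ->]; exists (x + y); rewrite mulrDr. Qed.

Lemma dividesN a b : divides a b -> divides a (- b).
Proof. by move=> [x ->]; exists (- x); rewrite mulrN. Qed.

Lemma dividesB a b c : divides a b -> divides a c -> divides a (b - c).
Proof. by move=> ab /dividesN; apply: dividesD. Qed.

Lemma divides_sum (I : Type) (r : seq I) (P : pred I) (F : I -> R) a :
  (forall i, P i -> divides a (F i)) -> divides a (\sum_(i <- r | P i) F i).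
Proof.
move=> aF; elim/big_rec: _ => [|i x Pi ax]; first exact: divides0.
by apply: dividesD ax; apply: aF.
Qed.

Lemma divides_unit u a : u \is a GRing.unit -> divides u a.
Proof. by move=> uu; exists (u^-1 * a); rewrite mulVKr. Qed.

Lemma divides_is_unit u a : u \is a GRing.unit -> divides a u ->
  a \is a GRing.unit.
Proof. by move=> uu [c uE]; move: uu; rewrite uE unitrM => /andP[]. Qed.

Lemma prime_dvd_prime p q : prime_elt p -> irred q -> divides p q ->
  divides q p.
Proof.
move=> [p0 pu _] [_ qI] [c qE]; case: (qI _ _ qE) => [pU|cU].
  by rewrite pU in pu.
by exists (c^-1); rewrite qE mulrK.
Qed.

Lemma prime_dvdX p a n : prime_elt p -> divides p (a ^+ n) -> divides p a.
Proof.
move=> pP; elim: n => [|n IH].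
  rewrite expr0 => /(divides_is_unit (unitr1 _)) pu.
  by case: pP => _; rewrite pu.
by rewrite exprS => h; case: (pP) => _ _ /(_ _ _ h)[].
Qed.

Lemma prime_irred p : prime_elt p -> irred p.
Proof.
move=> [p0 pu pM]; split=> // a b pE.
have /pM : divides p (a * b) by rewrite -pE; apply: divides_refl.
case=> -[c cE]; [right | left]; apply/unitrP; exists c.
  have: p * 1 = p * (c * b) by rewrite mulr1 {1}pE cE; ring.
  by move/(mulfI p0) => E; split; rewrite // mulrC.
have: p * 1 = p * (c * a) by rewrite mulr1 {1}pE cE; ring.
by move/(mulfI p0) => E; split; rewrite // mulrC.
Qed.

(** Each prime of the list divides one of the two factors, and can be cancelled
    from it. *)
Lemma prime_fact_split s : forall a b u, prime_fact (a * b) u s ->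
  exists u1 u2 s1 s2, [/\ prime_fact a u1 s1, prime_fact b u2 s2
    & size s = (size s1 + size s2)%N].
Proof.
elim: s => [|p s IH] a b u [uU sP].
  rewrite big_nil mulr1 => abE.
  move: uU; rewrite -abE unitrM => /andP[aU bU].
  by exists a, b, [::], [::]; split=> //; split; rewrite // big_nil mulr1.
rewrite big_cons => abE.
have pP : prime_elt p by apply: sP; rewrite mem_head.
have [p0 _ pM] := pP.
have sP' q : q \in s -> prime_elt q by move=> qs; apply: sP; rewrite inE qs orbT.
have /pM : divides p (a * b) by rewrite abE; eexists; rewrite mulrCA.
case=> -[c cE].
  have E : c * b = u * \prod_(q <- s) q.
    by apply: (mulfI p0); rewrite mulrA -cE abE mulrCA.
  have [|u1 [u2 [s1 [s2 [[u1U s1P aE] F2 ss]]]]] := IH c b u; first by split.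
  exists u1, u2, (p :: s1), s2; split=> //; last by rewrite /= ss.
  split=> //; last by rewrite cE aE big_cons mulrCA.
  by move=> q; rewrite inE => /predU1P[->|/s1P].
have E : a * c = u * \prod_(q <- s) q.
  by apply: (mulfI p0); rewrite mulrCA -cE abE mulrCA.
have [|u1 [u2 [s1 [s2 [F1 [u2U s2P bE] ss]]]]] := IH a c u; first by split.
exists u1, u2, s1, (p :: s2); split=> //; last by rewrite /= ss addnS.
split=> //; last by rewrite cE bE big_cons mulrCA.
by move=> q; rewrite inE => /predU1P[->|/s2P].
Qed.

Lemma prime_fact_unit a u s : prime_fact a u s -> s = [::] ->
  a \is a GRing.unit.
Proof. by move=> [uU _ ->] ->; rewrite big_nil mulr1. Qed.

(** Induction on the number of prime factors: it allows cancelling a scalar from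
    a relation one prime at a time. *)
Lemma factorial_ind (P : R -> Prop) : factorial_ring ->
  (forall u, u \is a GRing.unit -> P u) ->
  (forall p a, prime_elt p -> a != 0 -> P a -> P (p * a)) ->
  forall c, c != 0 -> P c.
Proof.
move=> Rf Pu Pp c c0; have [u [s [uU sP cE]]] := Rf c c0.
rewrite {}cE in c0 *; elim: s sP c0 => [|p s IH] sP.
  by rewrite big_nil mulr1 => _; apply: Pu.
rewrite big_cons mulrCA mulf_eq0 negb_or => /andP[_ a0]; apply: Pp => //.
  by apply: sP; rewrite mem_head.
by apply: IH => // q qs; apply: sP; rewrite inE qs orbT.
Qed.

Lemma nonunit_prime_dvd a : factorial_ring -> a != 0 ->
  a \isn't a GRing.unit -> exists2 p, prime_elt p & divides p a.
Proof.
move=> Rf a0 aU; have [u [s Fa]] := Rf a a0.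
case: s Fa => [|p s] Fa; first by rewrite (prime_fact_unit Fa) in aU.
have [_ sP ->] := Fa; exists p; first by apply: sP; rewrite mem_head.
by rewrite big_cons mulrCA; eexists.
Qed.

Lemma irred_prime p : factorial_ring -> p != 0 -> irred p -> prime_elt p.
Proof.
move=> Rf p0 [pU pI]; have [q qP qp] := nonunit_prime_dvd Rf p0 pU.
have [c pE] := prime_dvd_prime qP (conj pU pI) qp.
case: qp => e qE; split=> // a b pab; case: qP => _ _.
move/(_ a b (divides_trans _ pab)); case; first by exists e.
  by move=> h; left; apply: divides_trans h; exists c.
by move=> h; right; apply: divides_trans h; exists c.
Qed.

(** The prime factors of [a] are pairwise non-associate, so they can be divided
    out of [g] one at a time. *)
Lemma squarefree_divides a g : factorial_ring -> a != 0 ->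
  (forall p, prime_elt p -> ~ divides (p ^+ 2) a) ->
  (forall p, prime_elt p -> divides p a -> divides p g) -> divides a g.
Proof.
move=> Rf a0; move: g; pattern a; apply: factorial_ind a0 => // {a}.
  by move=> u uU g _ _; apply: divides_unit.
move=> p b pP b0 IH g sqf ag.
have [c gE] : divides b g.
  apply: IH => [q qP qb|q qP qb]; last by apply: ag qP _; apply: dividesMl.
  by apply: (sqf q qP); apply: dividesMl.
have [_ _ /(_ b c)[]] := pP.
- by rewrite -gE; apply: ag pP _; apply/dividesMr/divides_refl.
- by move=> [e bE]; case: (sqf p pP); rewrite bE; exists e; ring.
- by move=> [e cE]; exists e; rewrite gE cE; ring.
Qed.

End Factorial.

Section PolyFactorial.
Variable R : idomainType.
Implicit Types (f g h : {poly R}) (c p : R).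

Lemma strip_lead p f : f != 0 -> divides p (lead_coef f) ->
  exists2 t, divides p%:P t & (size (f - t)%R < size f)%N.
Proof.
move=> f0 [c fc]; exists (lead_coef f *: 'X^((size f).-1)).
  by rewrite fc -scalerA -mul_polyC; apply/dividesMr/divides_refl.
rewrite -[ltnRHS]prednK ?size_poly_gt0 // ltnS.
apply/leq_sizeP => j; rewrite leq_eqVlt => /predU1P[<-|jf].
  by rewrite coefB coefZ coefXn eqxx mulr1 subrr.
rewrite coefB coefZ coefXn (gtn_eqF jf) mulr0 subr0 nth_default //.
by rewrite -[leqLHS]prednK ?size_poly_gt0.
Qed.

(** Gauss's lemma: a prime that divides [f * g] divides one of the leading
    coefficients; strip that leading term and induct. *)
Lemma prime_polyC p : prime_elt p -> prime_elt p%:P.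
Proof.
move=> [p0 pU pM]; split.
- by rewrite polyC_eq0.
- by rewrite poly_unitE coefC /= (negPf pU) andbF.
have main n : forall f g, (size f + size g <= n)%N -> divides p%:P (f * g) ->
    divides p%:P f \/ divides p%:P g; last by move=> f g; apply: main.
elim: n => [|n IH] f g.
  rewrite leqn0 addn_eq0 size_poly_eq0 => /andP[/eqP-> _] _.
  by left; apply: divides0.
have [->|f0 fg_n] := eqVneq f 0; first by left; apply: divides0.
have [->|g0] := eqVneq g 0; first by right; apply: divides0.
move=> pfg; have [] : divides p (lead_coef f) \/ divides p (lead_coef g).
- apply: pM; have [e E] := pfg; exists (lead_coef e).
  by rewrite -lead_coefM E lead_coefM lead_coefC.
- move=> /(strip_lead f0)[t pt ft].
  have [||h|h] := IH (f - t) g; [lia| |left|by right].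
    by rewrite mulrBl; apply: dividesB; rewrite // ; apply: dividesMr.
  by rewrite -(subrK t f); apply: dividesD.
- move=> /(strip_lead g0)[t pt gt].
  have [||h|h] := IH f (g - t); [lia| |by left|right].
    by rewrite mulrBr; apply: dividesB; rewrite // ; apply: dividesMl.
  by rewrite -(subrK t g); apply: dividesD.
Qed.

Lemma unit_polyC c : c \is a GRing.unit -> c%:P \is a GRing.unit.
Proof.
move=> cU; rewrite poly_unitE coefC cU andbT size_polyC.
by have -> : c != 0 by apply: contraTneq cU => ->; rewrite unitr0.
Qed.

(** Pseudo-division by an element of least degree leaves no remainder. This
    replaces the principal ideals over the fraction field of [R]. *)
Lemma ideal_min (I : {poly R} -> Prop) :
  (forall f g, I f -> I g -> I (f + g)) -> (forall f g, I f -> I (g * f)) ->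
  (exists2 f, I f & f != 0) ->
  exists h, [/\ I h, h != 0
    & forall f, I f -> exists2 c, c != 0 & divides h (c *: f)].
Proof.
move=> ID IM [f If f0].
have [n] := ubnP (size f); elim: n f If f0 => // n IH f If f0 fn.
case: (classic (exists2 g, I g & g != 0 /\ (size g < size f)%N)).
  by move=> [g Ig [g0 gf]]; apply: (IH g) => //; lia.
move=> noI; exists f; split=> // g Ig.
exists (lead_coef f ^+ scalp g f); first exact: Pdiv.Idomain.lc_expn_scalp_neq0.
have [r0|r0] := eqVneq (g %% f) 0.
  by exists (g %/ f); rewrite Pdiv.Idomain.divp_eq r0 addr0 mulrC.
case: noI; exists (g %% f); last by split=> //; rewrite ltn_modp.
have -> : g %% f = (lead_coef f ^+ scalp g f)%:P * g + (- (g %/ f)) * f.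
  by rewrite mul_polyC Pdiv.Idomain.divp_eq mulNr addrC addKr.
by apply: ID; apply: IM.
Qed.

Hypothesis Rf : factorial_ring R.

(** Each prime factor of [c] stays prime in [R[X]], so it divides [h] or [q]. *)
Lemma cancel_content c : c != 0 -> forall f h q, c *: f = h * q ->
  exists a b h' q', [/\ f = h' * q', h = a *: h' & q = b *: q'].
Proof.
move=> c0; pattern c; apply: factorial_ind c0 => // {c} [u uU|p c pP _ IH].
  move=> f h q E; exists 1, u, h, (u^-1 *: q); rewrite scale1r scalerA divrr //.
  by rewrite scale1r -scalerAr -E scalerA mulVr // scale1r.
move=> f h q E; have p0 : p != 0 by case: pP.
have [_ _ /(_ h q)[]] := prime_polyC pP.
- by rewrite -E -mul_polyC polyCM -mulrA; eexists.
- move=> [h1 hE]; have [|a [b [h' [q' [fE h1E qE]]]]] := IH f h1 q.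
    apply: (@mulfI _ p%:P); rewrite ?polyC_eq0 //.
    by rewrite mulrA -hE -E mul_polyC scalerA.
  by exists (p * a), b, h', q'; rewrite hE h1E mul_polyC scalerA.
- move=> [q1 qE]; have [|a [b [h' [q' [fE hE q1E]]]]] := IH f h q1.
    apply: (@mulfI _ p%:P); rewrite ?polyC_eq0 //.
    by rewrite mulrCA -qE -E mul_polyC scalerA.
  by exists a, (p * b), h', q'; rewrite qE q1E mul_polyC scalerA.
Qed.

Lemma irred_prim_dvd f g c : irred f -> (1 < size f)%N -> c != 0 ->
  divides f (c *: g) -> divides f g.
Proof.
move=> [fU fI] f1 c0 [q E].
have [a [b [f' [q' [gE fE qE]]]]] := cancel_content c0 E.
have f'f : divides f f'.
  rewrite -mul_polyC in fE; have [aU|f'U] := fI _ _ fE.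
    by exists a%:P^-1; rewrite fE mulrC mulKr.
  move: f1; rewrite fE mul_polyC; move: f'U; rewrite poly_unitE => /andP[/eqP f'1 _].
  by rewrite ltnNge (leq_trans (size_scale_leq _ _)) ?f'1.
by rewrite gE; apply: dividesMr.
Qed.

(** The ideal generated by [f] and [g] is, up to scalars, principal; as [f] is
    irreducible, either its generator is a scalar, or it is [f] up to a scalar
    and [f] divides [g]. *)
Lemma irred_prime_poly f : irred f -> (1 < size f)%N -> prime_elt f.
Proof.
move=> fI f1; have f0 : f != 0 by rewrite -size_poly_gt0; lia.
split; rewrite ?(proj1 fI) // => g k fgk.
pose I h := exists u v, h = u * f + v * g.
have [|||h [[u [v hE]] h0 hI]] := @ideal_min I.
- by move=> x y [u [v ->]] [u' [v' ->]]; exists (u + u'), (v + v'); ring.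
- by move=> x y [u [v ->]]; exists (y * u), (y * v); ring.
- by exists f => //; exists 1, 0; ring.
have [|c c0 [q E]] := hI f; first by exists 1, 0; ring.
have [a [b [h' [q' [fE h'E qE]]]]] := cancel_content c0 E.
case: (proj2 fI _ _ fE) => [h'U|q'U]; last first.
  left; have [|e e0 [r gE]] := hI g; first by exists 0, 1; ring.
  apply: (irred_prim_dvd fI f1 e0); rewrite gE h'E.
  have -> : h' = f * q'^-1 by rewrite fE mulrK.
  by rewrite -mul_polyC; exists (a%:P * q'^-1 * r); ring.
right; move: h'U; rewrite poly_unitE => /andP[/eqP/eq_leq/size1_polyC h'C _].
have fk : divides f (h * k).
  rewrite hE mulrDl -!mulrA; apply: dividesD; last exact: dividesMl.
  by apply/dividesMl/dividesMr/divides_refl.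
move: h0 fk; rewrite h'E h'C -mul_polyC -polyCM polyC_eq0 mul_polyC => e0.
exact: irred_prim_dvd.
Qed.

(** A factorization of [f] into nonunits splits its leading coefficient, and a
    nonunit has positive degree or a leading coefficient with a prime factor; so
    the degree plus the number of these primes drops in both factors, and
    splitting ends with irreducible elements. *)
Theorem factorial_poly : factorial_ring {poly R}.
Proof.
have Rf' := Rf; move=> f f0.
have lf0 : lead_coef f != 0 by rewrite lead_coef_eq0.
have [u [s Fs]] := Rf' _ lf0.
have [n] := ubnP (size f + size s); elim: n => // n IH in f f0 lf0 u s Fs *.
move=> fsn; case: (boolP (f \is a GRing.unit)) => [fU|fU].
  by exists f, [::]; split; rewrite // big_nil mulr1.
case: (classic (irred f)) => [fI|fI].
  have [f1|f1] := leqP (size f) 1; last first.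
    exists 1, [:: f]; split; rewrite ?unitr1 ?big_seq1 ?mul1r // => p.
    by rewrite inE => /eqP->; apply: irred_prime_poly.
  rewrite (size1_polyC f1) in f0 *; rewrite polyC_eq0 in f0.
  have [v [t [vU tP ->]]] := Rf' _ f0; exists v%:P, (map polyC t); split.
  - exact: unit_polyC.
  - by move=> _ /mapP[p /tP pP ->]; apply: prime_polyC.
  - by rewrite big_map polyCM rmorph_prod.
have [g [h [fE gU hU]]] : exists g h, [/\ f = g * h, g \isn't a GRing.unit
    & h \isn't a GRing.unit].
  apply: NNPP => no; apply: fI; split=> // g h fE.
  case: (boolP (g \is a GRing.unit)) => gU; first by left.
  by right; case: (boolP (h \is a GRing.unit)) => // hU; case: no; exists g, h.
move: f0 lf0 Fs fsn {fU fI}; rewrite {}fE mulf_eq0 lead_coefM => /norP[g0 h0].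
move=> gh0 /prime_fact_split[u1 [u2 [s1 [s2 [F1 F2 ->]]]]].
rewrite size_mul // => n_gt.
have small (k : {poly R}) v r : k \isn't a GRing.unit -> k != 0 ->
    prime_fact (lead_coef k) v r -> (1 < size k + size r)%N.
  move=> kU k0 Fr; have := k0; rewrite -size_poly_gt0.
  case: r Fr => [|? ?] Fr; last by rewrite /=; lia.
  have [k1 _|] := leqP (size k) 1; last by rewrite /=; lia.
  have kE := size1_polyC k1; have := prime_fact_unit Fr erefl.
  by rewrite kE lead_coefC => /unit_polyC; rewrite -kE (negPf kU).
have := small _ _ _ gU g0 F1; have := small _ _ _ hU h0 F2 => h1 g1.
have gp : (0 < size g)%N by rewrite size_poly_gt0.
have hp : (0 < size h)%N by rewrite size_poly_gt0.
have [||v1 [t1 [v1U t1P gE]]] := IH g g0 _ u1 s1 F1; rewrite ?lead_coef_eq0 //.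
  by lia.
have [||v2 [t2 [v2U t2P hE]]] := IH h h0 _ u2 s2 F2; rewrite ?lead_coef_eq0 //.
  by lia.
exists (v1 * v2), (t1 ++ t2); split; first by rewrite unitrM v1U.
  by move=> p; rewrite mem_cat => /orP[/t1P|/t2P].
by rewrite big_cat gE hE /=; ring.
Qed.

End PolyFactorial.

Section Isomorphism.
Variables (R S : idomainType) (f : {rmorphism R -> S}) (g : S -> R).
Hypotheses (fK : cancel f g) (gK : cancel g f).

Let fI : injective f. Proof. exact: can_inj fK. Qed.

Let gM x y : g (x * y) = g x * g y.
Proof. by apply: fI; rewrite rmorphM !gK. Qed.

Let fU x : (f x \is a GRing.unit) = (x \is a GRing.unit).
Proof.
have g1 : g 1 = 1 by apply: fI; rewrite rmorph1 gK.
apply/idP/idP => [/unitrP[y [yx xy]]|]; last exact: rmorph_unit.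
by apply/unitrP; exists (g y); rewrite -{1 2}[x]fK -!gM yx xy g1.
Qed.

Lemma prime_iso p : prime_elt p -> prime_elt (g p).
Proof.
move=> [p0 pU pM]; split.
- by rewrite -(inj_eq fI) gK rmorph0.
- by rewrite -fU gK.
move=> x y [z E]; have [] := pM (f x) (f y).
- by exists (f z); rewrite -rmorphM E rmorphM gK.
- by move=> [w xE]; left; exists (g w); rewrite -[x]fK xE gM.
- by move=> [w xE]; right; exists (g w); rewrite -[y]fK xE gM.
Qed.

Lemma divides_iso p x : divides p (f x) -> divides (g p) x.
Proof. by move=> [c E]; exists (g c); rewrite -gM -E fK. Qed.

Lemma factorial_iso : factorial_ring S -> factorial_ring R.
Proof.
move=> Sf a a0; have [|u [s [uU sP aE]]] := Sf (f a).
  by rewrite -(rmorph0 f) inj_eq.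
exists (g u), (map g s); split; first by rewrite -fU gK.
  by move=> _ /mapP[p /sP pP ->]; apply: prime_iso.
rewrite -[a]fK aE gM big_map; congr (_ * _).
have g1 : g 1 = 1 by apply: fI; rewrite rmorph1 gK.
by elim: s {sP aE} => [|p s IH]; rewrite ?big_nil // !big_cons gM IH.
Qed.

End Isomorphism.

Lemma factorial_field (k : fieldType) : factorial_ring k.
Proof.
move=> a a0; exists a, [::]; split; rewrite ?unitfE // big_nil mulr1 //.
Qed.

(** * Polynomials in several variables *)

Lemma mpoly_rmorph_ext (n : nat) (k : fieldType) (A : nzRingType)
    (f g : {rmorphism {mpoly k[n]} -> A}) :
  (forall c, f c%:MP = g c%:MP) -> (forall i, f 'X_i = g 'X_i) -> f =1 g.
Proof.
move=> fgC fgX p; rewrite [p]mpolyE !rmorph_sum; apply: eq_bigr => m _.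
rewrite -mul_mpolyC !rmorphM fgC mpolyXE_id !rmorph_prod /=; congr (_ * _).
by apply: eq_bigr => i _; rewrite !rmorphXn fgX.
Qed.

Section MPolyMorphisms.
Variables (n : nat) (k : fieldType).

Local Notation widen := (widen_ord (leqnSn n)).

Lemma ord_max_or_widen (P : 'I_n.+1 -> Prop) :
  P ord_max -> (forall i, P (widen i)) -> forall i, P i.
Proof.
move=> Pmax Pw i; have [j ->|->//] := unliftP ord_max i.
by rewrite (_ : lift _ _ = widen j) //; apply: val_inj; exact: lift_max.
Qed.

Lemma muni_Xmax : muni ('X_ord_max : {mpoly k[n.+1]}) = 'X.
Proof.
rewrite muniE msuppX big_seq1 mcoeffX eqxx mnm1E eqxx expr1.
rewrite (_ : [multinom _ | _ < _] = 0%MM) ?mpolyX0 ?scale1r //.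
apply/mnmP => i; rewrite mnmE mnm0E mnm1E.
by case: eqP => // /(congr1 val)/= E; have := ltn_ord i; rewrite -E ltnn.
Qed.

Lemma muni_Xwiden i : muni ('X_(widen i) : {mpoly k[n.+1]}) = ('X_i)%:P.
Proof.
rewrite muniE msuppX big_seq1 mcoeffX eqxx mnm1E.
case: eqP => [/(congr1 val)/= E|_].
  by have := ltn_ord i; rewrite E ltnn.
rewrite expr0 scale1r (_ : [multinom _ | _ < _] = U_(i)%MM) ?alg_polyC //.
by apply/mnmP => j; rewrite mnmE !mnm1E.
Qed.

Definition muni_inv (q : {poly {mpoly k[n]}}) : {mpoly k[n.+1]} :=
  horner_eval 'X_ord_max (map_poly (@mwiden n k) q).

Lemma muniK : cancel (@muni n k) muni_inv.
Proof.
pose g : {rmorphism _ -> _} := (horner_eval ('X_ord_max : {mpoly k[n.+1]}) \o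
   map_poly (@mwiden n k)) \o (@muni n k).
suff: g =1 idfun by [].
apply: mpoly_rmorph_ext => [c|] /=.
  by rewrite muniC map_polyC /= mwidenC /horner_eval hornerC.
apply: ord_max_or_widen => [|i].
  by rewrite muni_Xmax map_polyX /horner_eval hornerX.
rewrite muni_Xwiden map_polyC /= mwidenX /horner_eval hornerC.
by rewrite mnmwiden1.
Qed.

Lemma muni_invK : cancel muni_inv (@muni n k).
Proof.
have mC p : muni (mwiden p) = p%:P :> {poly {mpoly k[n]}}.
  move: p; suff: (@muni n k) \o (@mwiden n k) =1 polyC by [].
  apply: mpoly_rmorph_ext.
    by move=> c /=; rewrite mwidenC muniC.
  by move=> i /=; rewrite mwidenX mnmwiden1 muni_Xwiden.
move=> q; rewrite /muni_inv /horner_eval horner_poly rmorph_sum /=.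
rewrite -[RHS]coefK poly_def; apply: eq_bigr => i _.
by rewrite rmorphM rmorphXn /= muni_Xmax mC mul_polyC.
Qed.

Lemma meval_muni (p : {mpoly k[n.+1]}) (v : 'I_n.+1 -> k) :
  p.@[v] = (map_poly (meval (v \o widen)) (muni p)).[v ord_max].
Proof.
pose g : {rmorphism _ -> _} := (horner_eval (v ord_max) \o
   map_poly (@meval n k (v \o widen))) \o (@muni n k).
move: p; suff: @meval n.+1 k v =1 g by [].
apply: mpoly_rmorph_ext => [c|] /=.
  by rewrite muniC map_polyC /= !mevalC /horner_eval hornerC.
apply: ord_max_or_widen => [|i].
  by rewrite muni_Xmax map_polyX mevalXU /horner_eval hornerX.
by rewrite muni_Xwiden map_polyC /= !mevalXU /horner_eval hornerC.
Qed.

End MPolyMorphisms.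

Theorem factorial_mpoly n (k : fieldType) : factorial_ring {mpoly k[n]}.
Proof.
elim: n => [|n IH]; last first.
  exact: (factorial_iso (@muniK n k) (@muni_invK n k) (factorial_poly IH)).
move=> p p0; exists p, [::]; split=> //; last by rewrite big_nil mulr1.
rewrite -(mpolyKC p) in p0 *; rewrite mpolyC_eq0 in p0.
by apply: rmorph_unit; rewrite unitfE.
Qed.

(** Give the first variables values that keep the leading coefficient in the last
    one nonzero; a polynomial in one variable has finitely many roots. *)
Lemma mpoly_nonroot n (k : closedFieldType) (p : {mpoly k[n]}) : p != 0 ->
  exists v : 'I_n -> k, p.@[v] != 0.
Proof.
elim: n p => [|n IH] p p0.
  exists (fun _ => 0); rewrite -(mpolyKC p) mevalC.
  by apply: contraNneq p0 => E; rewrite -(mpolyKC p) E mpolyC0.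
have q0 : muni p != 0.
  apply: contraNneq p0 => E; apply/eqP/(can_inj (@muniK n k)).
  by rewrite E rmorph0.
have [v' v'0] := IH (lead_coef (muni p)) (ltac:(by rewrite lead_coef_eq0)).
have : map_poly (meval v') (muni p) != 0.
  apply: contraNneq v'0 => E; have := congr1 (fun q : {poly k} => q`_(size (muni p)).-1) E.
  by rewrite /= coef0 coef_map => ->.
move=> /closed_nonrootP[x]; rewrite rootE => x0.
pose v (i : 'I_n.+1) := if unlift ord_max i is Some j then v' j else x.
exists v; rewrite meval_muni.
have -> : v ord_max = x by rewrite /v unlift_none.
rewrite (eq_map_poly (g := meval v')) // => q; apply: meval_eq => i /=.
rewrite /v (_ : widen_ord _ i = lift ord_max i) ?liftK //.
by apply: val_inj; rewrite [RHS]lift_max.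
Qed.

Section Homogeneous.
Variables (n : nat) (k : fieldType).
Local Notation R := {mpoly k[n]}.
Implicit Types (p q : R).

Lemma mcoeffM_mlast p q : p != 0 -> q != 0 ->
  (p * q)@_(mlast p + mlast q) = p@_(mlast p) * q@_(mlast q).
Proof.
move=> p0 q0; rewrite mpolyME (bigD1_seq (mlast p, mlast q)) /=; first last.
- by rewrite allpairs_uniq => // -[? ?] [].
- by rewrite allpairs_f// !mlast_supp.
rewrite mcoeffD mcoeffZ mcoeffX eqxx mulr1.
rewrite big_seq_cond raddf_sum /= big1 ?addr0 //.
case=> m1 m2 /andP[/allpairsP[[x y] [xp yq [-> ->]]]].
move: xp yq => /=.
move: x y => {}m1 {}m2 /mlast_lemc m1p /mlast_lemc m2q ne; rewrite mcoeffZ mcoeffX.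
move: m1p; rewrite le_eqVlt => /predU1P[m1E|m1p]; last first.
  by rewrite (gt_eqF (ltmc_le_add m1p m2q)) mulr0.
move: ne m2q; rewrite -m1E xpair_eqE eqxx /= le_eqVlt eq_sym => /negPf-> /=.
by move=> m2q; rewrite eqm_add2l (gt_eqF m2q) mulr0.
Qed.

(** The monomial order refines the degree, so it suffices to compare the
    degrees of the largest and of the smallest monomials of the factors. *)
Lemma homog_factor p q N : p * q != 0 -> p * q \is N.-homog ->
  p \is (mdeg (mlead p)).-homog.
Proof.
rewrite mulf_eq0 => /norP[p0 q0] /dhomogP pqN.
have lt_pq : (mlead p + mlead q)%MM \in msupp (p * q).
  by rewrite mcoeff_msupp mleadcM mulf_neq0 // mleadc_eq0.
have la_pq : (mlast p + mlast q)%MM \in msupp (p * q).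
  by rewrite mcoeff_msupp mcoeffM_mlast // mulf_neq0 // -mcoeff_msupp mlast_supp.
have := pqN _ lt_pq; have := pqN _ la_pq; rewrite /= !mdegD => <-.
have lp : (mdeg (mlast p) <= mdeg (mlead p))%N.
  exact: lemc_mdeg (mlast_lemc (mlead_supp p0)).
have lq : (mdeg (mlast q) <= mdeg (mlead q))%N.
  exact: lemc_mdeg (mlast_lemc (mlead_supp q0)).
move=> E; apply/dhomogP => m mp /=.
have l1 : (mdeg (mlast p) <= mdeg m)%N by exact: lemc_mdeg (mlast_lemc mp).
have l2 : (mdeg m <= mdeg (mlead p))%N by exact: lemc_mdeg (msupp_le_mlead mp).
lia.
Qed.

Lemma pihomogM_homog p q d e : p \is d.-homog ->
  pihomog mdeg e (p * q) = if (d <= e)%N then p * pihomog mdeg (e - d) q else 0.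
Proof.
move=> pd; pose N := maxn (msize q) e.+1.
rewrite [in LHS](@pihomog_partitionE n k mdeg N q) ?leq_maxl // mulr_sumr raddf_sum /=.
have pq i : p * pihomog mdeg i q \is (d + i).-homog.
  by apply: dhomogM (pihomogP _ _ _).
case: leqP => de; last first.
  by apply: big1 => i _; apply: (pihomog_ne0 _ (pq i)); lia.
have eN : (e - d < N)%N by rewrite /N; lia.
rewrite (bigD1 (Ordinal eN)) //= pihomog_dE; last by have := pq (e - d)%N; rewrite subnKC.
rewrite big1 ?addr0 // => i ie; apply: (pihomog_ne0 _ (pq i)).
by move: ie; rewrite -val_eqE /=; lia.
Qed.

Lemma homog_cofactor p q d e : p \is d.-homog -> q \is e.-homog ->
  divides p q -> exists2 r, r \is (e - d).-homog & q = p * r.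
Proof.
move=> pd qe [r qE]; rewrite -(pihomog_dE qe) qE (pihomogM_homog _ _ pd).
by case: leqP => _; [exists (pihomog mdeg (e - d) r) | exists 0];
  rewrite ?mulr0 ?rpred0 ?pihomogP.
Qed.

Lemma homog_divides_le p q d e : p \is d.-homog -> q \is e.-homog -> q != 0 ->
  divides p q -> (d <= e)%N.
Proof.
move=> pd qe q0 [r qE]; have := pihomog_dE qe; rewrite qE (pihomogM_homog _ _ pd).
by case: leqP => // _ E; rewrite qE -E eqxx in q0.
Qed.

Lemma homog_mderiv p d i : p \is d.-homog -> p^`M(i) \is d.-1.-homog.
Proof.
move=> /dhomogP pd; apply/dhomogP => m; rewrite mcoeff_msupp mcoeff_mderiv => h.
have /pd /= : (m + U_(i))%MM \in msupp p.
  by rewrite mcoeff_msupp; apply: contraNneq h => ->; rewrite mul0rn.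
by rewrite mdegD mdeg1; lia.
Qed.

Lemma mpolyX_mderiv i (m : 'X_{1..n}) :
  'X_i * ('X_[m])^`M(i) = ('X_[m] : R) *+ m i.
Proof.
rewrite mderivX scaler_nat mulrnAr; case: (posnP (m i)) => [->|mi].
  by rewrite !mulr0n.
rewrite -mpolyXD; congr (_ *+ _); congr 'X_[_].
apply/mnmP => j; rewrite mnmDE mnmBE mnm1E; case: eqP => [<-|_] /=; lia.
Qed.

Lemma euler_homog p d : p \is d.-homog -> \sum_i 'X_i * p^`M(i) = p *+ d.
Proof.
move=> /dhomogP pd; transitivity (\sum_(m <- msupp p) (p@_m *: 'X_[m]) *+ d).
  rewrite [in LHS](mpolyE p).
  under eq_bigr => i _ do rewrite raddf_sum mulr_sumr.
  rewrite exchange_big big_seq [RHS]big_seq; apply: eq_bigr => m /pd /= <-.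
  under eq_bigr => i _ do rewrite mderivZ -scalerAr mpolyX_mderiv -scalerMnr.
  by rewrite sumrMnr -mdegE.
by rewrite sumrMnl -mpolyE.
Qed.

Lemma msize_gt0 p : (0 < msize p)%N = (p != 0).
Proof. by rewrite lt0n msize_poly_eq0. Qed.

Lemma msize_mul p q : p != 0 -> q != 0 ->
  ((msize (p * q)).+1 = msize p + msize q)%N.
Proof.
move=> p0 q0; have -> : (msize (p * q) = (msize p + msize q).-1)%N by exact: msizeM.
by rewrite prednK // addn_gt0 msize_gt0 p0.
Qed.

Lemma mpoly_unitE p : (p \is a GRing.unit) = (msize p == 1%N).
Proof.
apply/idP/msize_poly1P => [/unitrP[q [qp _]]|[c c0 ->]]; last first.
  by rewrite rmorph_unit // unitfE.
have p0 : p != 0 by apply: contra_eq_neq qp => ->; rewrite mulr0 eq_sym oner_eq0.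
have q0 : q != 0 by apply: contra_eq_neq qp => ->; rewrite mul0r eq_sym oner_eq0.
have := msize_mul q0 p0; rewrite qp msize1 => E.
have := msize_gt0 p; have := msize_gt0 q; rewrite p0 q0 => q1 p1.
have /msize1_polyC pC : (msize p <= 1)%N by lia.
by exists p@_0%MM => //; apply: contraNneq p0 => c0; rewrite pC c0 mpolyC0.
Qed.

Lemma deg1_irred p : msize p = 2%N -> irred p.
Proof.
move=> p2; split=> [|a b pE]; first by rewrite mpoly_unitE p2.
have : a * b != 0 by rewrite -pE -msize_gt0 p2.
rewrite mulf_eq0 => /norP[a0 b0]; have := msize_mul a0 b0.
have := msize_gt0 a; have := msize_gt0 b; rewrite a0 b0 -pE p2 !mpoly_unitE.
by move=> b1 a1 E; lia.
Qed.

Lemma homog0_polyC p : p \is 0.-homog -> p = (p@_0%MM)%:MP.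
Proof.
move=> /dhomogP p0; apply: msize1_polyC; rewrite msizeE.
by apply/bigmax_leqP_seq => m /p0 /= ->.
Qed.

Lemma prime_X i : prime_elt ('X_i : R).
Proof.
apply: irred_prime; [exact: factorial_mpoly | | apply: deg1_irred].
  by rewrite -(msize_poly_eq0 'X_i) msizeX.
by rewrite msizeX mdeg1.
Qed.

Lemma X_ndvd_X i j : i != j -> ~ divides ('X_i : R) 'X_j.
Proof.
move=> ij [q E]; have := congr1 (meval (fun l => (l == j)%:R)) E.
by rewrite rmorphM /= !mevalXU eqxx (negPf ij) mul0r => /eqP; rewrite oner_eq0.
Qed.

Lemma msize_mderiv_lt p i : p != 0 -> (msize p^`M(i) < msize p)%N.
Proof.
move=> p0; have [->|d0] := eqVneq p^`M(i) 0; first by rewrite msize0 msize_gt0.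
rewrite -(mlead_deg d0); have := mlead_supp d0.
rewrite mcoeff_msupp mcoeff_mderiv => h.
have /msize_mdeg_lt : (mlead p^`M(i) + U_(i))%MM \in msupp p.
  by rewrite mcoeff_msupp; apply: contraNneq h => ->; rewrite mul0rn.
by rewrite mdegD mdeg1 addn1.
Qed.

Lemma divides_msize p q : q != 0 -> divides p q -> (msize p <= msize q)%N.
Proof.
move=> q0 [r qE]; have := q0; rewrite {1}qE mulf_eq0 => /norP[p0 r0].
have E : ((msize q).+1 = msize p + msize r)%N by rewrite qE; apply: msize_mul.
by have r1 : (0 < msize r)%N; [rewrite msize_gt0 | lia].
Qed.

(** Congruence modulo [a] is stable under sums and products. *)
Lemma mpoly_rmorph_cong (A : idomainType) (f g : {rmorphism R -> A}) (a : A) :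
  (forall c, f c%:MP = g c%:MP) -> (forall i, divides a (f 'X_i - g 'X_i)) ->
  forall p, divides a (f p - g p).
Proof.
move=> fgC fgX p; pose cong (x y : A) := divides a (x - y).
have cM x x' y y' : cong x x' -> cong y y' -> cong (x * y) (x' * y').
  move=> xx yy; rewrite /cong (_ : _ - _ = (x - x') * y + x' * (y - y')); last ring.
  by apply: dividesD; [apply: dividesMr | apply: dividesMl].
have c1 x : cong x x by rewrite /cong subrr; apply: divides0.
rewrite [p]mpolyE !rmorph_sum -sumrB /=; apply: divides_sum => m _.
rewrite -mul_mpolyC !rmorphM fgC mpolyXE_id !rmorph_prod /=; apply: (cM) => //.
apply: (big_ind2 cong) => [|x x1 y y1|i _]; [exact: c1 | exact: cM |].
rewrite !rmorphXn; elim: (m i) => [|l IH]; first exact: c1.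
by rewrite !exprS; apply: (cM) => //; apply: fgX.
Qed.

End Homogeneous.

(** Over a perfect field a polynomial without derivatives is a constant or a
    [q]-th power, so a prime polynomial has a nonzero partial derivative; the
    polynomial cannot divide it, for reasons of degree. *)
Lemma prime_mderiv n (k : closedFieldType) (p : {mpoly k[n]}) : prime_elt p ->
  exists i, ~ divides p p^`M(i).
Proof.
move=> pP; apply: not_all_ex_not => pd; have [p0 pU _] := pP.
have der0 i : p^`M(i) = 0.
  apply/eqP; apply: contraT => d0.
  by have := leq_ltn_trans (divides_msize d0 (pd i)) (msize_mderiv_lt i p0);
    rewrite ltnn.
have coef0 m i : m \in msupp p -> (m i)%:R = 0 :> k.
  move=> mp; case: (posnP (m i)) => [->//|mi].
  have mE : m = (m - U_(i) + U_(i))%MM.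
    apply/mnmP => j; rewrite mnmDE mnmBE mnm1E; case: eqP => [<-|_] /=; lia.
  have := congr1 (mcoeff (m - U_(i))) (der0 i).
  rewrite mcoeff_mderiv -mE mcoeff0 mnmBE mnm1E eqxx subn1 prednK // => E.
  have /eqP : p@_m * (m i)%:R = 0 by rewrite mulr_natr.
  by rewrite mulf_eq0 mcoeff_eq0 mp => /eqP.
case: (classic (exists q, q \in [pchar k])) => [[q qk]|no]; last first.
  move: pU; rewrite mpoly_unitE => /eqP[]; apply/eqP/msize_poly1P.
  have ch0 : [pchar k] =i pred0.
    by move=> r; apply/negbTE/negP => rk; case: no; exists r.
  have supp0 m : m \in msupp p -> m = 0%MM.
    move=> mp; apply/mnmP => i; rewrite mnm0E; apply/eqP.
    by rewrite -((pcharf0P k).1 ch0) (coef0 m i mp).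
  have /msize1_polyC pC : (msize p <= 1)%N.
    by rewrite -(mlead_deg p0) (supp0 _ (mlead_supp p0)) mdeg0.
  by exists p@_0%MM => //; apply: contraNneq p0 => c0; rewrite pC c0 mpolyC0.
have q_pr : prime q by case/andP: qk.
have qR : q \in [pchar {mpoly k[n]}].
  rewrite inE q_pr /= -mpolyC_nat mpolyC_eq0.
  by case/andP: qk.
have qroot (c : k) : exists r, r ^+ q = c.
  have [r] := @solve_monicpoly k q (fun i => if i == 0%N then c else 0) (prime_gt0 q_pr).
  rewrite -(prednK (prime_gt0 q_pr)) big_ord_recl big1 ?addr0 ?mulr1 => [E|i _].
    by exists r; rewrite E.
  by rewrite mul0r.
have [g pE] : exists g, p = g ^+ q.
  rewrite (mpolyE p); have : {subset msupp p <= msupp p} by [].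
  elim: {1 3}(msupp p) => [|m s IH] sp.
    by exists 0; rewrite big_nil expr0n gtn_eqF ?prime_gt0.
  have [|g gE] := IH; first by move=> x xs; apply: sp; rewrite inE xs orbT.
  have [r rE] := qroot p@_m; pose m' := [multinom (m i %/ q)%N | i < n].
  exists (r *: 'X_[m'] + g); rewrite big_cons gE exprDn_pchar.
    2: by rewrite pnatE // qR.
  congr (_ + _); rewrite exprZn rE mpolyXn; congr (_ *: 'X_[_]).
  apply/mnmP => i; rewrite mulmnE mnmE divnK //.
  by rewrite (dvdn_pcharf qk); apply/eqP/coef0/sp; rewrite mem_head.
have [_ /(_ g (g ^+ q.-1))] := prime_irred pP.
have q1 := prime_gt1 q_pr.
have gU : g \isn't a GRing.unit.
  by apply: contra pU => gU; rewrite pE unitrX.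
rewrite pE -exprS prednK ?prime_gt0 // => /(_ erefl)[gg|]; first by rewrite gg in gU.
by rewrite unitrX_pos ?(negPf gU) //; lia.
Qed.

(** * Vectors with three components *)

Notation o0 := (ord0 : 'I_3).
Notation o1 := (Ordinal (isT : 1 < 3)%N).
Notation o2 := (Ordinal (isT : 2 < 3)%N).

Lemma ord3_ind (P : 'I_3 -> Prop) : P o0 -> P o1 -> P o2 -> forall i, P i.
Proof.
move=> P0 P1 P2 [[|[|[|//]]] h].
- by rewrite (_ : Ordinal h = o0) //; apply: val_inj.
- by rewrite (_ : Ordinal h = o1) //; apply: val_inj.
- by rewrite (_ : Ordinal h = o2) //; apply: val_inj.
Qed.

Section Vectors.
Variable S : idomainType.
Implicit Types (a b w t : 'I_3 -> S).

Definition dot a b := \sum_i a i * b i.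

Definition cross a b (i : 'I_3) :=
  a (i + 1) * b (i + 2%:R) - a (i + 2%:R) * b (i + 1).

Lemma sum3 (f : 'I_3 -> S) : \sum_i f i = f o0 + f o1 + f o2.
Proof.
rewrite !big_ord_recl big_ord0 addr0 addrA.
by congr (_ + f _ + f _); apply: val_inj.
Qed.

Lemma dotE a b : dot a b = a o0 * b o0 + a o1 * b o1 + a o2 * b o2.
Proof. exact: sum3. Qed.

Lemma cross0E a b : cross a b o0 = a o1 * b o2 - a o2 * b o1.
Proof. by congr (a _ * b _ - a _ * b _); apply: val_inj. Qed.

Lemma cross1E a b : cross a b o1 = a o2 * b o0 - a o0 * b o2.
Proof. by congr (a _ * b _ - a _ * b _); apply: val_inj. Qed.

Lemma cross2E a b : cross a b o2 = a o0 * b o1 - a o1 * b o0.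
Proof. by congr (a _ * b _ - a _ * b _); apply: val_inj. Qed.

Definition crossE := (cross0E, cross1E, cross2E).

Lemma dot_crossl a b : dot a (cross a b) = 0.
Proof. by rewrite dotE !crossE; ring. Qed.

Lemma dot_crossr a b : dot b (cross a b) = 0.
Proof. by rewrite dotE !crossE; ring. Qed.

(** Cramer's rule, for the matrix with rows [a], [b], [t] applied to [g]. *)
Lemma cramer_dot a b t g j : dot (cross a b) t * g j =
  dot a g * cross b t j + dot b g * cross t a j + dot t g * cross a b j.
Proof. by elim/ord3_ind: j; rewrite !dotE !crossE; ring. Qed.

Lemma cramer_span a b t i j : cross a b i * t j =
  cross t b i * a j + cross a t i * b j + dot (cross a b) t * (i == j)%:R.
Proof.
by elim/ord3_ind: i; elim/ord3_ind: j; rewrite !dotE !crossE /=; ring.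
Qed.

Lemma cross_minors a b : (forall i, cross a b i = 0) ->
  forall i j, a i * b j = a j * b i.
Proof.
move=> ab0; have := ab0 o0; have := ab0 o1; have := ab0 o2; rewrite !crossE.
move=> /subr0_eq h2 /subr0_eq h1 /subr0_eq h0.
by elim/ord3_ind=> //; elim/ord3_ind.
Qed.

Lemma minors_cross p a b :
  (forall i j, divides p (a i * b j - a j * b i)) <->
  (forall i, divides p (cross a b i)).
Proof.
split=> [h i|h i j]; first exact: h.
have N x y : divides p (x - y) -> divides p (y - x).
  by move=> /dividesN; rewrite opprB.
have := h o0; have := h o1; have := h o2; rewrite !crossE => h2 h1 h0.
elim/ord3_ind: i; elim/ord3_ind: j; rewrite ?subrr //;
  by [apply: divides0 | apply: N].
Qed.

Definition coprime_vec w :=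
  forall p, prime_elt p -> ~ (forall i, divides p (w i)).

Hypothesis Sf : factorial_ring S.

Lemma prime_dvdM (p x y : S) : prime_elt p -> divides p (x * y) ->
  divides p x \/ divides p y.
Proof. by case=> _ _; apply. Qed.

(** A prime factor of [c] that did not divide [l] would divide all entries of [w]. *)
Lemma coprime_vec_scalar w : coprime_vec w -> forall c, c != 0 ->
  forall a l, (forall i, c * a i = l * w i) -> exists e, forall i, a i = e * w i.
Proof.
move=> cw c c0; pattern c; apply: factorial_ind c0 => // {c}.
  by move=> u uU a l E; exists (u^-1 * l) => i; rewrite -mulrA -E mulKr.
move=> p c pP _ IH a l E; have p0 : p != 0 by case: pP.
have [l' lE] : divides p l.
  apply: NNPP => pl; apply: (cw p pP) => i.
  by have [] : divides p l \/ divides p (w i);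
    [apply: prime_dvdM; rewrite // -E -mulrA; exists (c * a i) | |].
apply: (IH a l') => i; apply: (mulfI p0).
by rewrite mulrA E lE mulrA.
Qed.

Lemma coprime_vec_parallel w a : coprime_vec w -> (exists i, w i != 0) ->
  (forall i, cross w a i = 0) -> exists e, forall i, a i = e * w i.
Proof.
move=> cw [i0 wi0] /cross_minors E.
by apply: (coprime_vec_scalar cw wi0 (l := a i0)) => i; rewrite E mulrC.
Qed.

(** By Cramer's rule [cross a b i * t] is a combination of [a] and [b]. Its
    coefficients are entries of vectors parallel to the coprime vector
    [cross a b], so [cross a b i] can be cancelled. *)
Lemma coprime_cross_span a b t : coprime_vec (cross a b) ->
  (exists i, cross a b i != 0) -> dot (cross a b) t = 0 ->
  exists x y, forall i, t i = x * a i + y * b i.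
Proof.
move=> cw w0 det0; have span := cramer_span a b t.
have [i|x xE] := @coprime_vec_parallel (cross a b) (cross t b) cw w0.
  have -> : cross (cross a b) (cross t b) i = - b i * dot (cross a b) t.
    by elim/ord3_ind: i; rewrite dotE !crossE; ring.
  by rewrite det0 mulr0.
have [i|y yE] := @coprime_vec_parallel (cross a b) (cross a t) cw w0.
  have -> : cross (cross a b) (cross a t) i = a i * dot (cross a b) t.
    by elim/ord3_ind: i; rewrite dotE !crossE; ring.
  by rewrite det0 mulr0.
exists x, y => i; have [l wl] := w0; apply: (mulfI wl).
by rewrite span det0 mul0r addr0 xE yE; ring.
Qed.

End Vectors.

(** * Ternary forms and logarithmic vector fields *)

Section Ternary.
Variable k : closedFieldType.
Local Notation R := {mpoly k[3]}.
Implicit Types (F p q : R) (A B v w : 'I_3 -> R).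

Let Rf : factorial_ring R := @factorial_mpoly 3 k.

Definition Xv (i : 'I_3) : R := 'X_i.
Definition grad F (i : 'I_3) : R := F^`M(i).
Definition homv n A := forall i, A i \is n.-homog.

Lemma homogM d1 d2 d3 p q : p \is d1.-homog -> q \is d2.-homog ->
  (d1 + d2)%N = d3 -> p * q \is d3.-homog.
Proof. by move=> pa qb <-; apply: dhomogM. Qed.

Lemma homog_X i : ('X_i : R) \is 1.-homog.
Proof. by rewrite dhomogX /= mdeg1. Qed.

Lemma homog_Xn i n : ('X_i : R) ^+ n \is n.-homog.
Proof. by rewrite -[X in X.-homog]mul1n; apply/dhomogMn/homog_X. Qed.

Lemma homv_cross n A : homv n A -> homv n.+1 (cross Xv A).
Proof.
move=> hA i; rewrite /cross /Xv -[n.+1]/(1 + n)%N.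
by apply: rpredB; apply: dhomogM => //; apply: homog_X.
Qed.

Lemma coprime_Xv : coprime_vec Xv.
Proof.
move=> p pP pX; have X0p : divides 'X_o0 p.
  by apply: prime_dvd_prime pP _ (pX o0); apply/prime_irred/prime_X.
by apply: (@X_ndvd_X 3 k o0 o1) => //; apply: divides_trans X0p (pX o1).
Qed.

Lemma Xv_neq0 i : Xv i != 0.
Proof. by rewrite -msize_gt0 msizeX. Qed.

Lemma parallel_Xv A : (forall i, cross Xv A i = 0) ->
  exists e, forall i, A i = e * 'X_i.
Proof.
by apply: coprime_vec_parallel; [| exact: coprime_Xv | exists o0; apply: Xv_neq0].
Qed.

(** Exactness of the Koszul complex of the coordinates: set [X_0 = 0] to solve
    for the last two components. *)
Lemma koszul v : dot Xv v = 0 -> exists A, forall i, v i = cross Xv A i.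
Proof.
rewrite dotE /Xv; set x := 'X_o0; set y := 'X_o1; set z := 'X_o2 => E.
pose s (i : 'I_3) : R := if i == o0 then 0 else 'X_i.
pose r : {rmorphism R -> R} := mmap (@mpolyC 3 k) s.
have rx : r x = 0 by rewrite /r /= mmapX mmap1U.
have ry : r y = y by rewrite /r /= mmapX mmap1U.
have rz : r z = z by rewrite /r /= mmapX mmap1U.
have rcong p : divides x (p - r p).
  apply: (mpoly_rmorph_cong (f := idfun) (g := r)) => [c|] /=.
    by rewrite mmapC.
  elim/ord3_ind.
  - by rewrite rx subr0; apply: divides_refl.
  - by rewrite ry subrr; apply: divides0.
  - by rewrite rz subrr; apply: divides0.
have := congr1 r E; rewrite !rmorphD !rmorphM rmorph0 rx ry rz mul0r add0r => E'.
have [h hE] : divides z (r (v o1)).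
  have [||//] := @prime_dvdM _ z y (r (v o1)) (prime_X k o2).
    by exists (- r (v o2)); rewrite mulrN; apply/eqP; rewrite -addr_eq0 E'.
  by move/(@X_ndvd_X 3 k o2 o1 isT).
have h2 : r (v o2) = - (y * h).
  by apply: (mulfI (Xv_neq0 o2)); rewrite -[Xv o2]/z;
    apply/eqP; rewrite mulrN -addr_eq0 addrC -E' hE; apply/eqP; ring.
have [a1 a1E] := rcong (v o1); have [a2 a2E] := rcong (v o2).
have v1 : v o1 = z * h + x * a1 by rewrite -a1E -hE addrC subrK.
have v2 : v o2 = - (y * h) + x * a2 by rewrite -a2E -h2 addrC subrK.
have v0 : v o0 = - (y * a1) - z * a2.
  apply: (mulfI (Xv_neq0 o0)); rewrite -[Xv o0]/x; apply/eqP; rewrite -subr_eq0.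
  by rewrite -[X in _ == X]E v1 v2; apply/eqP; ring.
exists (fun i => if i == o0 then h else if i == o1 then a2 else - a1).
elim/ord3_ind; rewrite crossE /= /Xv -/x -/y -/z ?v0 ?v1 ?v2; ring.
Qed.

Lemma koszul_homog n v : homv n.+1 v -> dot Xv v = 0 ->
  exists2 A, homv n A & forall i, v i = cross Xv A i.
Proof.
move=> hv /koszul[A vE]; exists (fun i => pihomog mdeg n (A i)).
  by move=> i; apply: pihomogP.
move=> i; rewrite -(pihomog_dE (hv i)) vE /cross pihomogB /Xv.
by rewrite !(pihomogM_homog _ _ (homog_X _)) /= subSS subn0.
Qed.

Lemma dot_Xv_const v : homv 0 v -> dot Xv v = 0 -> forall i, v i = 0.
Proof.
move=> hv Xv0 i; have := congr1 (mcoeff U_(i)) Xv0.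
rewrite /dot mcoeff0 raddf_sum /= (bigD1 i) //= big1 ?addr0 => [|j ji].
  rewrite (homog0_polyC (hv i)) mulrC mul_mpolyC mcoeffZ mcoeffXU eqxx mulr1.
  by move=> ->; rewrite mpolyC0.
by rewrite (homog0_polyC (hv j)) mulrC mul_mpolyC mcoeffZ mcoeffXU (negPf ji) mulr0.
Qed.

Definition squarefree F := forall p, prime_elt p -> ~ divides (p ^+ 2) F.

(** Geometrically, the field [A] on affine space is tangent to the cone over the
    curve. *)
Definition logvec F A := divides F (dot A (grad F)).

(** The minors of [A] divided by [p] are orthogonal to [X], so by exactness of the
    Koszul complex they are the minors of a field [A']; the minors of
    [A - p A'] vanish, which makes it a multiple of the Euler field. *)
Lemma minors_prime_divisor n A p : homv n A -> (exists i, cross Xv A i != 0) ->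
  prime_elt p -> (forall i, divides p (cross Xv A i)) ->
  exists l (A' : 'I_3 -> R) (e : R),
    [/\ (l < n)%N, homv l A' & forall i, A i = e * 'X_i + p * A' i].
Proof.
move=> hA [i0 wi0] pP pw; have wh := homv_cross hA; have [p0 pU _] := pP.
have ph : p \is (mdeg (mlead p)).-homog.
  by have [r rE] := pw i0; apply: (homog_factor (q := r) (N := n.+1)); rewrite -rE.
have /fin_all_exists[v vE] : forall j, exists r : R,
    r \is (n.+1 - mdeg (mlead p)).-homog /\ cross Xv A j = p * r.
  by move=> j; have [r] := homog_cofactor ph (wh j) (pw j); exists r.
have p1 : (0 < mdeg (mlead p))%N.
  move: pU; rewrite mpoly_unitE -(mlead_deg p0).
  by case: (mdeg _).
have pn : (mdeg (mlead p) <= n.+1)%N.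
  exact: homog_divides_le ph (wh i0) wi0 (pw i0).
have Xv0 : dot Xv v = 0.
  apply: (mulfI p0); rewrite mulr0 -[RHS](dot_crossl Xv A) /dot mulr_sumr.
  by apply: eq_bigr => i _; have [_ ->] := vE i; ring.
have {pn} [pn|pn] : (mdeg (mlead p) = n.+1 \/ mdeg (mlead p) <= n)%N by lia.
  have v0 : forall i, v i = 0.
    by apply: dot_Xv_const Xv0 => j; have [] := vE j; rewrite pn subnn.
  by move: wi0; have [_ ->] := vE i0; rewrite v0 mulr0 eqxx.
have [||A' hA' vA'] := @koszul_homog (n - mdeg (mlead p)) v.
- by move=> i; rewrite -subSn //; have [] := vE i.
- by [].
have [i|e eE] := @parallel_Xv (fun i => A i - p * A' i).
  rewrite (_ : cross _ _ i = cross Xv A i - p * cross Xv A' i).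
    by have [_ ->] := vE i; rewrite vA' subrr.
  by rewrite /cross; ring.
exists (n - mdeg (mlead p))%N, A', e; split; [by lia | by [] |].
by move=> i; rewrite -eE subrK.
Qed.

Section Log.
Variables (d : nat) (F : R).
Hypotheses (F0 : F != 0) (Fd : F \is d.-homog) (Fs : squarefree F).

Lemma dot_Xgrad : dot Xv (grad F) = F *+ d.
Proof. exact: euler_homog. Qed.

Lemma logvecX a : logvec F (fun i => a * 'X_i).
Proof.
exists (a *+ d); rewrite mulrnAr mulrC -mulrnAr -dot_Xgrad mulr_sumr.
by apply: eq_bigr => i _; rewrite mulrA.
Qed.

Lemma logvecM a A : logvec F A -> logvec F (fun i => a * A i).
Proof.
move=> [e E]; exists (a * e); rewrite mulrCA -E mulr_sumr.
by apply: eq_bigr => i _; rewrite mulrA.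
Qed.

Lemma logvecB A B : logvec F A -> logvec F B -> logvec F (fun i => A i - B i).
Proof.
move=> FA FB; rewrite /logvec /dot.
under eq_bigr do rewrite mulrBl.
by rewrite sumrB; apply: dividesB.
Qed.

Lemma eq_logvec A B : A =1 B -> logvec F A -> logvec F B.
Proof. by move=> E; rewrite /logvec /dot; under eq_bigr do rewrite E. Qed.

(** Generic smoothness of a reduced curve: along [p = 0] the gradient of [p * H]
    is [H] times that of [p]. *)
Lemma component_grad p : prime_elt p -> divides p F ->
  exists j, ~ divides p (grad F j).
Proof.
move=> pP [H FE]; have [j pj] := prime_mderiv pP; exists j.
rewrite /grad FE mderivM => pd; have /(prime_dvdM pP)[//|[h hE]] :
    divides p (p^`M(j) * H).
  rewrite (_ : _ * H = p^`M(j) * H + p * H^`M(j) - p * H^`M(j)); last by ring.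
  by apply: dividesB => //; apply/dividesMr/divides_refl.
by apply: (Fs pP); rewrite FE hE; exists h; ring.
Qed.

Lemma divides_grad g : (forall j, divides F (g * grad F j)) -> divides F g.
Proof.
move=> Fg; apply: squarefree_divides => // p pP pF.
have [j pj] := component_grad pP pF.
by have [] := prime_dvdM pP (divides_trans pF (Fg j)).
Qed.

(** The Euler field, [A] and [B] are all orthogonal to the gradient of [F] along
    the curve, where it is generically nonzero; so they are dependent there. *)
Lemma log_det A B : logvec F A -> logvec F B ->
  divides F (dot (cross Xv A) B).
Proof.
move=> FA FB; apply: divides_grad => j; rewrite cramer_dot.
have FX : logvec F Xv by apply: eq_logvec (logvecX 1) => i; rewrite mul1r.
by do ![apply: dividesD]; apply: dividesMr.
Qed.

(** A prime [p] that is not a component can be cancelled. Otherwise write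
    [F = p H]: the first hypothesis makes [H] divide the derivative of [F] along
    [A], the second makes [p] divide it, and [p] does not divide [H]. *)
Lemma logvec_cancel p a A : prime_elt p -> ~ divides p a ->
  logvec F (fun i => p * A i) -> logvec F (fun i => a * A i) -> logvec F A.
Proof.
have dotM c : dot (fun i => c * A i) (grad F) = c * dot A (grad F).
  by rewrite /dot mulr_sumr; apply: eq_bigr => i _; rewrite mulrA.
move=> pP pa; rewrite /logvec !dotM; set D := dot A _; have p0 : p != 0 by case: pP.
move=> [u uE] aD; case: (classic (divides p F)) => [pF|pF]; last first.
  have [//|[v vE]] : divides p F \/ divides p u.
    by apply: prime_dvdM; rewrite // -uE; exists D.
  by exists v; apply: (mulfI p0); rewrite uE vE; ring.
have [//|[e eE]] : divides p a \/ divides p D.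
  by apply: prime_dvdM pP _; apply: divides_trans aD.
have [H FE] := pF; have [h hE] : divides H D.
  by exists u; apply: (mulfI p0); rewrite uE FE mulrA.
have [[f fE]|[f fE]] : divides p H \/ divides p h.
  - by apply: prime_dvdM; rewrite // -hE; exists e.
  - by case: (Fs pP); rewrite FE fE; exists f; ring.
by exists f; rewrite hE fE FE; ring.
Qed.

(** A field [B] is a multiple of the Euler field, and defines no foliation,
    exactly when [cross Xv B] vanishes. *)
Definition minimal_log n A :=
  [/\ homv n A, logvec F A, (exists i, cross Xv A i != 0)
    & forall l B, (l < n)%N -> homv l B -> logvec F B ->
        forall i, cross Xv B i = 0].

(** A logarithmic field of least degree generates, with the Euler field, a
    saturated module: clearing a prime [p] from a relation
    [c B = a A + b X] can only fail when [p] divides all minors of [A], and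
    then [A], up to the Euler field, is [p] times a logarithmic field of
    smaller degree. *)
Lemma minimal_log_span n A B : minimal_log n A -> logvec F B ->
  dot (cross Xv A) B = 0 -> exists a b, forall i, B i = a * 'X_i + b * A i.
Proof.
move=> [hA FA [i0 wi0] Amin] FB det0.
suff main c : c != 0 -> forall a b, (forall i, c * B i = a * 'X_i + b * A i) ->
    exists a b, forall i, B i = a * 'X_i + b * A i.
  apply: (main _ wi0 (cross B A i0) (cross Xv B i0)) => j.
  by rewrite cramer_span det0 mul0r addr0.
move=> c0; pattern c; apply: factorial_ind c0 => // {c} [u uU a b E|].
  exists (u^-1 * a), (u^-1 * b) => i.
  by rewrite -!mulrA -mulrDr -E mulKr.
move=> p c pP c0 IH a b E; have [p0 pU _] := pP.
have pX a' : (forall i, divides p (a' * 'X_i)) -> divides p a'.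
  move=> h; apply: NNPP => pa'; apply: (coprime_Xv pP) => i.
  by have [] := prime_dvdM pP (h i).
case: (classic (divides p b)) => [[b' bE]|pb].
  have [a' aE] : divides p a.
    apply: pX => i; rewrite (_ : a * _ = p * (c * B i) - b * A i).
      by rewrite bE; exists (c * B i - b' * A i); ring.
    by rewrite mulrA E; ring.
  apply: (IH a' b') => i; apply: (mulfI p0).
  by rewrite mulrA E aE bE; ring.
(* Modulo [p] the relation makes [b A] parallel to [X]. *)
have pw i : divides p (cross Xv A i).
  have [|/pb//|//] := @prime_dvdM _ p b (cross Xv A i) pP.
  have -> : b * cross Xv A i = cross Xv (fun j => p * c * B j) i.
    by rewrite /cross !E /Xv; ring.
  by exists (cross Xv (fun j => c * B j) i); rewrite /cross; ring.
have [l [A' [e [ln hA' AE]]]] :=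
  minors_prime_divisor hA (ex_intro _ i0 wi0) pP pw.
have [a' aE] : divides p (a + b * e).
  apply: pX => i; exists (c * B i - b * A' i).
  by rewrite mulrBr mulrA E AE; ring.
have FA' : logvec F A'.
  apply: (@logvec_cancel p b) => //.
    by apply: eq_logvec (logvecB FA (logvecX e)) => i; rewrite AE; ring.
  apply: eq_logvec (logvecB (logvecM c FB) (logvecX a')) => i.
  apply: (mulfI p0); rewrite /= mulrBr !mulrA E AE -aE.
  ring.
have A'0 := Amin _ _ ln hA' FA'.
have wE : cross Xv A i0 = p * cross Xv A' i0 by rewrite /cross !AE /Xv; ring.
by rewrite wE A'0 mulr0 eqxx in wi0.
Qed.

(** As [F] is homogeneous, the condition to be logarithmic splits into its graded
    pieces. *)
Lemma logvec_pihomog n B : (0 < d)%N -> logvec F B ->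
  logvec F (fun i => pihomog mdeg n (B i)).
Proof.
move=> d0 [g gE]; have := congr1 (pihomog mdeg (n + d.-1)) gE.
rewrite (pihomogM_homog _ _ Fd) /dot raddf_sum => E.
exists (if (d <= n + d.-1)%N then pihomog mdeg (n + d.-1 - d) g else 0).
rewrite [RHS](_ : _ = if (d <= n + d.-1)%N
  then F * pihomog mdeg (n + d.-1 - d) g else 0); last first.
  by case: ifP; rewrite ?mulr0.
rewrite -E; apply: eq_bigr => i _ /=.
by rewrite [in RHS]mulrC (pihomogM_homog _ _ (homog_mderiv _ Fd)) leq_addl addnK mulrC.
Qed.

End Log.
End Ternary.
Arguments Xv {k} i.

(** * The Hilbert function of the Jacobian ideal *)

Section LinearMaps.
Variable k : closedFieldType.
Local Notation V n := (dhomog 3 k n).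

Lemma hom_of_linear (T U : vectType k) (f : T -> U) : linear f ->
  exists g : 'Hom(T, U), g =1 f.
Proof.
move=> fl; pose fm := GRing.isLinear.Build k T U _ f fl.
pose f' : {linear T -> U} := HB.pack f fm.
by exists (linfun f') => x; rewrite lfunE.
Qed.

Lemma hom_of_homog (T : vectType k) n (f : T -> {mpoly k[3]}) : linear f ->
  (forall x, f x \is n.-homog) ->
  exists g : 'Hom(T, V n), forall x, val (g x) = f x.
Proof.
move=> fl fh; have [|g gE] := @hom_of_linear T (V n) (fun x => DHomog (fh x)).
  by move=> a x y; apply: val_inj; rewrite /= fl.
by exists g => x; rewrite gE.
Qed.

Lemma fst_linear (U W : vectType k) c (x y : (U * W)%type : vectType k) :
  (c *: x + y).1 = c *: x.1 + y.1.
Proof. by []. Qed.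

Lemma snd_linear (U W : vectType k) c (x y : (U * W)%type : vectType k) :
  (c *: x + y).2 = c *: x.2 + y.2.
Proof. by []. Qed.

Lemma dim_forms n : \dim {: V n} = 'C(n + 2, n).
Proof. by rewrite dimvf. Qed.

End LinearMaps.

Section Hilbert.
Variable k : closedFieldType.
Local Notation R := {mpoly k[3]}.
Local Notation V n := (dhomog 3 k n).
Variables (d : nat) (F : R).
Hypotheses (F0 : F != 0) (Fd : F \is d.-homog) (Fs : squarefree F) (d0 : (0 < d)%N).

(** The equation is among the generators, as Euler's relation does not express it
    by the derivatives when the characteristic divides its degree. *)
Definition jacobian (G : R) := exists a (b : 'I_3 -> R),
  G = a * F + \sum_j b j * F^`M(j).

(** Syzygies of degree [n] of the generators [F_0, F_1, F_2, F] are counted by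
    mapping a logarithmic field [B] to [det (X, A, B) / F]: by
    [minimal_log_span] the kernel consists of the combinations of the Euler
    field and [A]. The space [Z] of forms that are not such quotients measures
    how far this map is from being onto. *)
Lemma hilbert_jacobian m A n e (Z : {vspace V e}) s (u : 'I_s -> R) :
  minimal_log F m A -> (m <= n)%N -> (0 < n)%N -> (n + m + 1 = e + d)%N ->
  (forall (q : V e) B, q \in Z -> homv n B -> logvec F B ->
     dot (cross Xv A) B = F * val q -> q = 0) ->
  (forall i, u i \is (n + d.-1).-homog) ->
  (forall c : 'I_s -> k, jacobian (\sum_i c i *: u i) -> forall i, c i = 0) ->
  (s + 3 * 'C(n + 2, n) + \dim Z
     <= 'C(n + d.-1 + 2, n + d.-1) + 'C(n - m + 2, n - m) + 'C(e + 2, e))%N.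
Proof.
move=> Amin mn n0 nme Zcap uh ufree; have [hA FA [i0 wi0] _] := Amin.
have wh := homv_cross hA.
pose T : vectType k := (V n * V n * V n * V n.-1)%type.
pose bb (x : T) (i : 'I_3) : R :=
  val (if i == o0 then x.1.1.1 else if i == o1 then x.1.1.2 else x.1.2).
have bbl i c (x y : T) : bb (c *: x + y) i = c *: bb x i + bb y i.
  rewrite /bb !(fst_linear, snd_linear).
  by case: ifP => _; [|case: ifP => _]; exact: mpoly_of_dhomog_is_linear.
have bbh x i : bb x i \is n.-homog by rewrite /bb; apply: valP.
have dotl w c (x y : T) : dot w (bb (c *: x + y)) = c *: dot w (bb x) + dot w (bb y).
  rewrite /dot scaler_sumr -big_split; apply: eq_bigr => i _.
  by rewrite bbl mulrDr scalerAr.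
have [Phi PhiE] : exists Phi : 'Hom(T, V (n + d.-1)), forall x,
    val (Phi x) = val x.2 * F + dot (grad F) (bb x).
  apply: hom_of_homog => [c x y|x].
    by rewrite dotl mulrDl -scalerAl scalerDr addrACA.
  apply: rpredD.
    by apply: homogM (valP _) Fd _; lia.
  rewrite addnC; apply: rpred_sum => i _; apply: dhomogM => //.
  exact: homog_mderiv.
have [Psi PsiE] : exists Psi : 'Hom(T, V (e + d)), forall x,
    val (Psi x) = dot (cross Xv A) (bb x).
  apply: hom_of_homog => [|x]; first exact: dotl.
  rewrite (_ : (e + d = m.+1 + n)%N); last by lia.
  by apply: rpred_sum => i _; apply: dhomogM.
have [mu muE] : exists mu : 'Hom(V e, V (e + d)), forall q, val (mu q) = F * val q.
  apply: hom_of_homog => [c x y|x].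
    by rewrite /= mulrDr scalerAr.
  by rewrite addnC; apply: dhomogM => //; apply: valP.
have [pi piE] := @hom_of_linear k T _ (fun x => x.1) (fun c x y => erefl).
pose T' : vectType k := (V n.-1 * V (n - m))%type.
have kapi i : exists f : 'Hom(T', V n), forall x,
    val (f x) = val x.1 * 'X_i + val x.2 * A i.
  apply: hom_of_homog => [c x y|x].
    by rewrite /= !mulrDl -!scalerAl scalerDr; ring.
  apply: rpredD.
    by apply: homogM (valP _) (homog_X _ i) _; lia.
  by apply: homogM (valP _) (hA i) _; lia.
have [f0 f0E] := kapi o0; have [f1 f1E] := kapi o1; have [f2 f2E] := kapi o2.
have [|kap kapE] := @hom_of_linear k T' (V n * V n * V n)%type
    (fun x => (f0 x, f1 x, f2 x)).
  by move=> c x y; rewrite (linearP f0) (linearP f1) (linearP f2).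
have logK x : x \in lker Phi -> logvec F (bb x).
  rewrite memv_ker => /eqP E; have := PhiE x; rewrite E => /= {}E.
  exists (- val x.2); rewrite mulrN mulrC; apply/eqP; rewrite -addr_eq0 addrC.
  rewrite E; apply/eqP; congr (_ + _); rewrite /dot.
  by apply: eq_bigr => i _; rewrite mulrC.
pose K := lker Phi.
have dimU : (\dim (K :&: lker Psi) <= 'C(n.-1 + 2, n.-1) + 'C(n - m + 2, n - m))%N.
  have dimT' : \dim {: T'} = ('C(n.-1 + 2, n.-1) + 'C(n - m + 2, n - m))%N.
    by rewrite dimvf.
  rewrite -dimT' -(limg_dim_eq (f := pi)); last first.
    apply/eqP; rewrite -subv0; apply/subvP => x /memv_capP[/memv_capP[xK _]].
    rewrite memv_ker piE memv0 => /eqP x10.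
    have bb0 i : bb x i = 0 by rewrite /bb x10; case: ifP => _; [|case: ifP => _].
    move: xK; rewrite memv_ker => /eqP E; have := PhiE x; rewrite E /=.
    rewrite /dot big1 ?addr0 => [/esym/eqP|i _]; last by rewrite bb0 mulr0.
    rewrite mulf_eq0 (negPf F0) orbF => /eqP x20.
    have {}x20 : x.2 = 0 by apply: val_inj.
    by rewrite [x]surjective_pairing x10 x20.
  rewrite -(limg_ker_dim kap fullv); apply: leq_trans (leq_addl _ _).
  apply/dimvS/subvP => y /memv_imgP[x /memv_capP[xK xP] ->{y}].
  move: xP; rewrite memv_ker piE => /eqP E; have := PsiE x; rewrite E /= => /esym.
  move=> /(minimal_log_span Fd Fs Amin (logK x xK))[a [b abE]].
  have ah : pihomog mdeg n.-1 a \is n.-1.-homog by apply: pihomogP.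
  have bh : pihomog mdeg (n - m) b \is (n - m).-homog by apply: pihomogP.
  apply/memv_imgP; exists (DHomog ah, DHomog bh); first exact: memvf.
  have comp i : bb x i = pihomog mdeg n.-1 a * 'X_i + pihomog mdeg (n - m) b * A i.
    rewrite -(pihomog_dE (bbh x i)) abE raddfD /= ![_ * 'X_i]mulrC ![_ * A i]mulrC.
    by rewrite (pihomogM_homog _ _ (homog_X _ i)) (pihomogM_homog _ _ (hA i)) n0 mn subn1.
  rewrite kapE [x.1]surjective_pairing [x.1.1]surjective_pairing.
  congr (_, _, _); apply: val_inj; rewrite ?f0E ?f1E ?f2E /=.
  - exact: (comp o0).
  - exact: (comp o1).
  - exact: (comp o2).
have mu_inj (U : {vspace V e}) : (U :&: lker mu)%VS = 0%VS.
  apply/eqP; rewrite -subv0; apply/subvP => x /memv_capP[_].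
  rewrite memv_ker memv0 => /eqP E; have := muE x; rewrite E /= => /esym/eqP.
  by rewrite mulf_eq0 (negPf F0) /= => /eqP x0; apply/eqP/val_inj.
have dimPsi : (\dim (Psi @: K) + \dim Z <= 'C(e + 2, e))%N.
  rewrite -(limg_dim_eq (mu_inj Z)) -dimv_disjoint_sum.
    rewrite -(dim_forms k) -(limg_dim_eq (mu_inj fullv)); apply: dimvS.
    rewrite subv_add; apply/andP; split; last by apply: limgS; apply: subvf.
    apply/subvP => _ /memv_imgP[x xK ->].
    have [|q qh qE] := homog_cofactor (p := F) (q := val (Psi x)) Fd (valP _).
      by rewrite PsiE; apply: (log_det (d := d)) => //; apply: logK.
    rewrite addnK in qh; apply/memv_imgP; exists (DHomog qh); rewrite ?memvf //.
    by apply: val_inj; rewrite muE qE.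
  apply/eqP; rewrite -subv0; apply/subvP => _ /memv_capP[/memv_imgP[x xK ->]].
  move=> /memv_imgP[q qZ E]; rewrite E memv0; apply/eqP.
  rewrite (Zcap q (bb x)) ?linear0 //; first exact: logK.
  by rewrite -PsiE E muE.
pose uu i : V (n + d.-1) := DHomog (uh i).
have ut : free [tuple uu i | i < s].
  apply/freeP => c E; apply: ufree; exists 0, (fun=> 0).
  rewrite mul0r add0r [RHS]big1 => [|j _]; last by rewrite mul0r.
  transitivity (val (\sum_(i < s) c i *: [tuple uu i | i < s]`_i)); last by rewrite E.
  rewrite raddf_sum; apply: eq_bigr => i _.
  by rewrite -tnth_nth tnth_mktuple.
have cap0 : (<<[tuple uu i | i < s]>> :&: limg Phi)%VS = 0%VS.
  apply/eqP; rewrite -subv0; apply/subvP => x /memv_capP[xu /memv_imgP[y _ xE]].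
  rewrite memv0 (coord_span xu); apply/eqP; apply: big1 => i _.
  rewrite (ufree (fun j => coord [tuple uu i | i < s] j x)) ?scale0r //.
  exists (val y.2), (bb y); transitivity (val x).
    rewrite [in RHS](coord_span xu) raddf_sum; apply: eq_bigr => j _.
    by rewrite -tnth_nth tnth_mktuple.
  by rewrite xE PhiE; congr (_ + _); apply: eq_bigr => j _; rewrite mulrC.
have dimu : \dim <<[tuple uu i | i < s]>> = s.
  by move/eqP: ut => ->; rewrite size_tuple.
have : (s + \dim (limg Phi) <= 'C(n + d.-1 + 2, n + d.-1))%N.
  by rewrite -{1}dimu -dimv_disjoint_sum // -(dim_forms k); apply/dimvS/subvf.
have := limg_ker_dim Phi fullv; rewrite capfv.
have := limg_ker_dim Psi K.
have -> : \dim {: T} = ('C(n + 2, n) + 'C(n + 2, n) + 'C(n + 2, n)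
    + 'C(n.-1 + 2, n.-1))%N by rewrite dimvf.
by rewrite -/K; move: dimU dimPsi; lia.
Qed.

End Hilbert.

(** A bound for the degree of the singular scheme of the curve, that is, for the
    large values of the Hilbert function of the quotient by the Jacobian ideal.
    Independent families stand for the dimension of the quotient. *)
Definition jacobian_codim_le (k : closedFieldType) (F : {mpoly k[3]}) (b : int) :=
  exists N0, forall N s (u : 'I_s -> {mpoly k[3]}), (N0 <= N)%N ->
    (forall i, u i \is N.-homog) ->
    (forall c : 'I_s -> k, jacobian F (\sum_i c i *: u i) -> forall i, c i = 0) ->
    s%:Z <= b.

Lemma double_bin n : ('C(n + 2, n) * 2 = (n + 1) * (n + 2))%N.
Proof.
rewrite -[X in 'C(_, X)](addnK 2 n) bin_sub ?leq_addl // bin2 muln2.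
have := odd_double_half ((n + 2) * (n + 2).-1); rewrite oddM.
have -> : odd (n + 2) && odd (n + 2).-1 = false.
  by rewrite !addn2 /= negbK; case: odd.
by rewrite add0n => ->; rewrite !addn2 addn1 mulnC.
Qed.

(** In large degree [N] the Hilbert functions in [hilbert_jacobian] are
    polynomials, in whose combination only the constant terms survive. *)
Lemma jacobian_codim (k : closedFieldType) d (F : {mpoly k[3]}) m A z :
  F != 0 -> F \is d.-homog -> squarefree F -> (0 < d)%N -> minimal_log F m A ->
  (exists e0, forall e n, (e0 <= e)%N -> (n + m + 1 = e + d)%N ->
     exists2 Z : {vspace dhomog 3 k e}, (z <= \dim Z)%N &
       forall (q : dhomog 3 k e) B, q \in Z -> homv n B -> logvec F B ->
         dot (cross Xv A) B = F * val q -> q = 0) ->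
  jacobian_codim_le F ((d%:Z - 1) * (d%:Z - m%:Z - 1) + m%:Z ^+ 2 - z%:Z).
Proof.
move=> F0 Fd Fs d0 Amin [e0 Ze].
exists (e0 + m + d + d)%N => N s u Ne uh ufree.
pose n := (N - d.-1)%N; pose e := (n + m + 1 - d)%N.
have nN : (n + d.-1 = N)%N by rewrite /n; lia.
have ne : (n + m + 1 = e + d)%N by rewrite /e /n; lia.
have [||Z zZ Zcap] := Ze e n; [by rewrite /e /n; lia | by [] |].
have := hilbert_jacobian F0 Fd Fs d0 Amin (n := n) (e := e) (Z := Z) (s := s) (u := u).
rewrite nN => /(_ _ _ ne Zcap uh ufree) H.
have {H} : (s + 3 * 'C(n + 2, n) + \dim Z <=
  'C(N + 2, N) + 'C(n - m + 2, n - m) + 'C(e + 2, e))%N.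
  by apply: H; rewrite /n; lia.
have := double_bin n; have := double_bin N; have := double_bin (n - m).
have := double_bin e.
have mn : (m <= n)%N by rewrite /n; lia.
move: 'C(n + 2, n) 'C(N + 2, N) 'C(n - m + 2, n - m) 'C(e + 2, e) => x y v w.
move: (\dim Z) zZ => zd; rewrite -nN.
have [a na] : exists a, n = (a + m)%N by exists (n - m)%N; lia.
have [D dD] : exists D, d = D.+1 by exists d.-1; lia.
rewrite na dD in ne *; rewrite addnK /=.
have e2 : e%:Z * e%:Z = (a%:Z + 2 * m%:Z - D%:Z) * (a%:Z + 2 * m%:Z - D%:Z).
  by congr (_ * _); lia.
lia.
Qed.

(** * A line that avoids the common zeros of coprime forms *)

Section GeneralLine.
Variable k : closedFieldType.
Local Notation R := {mpoly k[3]}.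
Local Notation A2 := {mpoly k[2]}.
Local Notation S := {poly {poly k}}.
Local Notation o1' := (Ordinal (isT : 1 < 2)%N).
Implicit Types (a b t w : 'I_3 -> R).

Let Sf : factorial_ring S := factorial_poly (factorial_poly (@factorial_field k)).

Lemma map_cross (T U : idomainType) (f : {rmorphism T -> U}) (a b : 'I_3 -> T) i :
  f (cross a b i) = cross (f \o a) (f \o b) i.
Proof. by rewrite /cross rmorphB !rmorphM. Qed.

Lemma map_dot (T U : idomainType) (f : {rmorphism T -> U}) (a b : 'I_3 -> T) :
  f (dot a b) = dot (f \o a) (f \o b).
Proof. by rewrite /dot rmorph_sum; apply: eq_bigr => i _; rewrite rmorphM. Qed.

Lemma eq_dot (T : idomainType) (a a' b : 'I_3 -> T) : a =1 a' -> dot a b = dot a' b.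
Proof. by move=> E; apply: eq_bigr => i _; rewrite E. Qed.

Lemma prime_size1 (T : idomainType) (p : {poly T}) c :
  c != 0 -> divides p c%:P -> (size p <= 1)%N.
Proof.
move=> c0 [q E]; have : p * q != 0 by rewrite -E polyC_eq0.
rewrite mulf_eq0 => /norP[p0 q0].
have Es : (1 = (size p + size (q : {poly T})).-1)%N.
  by rewrite -size_mul // -E size_polyC c0.
have : (0 < size (q : {poly T}))%N by rewrite size_poly_gt0.
by move: Es; case: (size (q : {poly T})) => // l; rewrite addnS; lia.
Qed.

(** Coprime polynomials generate an ideal that contains a nonzero polynomial
    free of the last variable, as the generator of least degree of this ideal has
    no prime factor of positive degree. *)
Lemma coprime_elimination n (w : 'I_3 -> {mpoly k[n.+1]}) :
  coprime_vec w -> (exists i, w i != 0) ->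
  exists2 h, h != 0 & exists u : 'I_3 -> {poly {mpoly k[n]}},
    h%:P = \sum_i u i * muni (w i).
Proof.
move=> cw [i0 wi0]; pose I f := exists u : 'I_3 -> {poly {mpoly k[n]}},
  f = \sum_i u i * muni (w i).
have Iw i : I (muni (w i)).
  exists (fun j => (i == j)%:R); rewrite (bigD1 i) //= eqxx mul1r.
  by rewrite big1 ?addr0 // => j ji; rewrite eq_sym (negPf ji) mul0r.
have [|||h [Ih h0 hI]] := @ideal_min _ I.
- move=> f g [u ->] [v ->]; exists (fun i => u i + v i).
  by rewrite -big_split; apply: eq_bigr => i _; rewrite mulrDl.
- move=> f g [u ->]; exists (fun i => g * u i).
  by rewrite mulr_sumr; apply: eq_bigr => i _; rewrite mulrA.
- exists (muni (w i0)) => //; apply: contraNneq wi0 => E.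
  by apply/eqP/(can_inj (@muniK n k)); rewrite E rmorph0.
suff /size1_polyC hE : (size h <= 1)%N.
  by exists h`_0; [rewrite hE polyC_eq0 in h0 | rewrite -hE].
rewrite leqNgt; apply/negP => h1.
have Rf := @factorial_mpoly n k; have Pf := factorial_poly Rf.
have [p [pP ph p1]] : exists p, [/\ prime_elt p, divides p h & (1 < size p)%N].
  apply: NNPP => no; move: h1; apply/negP; rewrite -leqNgt.
  have: forall p, prime_elt p -> divides p h -> (size p <= 1)%N.
    by move=> p pP ph; rewrite leqNgt; apply/negP => p1; apply: no; exists p.
  pattern h; apply: (factorial_ind Pf) h0 => [u|p f pP f0 IH ps].
    by rewrite poly_unitE => /andP[/eqP->].
  have p1 := ps p pP (dividesMr _ (divides_refl _)).
  have f1 : (size f <= 1)%N by apply: IH => q qP qf; apply/ps/dividesMl.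
  by rewrite (size1_polyC p1) (size1_polyC f1) -polyCM size_polyC_leq1.
apply: (cw (muni_inv p)); first exact: (prime_iso (@muniK n k) (@muni_invK n k)).
move=> i; apply: (divides_iso (@muniK n k) (@muni_invK n k)).
have [c c0 hc] := hI _ (Iw i).
have : divides p (c%:P * muni (w i)).
  by rewrite mul_polyC; apply: divides_trans hc.
by move=> /(prime_dvdM pP)[/(prime_size1 c0)|//]; lia.
Qed.

Lemma muni_coef_homog n (p : {mpoly k[n.+1]}) N j : p \is N.-homog ->
  (muni p)`_j \is (N - j).-homog /\ ((N < j)%N -> (muni p)`_j = 0).
Proof.
move=> /dhomogP pN.
have term m : m \in msupp p -> forall c : k,
   (c *: 'X_[[multinom (m (widen_ord (leqnSn n) i)) | i < n]] *:
     'X^(m ord_max) : {poly {mpoly k[n]}})`_j \is (N - j).-homog /\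
   ((N < j)%N -> (c *: 'X_[[multinom (m (widen_ord (leqnSn n) i)) | i < n]] *:
     'X^(m ord_max) : {poly {mpoly k[n]}})`_j = 0).
  move=> /pN /= mN c; rewrite coefZ coefXn; case: eqP => [jE|_]; last first.
    by rewrite mulr0 rpred0.
  rewrite mulr1; have mE : (mdeg [multinom (m (widen_ord (leqnSn n) i)) | i < n]
      + j = N)%N.
    rewrite -mN !mdegE big_ord_recr /= jE; congr (_ + _)%N.
    by apply: eq_bigr => i _; rewrite mnmE.
  split; last by rewrite -mE; lia.
  by apply: dhomogZ; rewrite dhomogX /= -mE addnK.
rewrite muniE coef_sum big_seq; split=> [|Nj].
  by apply: rpred_sum => m /term /(_ p@_m)[].
by apply: big1 => m /term /(_ p@_m)[_]; apply.
Qed.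

Lemma homog_meval0 n (p : {mpoly k[n]}) N : p \is N.-homog -> (0 < N)%N ->
  p.@[fun=> 0] = 0.
Proof.
move=> /dhomogP pN N0; rewrite mevalE big_seq big1 // => m /pN /= mN.
have [i mi] : exists i, (0 < m i)%N.
  apply: NNPP => no; move: N0; rewrite -mN mdegE big1 // => i _.
  by apply/eqP; rewrite -leqn0 leqNgt; apply/negP => mi; apply: no; exists i.
by rewrite (bigD1 i) //= expr0n gtn_eqF // mul0r mulr0.
Qed.

(** At the point (0 : 0 : 1) only the pure power of the last variable survives,
    and its coefficient is a constant. *)
Lemma muni_lead_unit (p : R) N : p \is N.-homog ->
  p.@[fun i => (i == o2)%:R] != 0 -> (muni p)`_N \is a GRing.unit.
Proof.
move=> pN; have := meval_muni p (fun i => (i == o2)%:R).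
rewrite (_ : (ord_max == o2) = true) // => ->.
rewrite (eq_map_poly (g := meval (fun=> 0))); last first.
  move=> q; apply: meval_eq => i /=; case: eqP => // /(congr1 val)/= E.
  by have := ltn_ord i; rewrite E.
have c0 : (muni p)`_N \is 0.-homog by have [] := muni_coef_homog N pN; rewrite subnn.
have -> : map_poly (meval (fun=> 0)) (muni p) = ((muni p)`_N).@[fun=> 0] *: 'X^N.
  apply/polyP => j; rewrite coef_map coefZ coefXn /=; case: eqP => [->|jN].
    by rewrite mulr1.
  rewrite mulr0; have [jh j0] := muni_coef_homog j pN.
  have [/j0 ->|Nj] := ltnP N j; first by rewrite rmorph0.
  by apply: homog_meval0 jh _; lia.
rewrite hornerZ hornerXn expr1n mulr1 => nz.
rewrite (homog0_polyC c0) rmorph_unit // unitfE.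
by apply: contraNneq nz => E; rewrite (homog0_polyC c0) E mpolyC0 meval0.
Qed.

Lemma span_mod (T : idomainType) (l t t' a a' b b' x y : T) :
  divides l (t - t') -> divides l (a - a') -> divides l (b - b') ->
  t' = x * a' + y * b' -> divides l (t - (x * a + y * b)).
Proof.
move=> lt la lb tE; rewrite (_ : _ - _ = (t - t') - x * (a - a') - y * (b - b')).
  exact: dividesB (dividesB lt (dividesMl _ la)) (dividesMl _ lb).
by rewrite tE; ring.
Qed.

(** Restriction to the line [X_1 = c X_0], with [X_0] and [X_2] as coordinates. *)
Definition on_line (c : k) : {rmorphism R -> S} :=
  map_poly (mmap polyC (fun i : 'I_2 => if i == ord0 then 'X else c *: 'X))
    \o @muni 2 k.

(** Choose the line [X_1 = c X_0] such that a form [h] in [X_0], [X_1] of the ideal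
    generated by the minors does not vanish on it. On the line a prime that
    divides all minors then divides [h], so it is free of [X_2], and it divides
    the constant leading coefficient in [X_2] of one minor, so it is a unit. Thus
    [coprime_cross_span] applies on the line, and its coefficients lift. *)
Lemma general_line_chart a b N i1 : coprime_vec (cross a b) ->
  cross a b i1 \is N.-homog -> (cross a b i1).@[fun i => (i == o2)%:R] != 0 ->
  exists c : k, forall t, divides ('X_o1 - c *: 'X_o0) (dot (cross a b) t) ->
    exists x y z, forall i, t i = x * a i + y * b i + ('X_o1 - c *: 'X_o0) * z i.
Proof.
set w := cross a b => cw wN w1.
have w0 : w i1 != 0 by apply: contraNneq w1 => ->; rewrite meval0.
have [h h0 [u hE]] := coprime_elimination cw (ex_intro _ i1 w0).
have [v] : exists v : 'I_2 -> k, (h * 'X_ord0).@[v] != 0.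
  by apply: mpoly_nonroot; rewrite mulf_neq0 // -msize_gt0 msizeX.
rewrite rmorphM /= mevalXU mulf_eq0 => /norP[hv v0].
pose c := v o1' / v ord0; exists c => t.
set L : R := 'X_o1 - _.
pose r : {rmorphism R -> S} := on_line c.
have rX0 : r 'X_o0 = 'X%:P.
  rewrite /r /= (_ : o0 = widen_ord (leqnSn 2) ord0); last exact: val_inj.
  by rewrite muni_Xwiden map_polyC /= mmapX mmap1U.
have rX1 : r 'X_o1 = (c *: 'X)%:P.
  rewrite /r /= (_ : o1 = widen_ord (leqnSn 2) o1'); last exact: val_inj.
  by rewrite muni_Xwiden map_polyC /= mmapX mmap1U.
have rX2 : r 'X_o2 = 'X.
  rewrite /r /= (_ : o2 = ord_max); last exact: val_inj.
  by rewrite muni_Xmax map_polyX.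
have rC e : r e%:MP = e%:P%:P by rewrite /r /= muniC map_polyC /= mmapC.
have rL : r L = 0.
  by rewrite /L -mul_mpolyC rmorphB rmorphM rX0 rX1 rC -polyCM mul_polyC subrr.
pose rho : {rmorphism A2 -> {poly k}} :=
  mmap polyC (fun i : 'I_2 => if i == ord0 then 'X else c *: 'X).
have rhoh : rho h != 0.
  apply: contraNneq hv => E; suff -> : h.@[v] = (rho h).[v ord0] by rewrite E horner0.
  suff : meval v =1 horner_eval (v ord0) \o rho by apply.
  apply: mpoly_rmorph_ext => [e|i] /=.
    by rewrite mevalC mmapC /horner_eval hornerC.
  rewrite mevalXU mmapX mmap1U /horner_eval; case: eqP => [->|i0].
    by rewrite hornerX.
  rewrite hornerZ hornerX /c divfK //; congr v; apply: val_inj => /=.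
  by case: i i0 => [[|[|//]]] // i2 []; apply: val_inj.
have rE p : r p = map_poly rho (muni p) by [].
have wr0 : (r (w i1))`_N \is a GRing.unit.
  by rewrite rE coef_map rmorph_unit // muni_lead_unit.
have cwr : coprime_vec (cross (r \o a) (r \o b)).
  move=> P PP Pw.
  have {}Pw i : divides P (r (w i)) by rewrite map_cross.
  have Ph : divides P (rho h)%:P.
    have -> : (rho h)%:P = map_poly rho h%:P by rewrite map_polyC.
    rewrite hE rmorph_sum; apply: divides_sum => i _.
    by rewrite rmorphM; apply: dividesMl; exact: Pw.
  have /size1_polyC PE := prime_size1 rhoh Ph.
  have [q qE] := Pw i1; have [_ /negP PU _] := PP; apply: PU.
  rewrite PE; apply: rmorph_unit; apply: divides_is_unit wr0 _.
  by exists q`_N; rewrite qE {1}PE coefCM.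
pose sec1 : {rmorphism {poly k} -> R} :=
  horner_eval ('X_o0 : R) \o map_poly (@mpolyC 3 k).
pose sec : {rmorphism S -> R} := horner_eval ('X_o2 : R) \o map_poly sec1.
have secE q : sec q = (map_poly sec1 q).['X_o2] by [].
have secC f : sec f%:P = (map_poly (@mpolyC 3 k) f).['X_o0].
  by rewrite secE map_polyC hornerC.
have secr p : divides L (p - sec (r p)).
  apply: (mpoly_rmorph_cong (f := idfun) (g := sec \o r)) => [e|i].
    transitivity (sec e%:P%:P); last by congr (sec _); rewrite -rC.
    by rewrite secC map_polyC hornerC.
  change (divides L ('X_i - sec (r 'X_i))); elim/ord3_ind: i.
  - by rewrite rX0 secC map_polyX hornerX subrr; apply: divides0.
  - rewrite rX1 secC map_polyZ hornerZ map_polyX hornerX mul_mpolyC.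
    exact: divides_refl.
  - rewrite rX2 secE map_polyX hornerX subrr.
    exact: divides0.
move=> [q qE]; have [||x [y xyE]] :=
  @coprime_cross_span _ Sf (r \o a) (r \o b) (r \o t) cwr.
- exists i1; rewrite -map_cross; apply: contraTneq wr0 => ->.
  by rewrite coef0 unitr0.
- rewrite -(eq_dot _ (map_cross r a b)) -map_dot -/w qE rmorphM rL mul0r //.
have tL i : divides L (t i - (sec x * a i + sec y * b i)).
  apply: (span_mod (secr (t i)) (secr (a i)) (secr (b i))).
  by rewrite -!rmorphM -rmorphD -xyE.
have [z zE] := fin_all_exists tL; exists (sec x), (sec y), z => i.
by rewrite -zE addrC subrK.
Qed.

Lemma subst_rmorph (h : 'I_3 -> R) : exists f : {rmorphism R -> R},
  (forall i, f 'X_i = h i) /\ (forall c, f c%:MP = c%:MP).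
Proof.
exists (mmap (@mpolyC 3 k) h); split=> [i|c] /=; last by rewrite mmapC.
by rewrite mmapX mmap1U.
Qed.

(** Moving the point (0 : 0 : 1) to a point where the vector does not vanish
    reduces the general case to the previous one. *)
Lemma general_line a b N : coprime_vec (cross a b) -> homv N (cross a b) ->
  (exists i, cross a b i != 0) ->
  exists L : R, [/\ L \is 1.-homog, L != 0 &
    forall t, divides L (dot (cross a b) t) ->
    exists x y z, forall i, t i = x * a i + y * b i + L * z i].
Proof.
set w := cross a b => cw wN [i1 w1].
have [v] : exists v : 'I_3 -> k, (w i1 * 'X_o2).@[v] != 0.
  by apply: mpoly_nonroot; rewrite mulf_neq0 // -msize_gt0 msizeX.
rewrite rmorphM /= mevalXU mulf_eq0 => /norP[wv v2].
pose lin (e : 'I_3 -> k) (i : 'I_3) : R :=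
  if i == o2 then (e o2)%:MP * 'X_o2 else 'X_i + (e i)%:MP * 'X_o2.
pose v' (i : 'I_3) := if i == o2 then (v o2)^-1 else - (v i / v o2).
have [f [fX fC]] := subst_rmorph (lin v).
have [g [gX gC]] := subst_rmorph (lin v').
have flin e i : f (lin e i) = if i == o2 then (e o2)%:MP * lin v o2
    else lin v i + (e i)%:MP * lin v o2.
  by rewrite -!fX -(fC (e o2)) -(fC (e i)) -!rmorphM -rmorphD [in LHS]/lin; case: ifP.
have glin e i : g (lin e i) = if i == o2 then (e o2)%:MP * lin v' o2
    else lin v' i + (e i)%:MP * lin v' o2.
  by rewrite -!gX -(gC (e o2)) -(gC (e i)) -!rmorphM -rmorphD [in LHS]/lin; case: ifP.
have fK : cancel f g.
  suff: g \o f =1 idfun by [].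
  apply: mpoly_rmorph_ext => [e|i].
    by rewrite /= fC gC.
  rewrite /= fX glin /lin /v'; elim/ord3_ind: i => /=.
  - by rewrite mulrA -mpolyCM mpolyCN mulNr subrK.
  - by rewrite mulrA -mpolyCM mpolyCN mulNr subrK.
  - by rewrite mulrA -mpolyCM mulfV // mpolyC1 mul1r.
have gK : cancel g f.
  suff: f \o g =1 idfun by [].
  apply: mpoly_rmorph_ext => [e|i].
    by rewrite /= gC fC.
  rewrite /= gX flin /lin /v'; elim/ord3_ind: i => /=.
  - by rewrite mulrA -mpolyCM mulNr divfK // mpolyCN mulNr addrK.
  - by rewrite mulrA -mpolyCM mulNr divfK // mpolyCN mulNr addrK.
  - by rewrite mulrA -mpolyCM mulVf // mpolyC1 mul1r.
have linh e i : lin e i \is 1.-homog.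
  have CX c j : (c%:MP * 'X_j : R) \is 1.-homog.
    by rewrite mul_mpolyC rpredZ // homog_X.
  by rewrite /lin; case: ifP => _ //; apply: rpredD; rewrite ?homog_X.
have fh p n : p \is n.-homog -> f p \is n.-homog.
  move=> /dhomogP pn; rewrite [p]mpolyE rmorph_sum big_seq.
  apply: rpred_sum => m /pn /= <-.
  rewrite -mul_mpolyC rmorphM fC mul_mpolyC rpredZ // mpolyXE_id rmorph_prod mdegE.
  apply: (big_ind2 (fun (p : R) n => p \is n.-homog)) => [|x x' y y' xh yh|i _].
  - exact: dhomog1.
  - exact: dhomogM.
  - by rewrite rmorphXn fX -[X in X.-homog]mul1n; apply: dhomogMn.
have [|||c cP] := @general_line_chart (f \o a) (f \o b) N i1.
- move=> p pP pw; apply: (cw (g p)); first exact: (prime_iso fK gK).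
  by move=> i; apply: (divides_iso fK gK); rewrite map_cross.
- by rewrite -map_cross; apply/fh/wN.
- rewrite -map_cross; apply: contraNneq wv => <-.
  suff : @meval 3 k v =1 meval (fun i => (i == o2)%:R) \o f by move->.
  apply: mpoly_rmorph_ext => [e|i].
    by rewrite /= fC !mevalC.
  rewrite /= fX mevalXU /lin.
  case: eqP => [->|/eqP i2]; rewrite ?rmorphD rmorphM /= !mevalC !mevalXU /= ?mulr1 //.
  by rewrite (negPf i2) add0r.
exists (g ('X_o1 - c *: 'X_o0)); split.
- have -> : g ('X_o1 - c *: 'X_o0) = lin v' o1 - c *: lin v' o0.
    by rewrite -!mul_mpolyC rmorphB rmorphM gC !gX.
  by apply: rpredB; [exact: linh | apply/rpredZ/linh].
- apply: contra_notN (@X_ndvd_X 3 k o0 o1 isT) => /eqP E; exists c%:MP.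
  have /eqP : 'X_o1 - c *: 'X_o0 = 0 :> R by rewrite -(gK ('X_o1 - _)) E rmorph0.
  by rewrite subr_eq0 => /eqP ->; rewrite mulrC mul_mpolyC.
move=> t [q qE]; have [|x [y [z xyzE]]] := cP (f \o t).
  exists (f q); rewrite -(eq_dot _ (map_cross f a b)) -map_dot qE rmorphM gK //.
exists (g x), (g y), (g \o z) => i; have := congr1 g (xyzE i).
by move: ('X_o1 - _) => l; rewrite !rmorphD !rmorphM /= !fK.
Qed.

End GeneralLine.

(** * Leaves and the bound on the Jacobian codimension *)

Lemma ex_min (P : nat -> Prop) n : P n ->
  exists2 m, P m & forall l, P l -> (m <= l)%N.
Proof.
have [N] := ubnP n; elim: N n => // N IH n nN Pn.
case: (classic (exists2 l, P l & (l < n)%N)) => [[l Pl ln]|no].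
  by apply: IH Pl; lia.
exists n => // l Pl; rewrite leqNgt; apply/negP => ln; apply: no; by exists l.
Qed.

Section Bounds.
Variable k : closedFieldType.
Local Notation R := {mpoly k[3]}.
Variables (d : nat) (F : R).
Hypotheses (F0 : F != 0) (Fd : F \is d.-homog) (Fs : squarefree F) (d0 : (0 < d)%N).

Let Rf : factorial_ring R := @factorial_mpoly 3 k.

(** [A] represents a foliation of degree [n] with the curve [F = 0] as leaf. *)
Definition leaf_vec n (A : 'I_3 -> R) :=
  [/\ homv n A, logvec F A & forall g G, G \is g.-homog -> irred G ->
    divides G F -> ~ forall i, divides G (cross Xv A i)].

Lemma homog_neq0_prime (p : R) n : p \is n.-homog -> (0 < n)%N -> p != 0 ->
  exists2 G, prime_elt G & divides G p.
Proof.
move=> /dhomogP pn n0 p0; apply: nonunit_prime_dvd => //.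
rewrite mpoly_unitE -(mlead_deg p0) eqSS.
by rewrite (pn _ (mlead_supp p0)) /= -lt0n.
Qed.

Lemma homog_divisor (p G : R) n : p \is n.-homog -> p != 0 -> divides G p ->
  exists g, G \is g.-homog.
Proof.
move=> pn p0 [r rE]; exists (mdeg (mlead G)).
by apply: (homog_factor (q := r) (N := n)); rewrite -rE.
Qed.

Lemma leaf_vec_neq0 n A : leaf_vec n A -> exists i, cross Xv A i != 0.
Proof.
move=> [_ _ leafA]; apply: NNPP => no.
have [G GP GF] := homog_neq0_prime Fd d0 F0.
have [g Gg] := homog_divisor Fd F0 GF.
apply: (leafA g G) => // [|i]; first exact: prime_irred.
have [->|w0] := eqVneq (cross Xv A i) 0; first exact: divides0.
by case: no; exists i.
Qed.

(** For a point [Q] off the curve and a line [v . X = 0] through [Q], the field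
    [v x grad F] has [F] as a first integral. Its minors are congruent modulo [F]
    to the products of [v . X] with the derivatives of [F]; a component of the
    curve that divides them all is therefore the line [v . X = 0]; but this line
    passes through [Q]. *)
Lemma hamiltonian_leaf_vec : exists A, leaf_vec d.-1 A.
Proof.
have [Q FQ] := mpoly_nonroot F0.
have [v [i1 v1] vQ] : exists2 v : 'I_3 -> k, (exists i, v i != 0)
    & v o0 * Q o0 + v o1 * Q o1 + v o2 * Q o2 = 0.
  have [Q0|Q0] := eqVneq (Q o0) 0.
    exists (fun i => (i == o0)%:R); first by exists o0; rewrite oner_eq0.
    by rewrite /= Q0; ring.
  exists (fun i => if i == o0 then Q o1 else if i == o1 then - Q o0 else 0).
    by exists o1; rewrite /= oppr_eq0.
  by rewrite /=; ring.
pose V i : R := (v i)%:MP; pose L := dot V Xv.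
have L1 : L \is 1.-homog.
  by apply: rpred_sum => i _; rewrite mul_mpolyC rpredZ // homog_X.
have L0 : L != 0.
  apply: contraNneq v1 => E; have := congr1 (mcoeff U_(i1)) E.
  rewrite /L /dot mcoeff0 raddf_sum (bigD1 i1) //= big1 ?addr0 => [|i ii1].
    by rewrite mul_mpolyC mcoeffZ mcoeffXU eqxx mulr1 => ->.
  by rewrite mul_mpolyC mcoeffZ mcoeffXU (negPf ii1) mulr0.
have LI : irred L.
  apply: deg1_irred; rewrite -(mlead_deg L0); congr _.+1.
  by move/dhomogP: L1; apply; apply: mlead_supp.
exists (cross V (grad F)); split.
- move=> i; rewrite /cross !mul_mpolyC.
  by apply: rpredB; apply: rpredZ; apply: homog_mderiv.
- exists 0; rewrite mulr0 -[RHS](dot_crossr V (grad F)) /dot.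
  by apply: eq_bigr => i _; rewrite mulrC.
move=> g G Gg GI GF Gw; have GP : prime_elt G.
  by apply: irred_prime => //; apply: contraNneq F0 => E; have [r ->] := GF;
    rewrite E mul0r.
have [j Gj] := component_grad Fs GP GF.
have [|[u LE]|//] := @prime_dvdM _ G L (grad F j) GP.
  rewrite (_ : _ * _ = V j * (F *+ d) - cross Xv (cross V (grad F)) j).
    by apply: dividesB => //; apply: dividesMl; rewrite -mulr_natr; apply: dividesMr.
  rewrite -(dot_Xgrad Fd) /L.
  by elim/ord3_ind: j {Gj}; rewrite !dotE !crossE; ring.
have [GU|uU] := (proj2 LI) _ _ LE; first by have := proj1 GI; rewrite GU.
have LG : divides L G by exists u^-1; rewrite LE mulrK.
have [r FE] := divides_trans LG GF.
move: FQ; rewrite FE rmorphM /= (_ : L.@[Q] = 0) ?mul0r ?eqxx //.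
by rewrite /L dotE !rmorphD !rmorphM /= !mevalC !mevalXU.
Qed.

Lemma jacobian_codim_mono (b c : int) : b <= c ->
  jacobian_codim_le F b -> jacobian_codim_le F c.
Proof.
move=> bc [N0 H]; exists N0 => N s u N0N uh uf.
exact: le_trans (H N s u N0N uh uf) bc.
Qed.

Lemma jacobian_codim_minimal m A : minimal_log F m A ->
  jacobian_codim_le F ((d%:Z - 1) * (d%:Z - m%:Z - 1) + m%:Z ^+ 2).
Proof.
move=> Amin; rewrite -[X in jacobian_codim_le _ X]subr0.
apply: (jacobian_codim (z := 0) F0 Fd Fs d0 Amin); exists 0%N => e n _ _.
exists 0%VS; first by rewrite dimv0.
by move=> q B; rewrite memv0 => /eqP.
Qed.

Lemma exists_minimal_log n A : leaf_vec n A ->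
  exists2 m, (m <= n)%N & exists B, minimal_log F m B.
Proof.
move=> lA; have [hA FA _] := lA.
pose P l := exists2 B, homv l B & logvec F B /\ exists i, cross Xv B i != 0.
have [|m [B hB [FB B0]] mmin] := @ex_min P n.
  by exists A => //; split=> //; apply: leaf_vec_neq0 lA.
exists m; last exists B.
  by apply: mmin; exists A => //; split=> //; apply: leaf_vec_neq0 lA.
split=> // l C lm hC FC i; apply: contraTeq lm => Ci.
by rewrite -leqNgt; apply: mmin; exists C => //; split=> //; exists i.
Qed.

Variables (m : nat) (A : 'I_3 -> R).
Hypotheses (lA : leaf_vec m A)
  (m_min : forall l B, leaf_vec l B -> (m <= l)%N).

(** If logarithmic fields start in a degree [l < m], a generator [B] there does
    not have the curve as leaf, so some component divides all minors of [B]. As it does not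
    divide all those of [A], the fields [A], [B] and the Euler field are
    independent and [F] divides their determinant, of degree [l + m + 1]. *)
Lemma minimal_log_degree l B : minimal_log F l B -> (l <= m)%N ->
  l = m \/ (l < m)%N /\ (d <= l + m + 1)%N /\
    exists g G, [/\ G \is g.-homog, irred G, divides G F
      & forall i, divides G (cross Xv B i)].
Proof.
move=> Bmin; rewrite leq_eqVlt => /predU1P[->|lm]; [by left | right].
have [hB FB B0 _] := Bmin.
have [g [G [Gg GI GF GB]]] : exists g G, [/\ G \is g.-homog, irred G, divides G F
      & forall i, divides G (cross Xv B i)].
  apply: NNPP => no; suff /m_min : leaf_vec l B by rewrite leqNgt lm.
  by split=> // g G Gg GI GF GB; apply: no; exists g, G.
split=> //; split; last by exists g, G.
have [hA FA leafA] := lA.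
have [E|det0] := eqVneq (dot (cross Xv B) A) 0.
  have [a [b AE]] := minimal_log_span Fd Fs Bmin FA E.
  case: (leafA g G Gg GI GF) => i.
  rewrite (_ : cross Xv A i = b * cross Xv B i); first exact: dividesMl.
  by rewrite /cross !AE /Xv; ring.
have deth : dot (cross Xv B) A \is (l + m + 1).-homog.
  by apply: rpred_sum => i _; apply: homogM (homv_cross hB i) (hA i) _; lia.
exact: homog_divides_le Fd deth det0 (log_det F0 Fd Fs FB FA).
Qed.

Lemma leaf_degree_le : (m <= d.-1)%N.
Proof. by have [B /m_min] := hamiltonian_leaf_vec. Qed.

(** The bound that counting gives with a logarithmic field of least degree [l]
    falls short of the bound at [m] by [(m - l) (l + m + 1 - d)], and both factors
    are nonnegative by [minimal_log_degree]. *)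
Theorem jacobian_codim_leaf :
  jacobian_codim_le F ((d%:Z - 1) * (d%:Z - m%:Z - 1) + m%:Z ^+ 2).
Proof.
have [l lm [B Bmin]] := exists_minimal_log lA.
have := jacobian_codim_minimal Bmin.
have [-> //|[{}lm [dlm _]]] := minimal_log_degree Bmin lm.
apply: jacobian_codim_mono.
have [a mE] : exists a, m = (l + a)%N by exists (m - l)%N; lia.
have [b dE] : exists b, (l + m + 1 = d + b)%N by exists (l + m + 1 - d)%N; lia.
have -> : d%:Z = l%:Z + m%:Z + 1 - b%:Z by lia.
rewrite mE PoszD -subr_ge0 [X in _ <= X](_ : _ = a%:Z * b%:Z); last by ring.
exact: mulr_ge0.
Qed.

(** For an irreducible curve a logarithmic field of degree less than [m] would
    have all its minors, of degree at most [d - 1], divisible by [F]. *)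
Lemma irreducible_minimal_log : irred F -> minimal_log F m A.
Proof.
move=> FI; have [l lm [B Bmin]] := exists_minimal_log lA.
have [lE|[{}lm [_ [g [G [Gg GI GF GB]]]]]] := minimal_log_degree Bmin lm.
  have [hA FA _] := lA; have [_ _ _ Bl] := Bmin.
  by split=> //; [apply: leaf_vec_neq0 lA | rewrite -lE].
have GP : prime_elt G.
  by apply: irred_prime => //; apply: contraNneq F0 => E; have [r ->] := GF;
    rewrite E mul0r.
have FG := prime_dvd_prime GP FI GF.
have [hB _ [i wi] _] := Bmin.
have := homog_divides_le Fd (homv_cross hB i) wi (divides_trans FG (GB i)).
by have := leaf_degree_le; lia.
Qed.

(** A common prime factor of the minors other than [F] could be divided out of [A],
    up to the Euler field, and would leave a logarithmic field of smaller
    degree. *)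
Lemma irreducible_coprime_minors : irred F -> coprime_vec (cross Xv A).
Proof.
move=> FI p pP pw; have Amin := irreducible_minimal_log FI.
have FP : prime_elt F by apply: irred_prime.
have [hA FA leafA] := lA; have [_ _ A0 Al] := Amin.
case: (classic (divides p F)) => pF.
  have Fp := prime_dvd_prime pP FI pF.
  by apply: (leafA d F) => // [|i]; [apply: divides_refl | apply: divides_trans (pw i)].
have [l [B [e [ln hB AE]]]] := minors_prime_divisor hA A0 pP pw.
have FpB : logvec F (fun i => p * B i).
  by apply: eq_logvec (logvecB FA (logvecX Fd e)) => i; rewrite AE; ring.
have FB : logvec F B.
  have [Fp|//] : divides F p \/ divides F (dot B (grad F)).
    apply: prime_dvdM => //; move: FpB; rewrite /logvec /dot mulr_sumr.
    by under eq_bigr do rewrite -mulrA.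
  by case: pF; apply: prime_dvd_prime Fp; rewrite //; apply: prime_irred.
have [i] := A0; rewrite (_ : cross Xv A i = p * cross Xv B i).
  by rewrite (Al _ _ ln hB FB) mulr0 eqxx.
by rewrite /cross !AE /Xv; ring.
Qed.

(** Let [L] be a line avoiding the common zeros of the minors of [A]. Then [L]
    is not a zero divisor modulo the ideal of the forms [det (X, A, B) / F] with
    [B] logarithmic. This ideal is zero in degree [2 m - d], where [B] has degree
    [m - 1] and is a multiple of the Euler field; hence in higher degree it does
    not meet the products of a power of [L] and a form of degree [2 m - d]. *)
Theorem jacobian_codim_irreducible : (d <= 2 * m)%N -> irred F ->
  jacobian_codim_le F ((d%:Z - 1) * (d%:Z - m%:Z - 1) + m%:Z ^+ 2
    - 'C(2 * m + 2 - d, 2)%:Z).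
Proof.
move=> dm FI; have Amin := irreducible_minimal_log FI.
have cw := irreducible_coprime_minors FI.
have [hA FA A0 Al] := Amin; have wh := homv_cross hA.
have FP : prime_elt F by apply: irred_prime.
have md := leaf_degree_le.
have [L [L1 L0 Lspan]] := general_line cw wh A0.
have FL : ~ divides F L.
  by move=> /(homog_divides_le Fd L1 L0); lia.
pose s := (2 * m - d)%N.
have base q t : q \is s.-homog -> logvec F t -> dot (cross Xv A) t = F * q -> q = 0.
  move=> qs Ft E; have Fth := logvec_pihomog Fd m.-1 d0 Ft.
  have th0 := Al m.-1 _ (ltac:(lia)) (fun i => pihomogP _ _ _) Fth.
  apply: (mulfI F0); rewrite mulr0 -E.
  have := dhomogM Fd qs; rewrite -E => /pihomog_dE <-.
  have [e eE] := parallel_Xv th0.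
  transitivity (e * dot Xv (cross Xv A)); last by rewrite dot_crossl mulr0.
  rewrite /dot raddf_sum mulr_sumr /=.
  apply: eq_bigr => i _; rewrite (pihomogM_homog _ _ (wh i)).
  have -> : (m < d + s)%N by rewrite /s; lia.
  by rewrite (_ : (d + s - m.+1 = m.-1)%N) ?eE /Xv; [ring | rewrite /s; lia].
have power j : forall q t, q \is s.-homog -> logvec F t ->
    dot (cross Xv A) t = F * (L ^+ j * q) -> q = 0.
  elim: j => [|j IH] q t qs Ft; first by rewrite expr0 mul1r; apply: base.
  move=> E; have [|x [y [z tE]]] := Lspan t.
    by rewrite E; exists (F * (L ^+ j * q)); rewrite exprS; ring.
  have FLz : logvec F (fun i => L * z i).
    apply: eq_logvec (logvecB (logvecB Ft (logvecX Fd x)) (logvecM y FA)) => i.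
    by rewrite tE /Xv; ring.
  apply: (IH q z) => //.
    have [//|//] : divides F L \/ divides F (dot z (grad F)).
    apply: prime_dvdM => //; move: FLz; rewrite /logvec /dot mulr_sumr.
    by under eq_bigr do rewrite -mulrA.
  apply: (mulfI L0); transitivity (dot (cross Xv A) t).
    rewrite [RHS]dotE !tE !dotE !crossE /Xv; ring.
  by rewrite E exprS; ring.
have -> : 'C(2 * m + 2 - d, 2) = 'C(s + 2, s).
  have -> : (2 * m + 2 - d = s + 2)%N by rewrite /s; lia.
  by rewrite -(bin_sub (leq_addl s 2)) addnK.
apply: (jacobian_codim F0 Fd Fs d0 Amin); exists s => e n se nme.
have [mu muE] : exists mu : 'Hom(dhomog 3 k s, dhomog 3 k e),
    forall q, val (mu q) = L ^+ (e - s) * val q.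
  apply: hom_of_homog => [c x y|x]; first by rewrite /= mulrDr scalerAr.
  by apply: homogM (dhomogMn _ L1) (valP x) _; lia.
exists (limg mu).
  rewrite limg_dim_eq ?dim_forms // capfv; apply/eqP; rewrite -subv0.
  apply/subvP => x; rewrite memv_ker memv0 => /eqP E; have := muE x.
  rewrite E /= => /esym/eqP; rewrite mulf_eq0 expf_eq0 (negPf L0) andbF /=.
  by move=> /eqP x0; apply/eqP/val_inj.
move=> q B /memv_imgP[q' _ ->] hB FB; rewrite muE => E.
suff q0 : q' = 0 by rewrite q0 linear0.
by apply: val_inj; apply: (power (e - s)%N _ B) => //; apply: valP.
Qed.

End Bounds.

(** * Foliations and vector fields *)

Section FractionRep.
Variable T : idomainType.
Import FracField.
Local Notation "x %:F" := (@tofrac T x).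
Lemma frac_rep (s : {fraction T}) :
  exists p : T * T, (p.2 != 0) && (s == p.1%:F / p.2%:F).
Proof.
elim/quotW: s => x; exists (\n_x, \d_x); rewrite denom_ratioP /=.
have d0 : (\d_x)%:F != 0 by rewrite tofrac_eq0 denom_ratioP.
rewrite -[X in X == _](mulfK d0); apply/eqP; congr (_ / _).
rewrite -[LHS]/(mul _ _) !piE; apply/eqmodP; rewrite /= equivfE /mulf.
by rewrite !numden_Ratio ?mulf_neq0 ?oner_eq0 ?denom_ratioP // !mulr1 mulrC.
Qed.
End FractionRep.

Section QuotientRule.
Variable L : fieldType.
Implicit Types a b c e : L.

Lemma quotient_rule_add a a' b b' c c' e e' : b != 0 -> e != 0 ->
  (b * e * (a * e' + e * a' + (c * b' + b * c')) - (a * e + c * b) * (b * e' + e * b'))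
    / (b * e) ^+ 2 = (b * a' - a * b') / b ^+ 2 + (e * c' - c * e') / e ^+ 2.
Proof. by move=> b0 e0; field; rewrite b0 e0. Qed.

Lemma quotient_rule_mul a a' b b' c c' e e' : b != 0 -> e != 0 ->
  (b * e * (a * c' + c * a') - a * c * (b * e' + e * b')) / (b * e) ^+ 2
    = a / b * ((e * c' - c * e') / e ^+ 2) + c / e * ((b * a' - a * b') / b ^+ 2).
Proof. by move=> b0 e0; field; rewrite b0 e0. Qed.

End QuotientRule.

Local Opaque FracField.tofrac.

Section Derivations.
Variable k : closedFieldType.
Local Notation R := {mpoly k[3]}.
Local Notation K := (hfrac k).
Local Notation tf := (@tofrac R).
Implicit Types (F G H : R) (A : 'I_3 -> R) (s t : K).

Definition vder A G := dot A (grad G).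

Lemma vderD A G H : vder A (G + H) = vder A G + vder A H.
Proof.
rewrite /vder /dot -big_split; apply: eq_bigr => i _.
by rewrite /grad mderivD mulrDr.
Qed.

Lemma vderM A G H : vder A (G * H) = G * vder A H + H * vder A G.
Proof.
rewrite /vder /dot !mulr_sumr -big_split; apply: eq_bigr => i _.
by rewrite /grad mderivM /=; ring.
Qed.

Lemma vderC A c : vder A c%:MP = 0.
Proof. by rewrite /vder /dot big1 // => i _; rewrite /grad mderivC mulr0. Qed.

Lemma mderivXU (i j : 'I_3) : ('X_i : R)^`M(j) = (i == j)%:R.
Proof.
rewrite mderivX mnm1E; case: eqP => [->|_]; last by rewrite scale0r.
by rewrite scale1r -{1}[U_(j)%MM]add0m addmK mpolyX0.
Qed.

Lemma vderX A i : vder A 'X_i = A i.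
Proof.
rewrite /vder /dot (bigD1 i) //= /grad mderivXU eqxx mulr1 big1 ?addr0 // => j ji.
by rewrite mderivXU eq_sym (negPf ji) mulr0.
Qed.

Lemma vderXn A i l : 'X_i * vder A ('X_i ^+ l) = 'X_i ^+ l * A i *+ l.
Proof.
elim: l => [|l IH].
  by rewrite expr0 -mpolyC1 vderC mulr0.
rewrite exprS vderM mulrDr mulrCA mulrA -[_ * _ * vder _ _]mulrA IH vderX.
by rewrite mulrS; ring.
Qed.

(** The quotient rule, on a chosen representation of [s] as a fraction. *)
Definition fder A s : K :=
  let p := xchoose (frac_rep s) in
  tf (p.2 * vder A p.1 - p.1 * vder A p.2) / tf p.2 ^+ 2.

Lemma fderE A G H : H != 0 ->
  fder A (tf G / tf H) = tf (H * vder A G - G * vder A H) / tf H ^+ 2.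
Proof.
move=> H0; rewrite /fder; case: (xchoose _) (xchooseP (frac_rep (tf G / tf H))).
move=> a b /= /andP[b0 /eqP E].
have {}E : G * b = a * H.
  by move/eqP: E; rewrite eqr_div ?tofrac_eq0 // -!tofracM tofrac_eq => /eqP.
apply/eqP; rewrite eqr_div ?expf_neq0 ?tofrac_eq0 // -!tofracXn -!tofracM.
rewrite tofrac_eq; apply/eqP; have := congr1 (vder A) E; rewrite !vderM => E'.
transitivity (b * (H * (H * vder A a)) - (a * H) * H * vder A b); first by ring.
have -> : H * vder A a = G * vder A b + b * vder A G - a * vder A H.
  by rewrite E'; ring.
rewrite -E; transitivity (b * (b * (H * vder A G)) - b * (a * H) * vder A H); first by ring.
by rewrite -E; ring.
Qed.

Lemma frac_ind (P : K -> Prop) :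
  (forall G H, H != 0 -> P (tf G / tf H)) -> forall s, P s.
Proof. by move=> PGH s; have [[G H] /andP[H0 /eqP->]] := frac_rep s; apply: PGH. Qed.

Lemma fderD A s t : fder A (s + t) = fder A s + fder A t.
Proof.
elim/frac_ind: s => a b b0; elim/frac_ind: t => c e e0.
have tb : tf b != 0 by rewrite tofrac_eq0.
have te : tf e != 0 by rewrite tofrac_eq0.
rewrite (addf_div _ _ tb te) -!tofracM -tofracD !fderE ?mulf_neq0 // !vderD !vderM.
rewrite !tofracB !tofracM !tofracD !tofracM.
by apply: quotient_rule_add; [exact: tb | exact: te].
Qed.

Lemma fderM A s t : fder A (s * t) = s * fder A t + t * fder A s.
Proof.
elim/frac_ind: s => a b b0; elim/frac_ind: t => c e e0.
have tb : tf b != 0 by rewrite tofrac_eq0.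
have te : tf e != 0 by rewrite tofrac_eq0.
rewrite mulf_div -!tofracM !fderE ?mulf_neq0 // !vderM.
rewrite !tofracB !tofracM !tofracD !tofracM.
by apply: quotient_rule_mul; [exact: tb | exact: te].
Qed.

Lemma fder_const A c : fder A (const c) = 0.
Proof.
rewrite /const -[tf _]divr1 -(tofrac1 R) fderE ?oner_eq0 //.
by rewrite -mpolyC1 !vderC !mulr0 subrr tofrac0 mul0r.
Qed.

Definition minor A (i j : 'I_3) : R := 'X_i * A j - 'X_j * A i.

Lemma sum_minor A i l H : H \is l.-homog ->
  \sum_j minor A i j * H^`M(j) = 'X_i * vder A H - H *+ l * A i.
Proof.
move=> Hl; rewrite -(euler_homog Hl) /vder /dot mulr_sumr mulr_suml -sumrB.
by apply: eq_bigr => j _; rewrite /minor /grad; ring.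
Qed.

Lemma Xf_neq0 i : Xf k i != 0.
Proof. by rewrite tofrac_eq0 -msize_gt0 msizeX. Qed.

Lemma XfX i l : Xf k i ^+ l = tf ('X_i ^+ l).
Proof. by rewrite tofracXn. Qed.

Lemma fder_chart A i l H : H \is l.-homog -> fder A (tf H / Xf k i ^+ l) =
  tf (\sum_j minor A i j * H^`M(j)) / Xf k i ^+ l.+1.
Proof.
move=> Hl; rewrite (sum_minor A i Hl) !XfX.
have X0 j : ('X_i : R) ^+ j != 0 by rewrite expf_neq0 // -msize_gt0 msizeX.
rewrite fderE //; apply/eqP; rewrite eqr_div ?expf_neq0 ?tofrac_eq0 //.
rewrite -!tofracXn -!tofracM tofrac_eq; apply/eqP; rewrite exprS.
transitivity ('X_i ^+ l * ('X_i ^+ l * 'X_i * vder A H)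
  - 'X_i ^+ l * H * ('X_i * vder A ('X_i ^+ l))); first by ring.
by rewrite vderXn; ring.
Qed.

Lemma section0 e i : section e i (0 : K).
Proof.
case: e => [e|e].
  by exists 0%N, e, 0; rewrite rpred0 tofrac0 mul0r; split=> //; lia.
by exists e.+1, 0%N, 0; rewrite rpred0 tofrac0 mul0r; split=> //; lia.
Qed.

Lemma section_add e i s t : section e i s -> section e i t -> section e i (s + t).
Proof.
move=> [n [p [A [pE Ap ->]]]] [n' [p' [B [p'E Bp ->]]]].
exists (n + n')%N, (p + n')%N, (A * 'X_i ^+ n' + B * 'X_i ^+ n); split.
- by lia.
- apply: rpredD; first by apply: homogM Ap (dhomogMn _ (homog_X _ i)) _; lia.
  by apply: homogM Bp (dhomogMn _ (homog_X _ i)) _; lia.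
- have X0 := Xf_neq0 i; rewrite addf_div ?expf_neq0 // -exprD.
  by rewrite !XfX -!tofracM -tofracD.
Qed.

Lemma curve_ideal_sum d F e i (T : eqType) (r : seq T) (f : T -> K) :
  (forall x, x \in r -> curve_ideal d F e i (f x)) ->
  curve_ideal d F e i (\sum_(x <- r) f x).
Proof.
elim: r => [|x r IH] fr.
  by rewrite big_nil; exists 0; [apply: section0 | rewrite mulr0].
rewrite big_cons; have [t1 s1 ->] := fr x (mem_head _ _).
have [|t2 s2 ->] := IH; first by move=> y yr; apply: fr; rewrite inE yr orbT.
by exists (t1 + t2); [apply: section_add | rewrite mulrDr].
Qed.

(** The quotient rule for the derivation along [A], with Euler's relation used to
    write it in terms of the minors of [X] and [A]: these depend only on [A] modulo
    the Euler field, and they are all that a derivation of degree-zero fractions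
    can see of [A]. *)
Definition represents (D : foliation k) n A :=
  [/\ twist D = n%:Z - 1, homv n A
    & forall i l H, H \is l.-homog ->
      D (tf H / Xf k i ^+ l) = tf (\sum_j minor A i j * H^`M(j)) / Xf k i ^+ l.+1].

Lemma ratfun_chart i l H : H \is l.-homog -> ratfun (tf H / Xf k i ^+ l).
Proof.
move=> Hl; exists l, H, ('X_i ^+ l); split=> //; last by rewrite XfX.
  exact: homog_Xn.
by rewrite expf_neq0 // -msize_gt0 msizeX.
Qed.

Lemma homv_minor n A i j : homv n A -> minor A i j \is n.+1.-homog.
Proof.
move=> hA; apply: rpredB; apply: homogM (homog_X _ _) (hA _) _; lia.
Qed.

Lemma homog_sum_minor n A i l H : homv n A -> H \is l.-homog ->
  \sum_j minor A i j * H^`M(j) \is (l + n).-homog.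
Proof.
move=> hA Hl; case: l Hl => [|l] Hl.
  rewrite big1 ?rpred0 // => j _.
  by rewrite (homog0_polyC Hl) mderivC mulr0.
apply: rpred_sum => j _.
by apply: homogM (homv_minor _ _ hA) (homog_mderiv _ Hl) _; lia.
Qed.

Lemma foliation_of_vec n A : homv n A -> (exists i, cross Xv A i != 0) ->
  exists D, represents D n A.
Proof.
move=> hA [i0 wi0].
have reg i a : section 0 i a -> section (n%:Z - 1) i (fder A a).
  move=> [l [p [H [pl Hp ->]]]]; have {pl} pl : p = l by lia.
  rewrite {}pl in Hp; rewrite fder_chart //.
  exists l.+1, (l + n)%N, (\sum_j minor A i j * H^`M(j)).
  by split=> //; [lia | apply: homog_sum_minor].
have nz : exists2 a, ratfun a & fder A a != 0.
  pose i := i0 + 1; pose j := i0 + 2%:R.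
  exists (tf 'X_j / Xf k i ^+ 1); first exact/ratfun_chart/homog_X.
  have := fder_chart A i (homog_X k j); rewrite (sum_minor A i (homog_X k j)) vderX.
  move=> ->; rewrite mulf_neq0 ?invr_eq0 ?expf_neq0 ?Xf_neq0 // tofrac_eq0.
  by rewrite mulr1n.
exists (Foliation (fun a b _ _ => fderD A a b) (fun a b _ _ => fderM A a b)
  (fder_const A) reg nz).
by split=> // i l H Hl; apply: fder_chart.
Qed.

Lemma represents_degree D n A : represents D n A -> fol_degree D = n.
Proof. by move=> [tD _ _]; rewrite /fol_degree tD; lia. Qed.

Lemma prime_pow_divides p c a (u : R) : prime_elt p -> ~ divides p c ->
  divides (p ^+ a) (c * u) -> divides (p ^+ a) u.
Proof.
move=> pP pc; elim: a u => [|a IH] u.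
  by rewrite expr0 => _; exists u; rewrite mul1r.
move=> [v E]; have [//|[w uE]] : divides p c \/ divides p u.
  by apply: prime_dvdM pP _; rewrite E exprS -mulrA; eexists.
have [|z zE] := IH w; last by exists z; rewrite uE zE exprS mulrA.
exists v; have p0 : p != 0 by case: pP.
by apply: (mulfI p0); rewrite mulrCA -uE E exprS mulrA.
Qed.

(** Divisibility on two charts suffices, as powers of distinct variables are coprime. *)
Lemma divides_two_charts F g i j a b : F != 0 -> i != j ->
  divides F ('X_i ^+ a * g) -> divides F ('X_j ^+ b * g) -> divides F g.
Proof.
move=> F0 ij [u uE] [v vE].
have [w wE] : divides ('X_i ^+ a) u.
  apply: (@prime_pow_divides _ ('X_j ^+ b) a u (prime_X k i)).
    by move/(prime_dvdX (prime_X k i)); apply: X_ndvd_X.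
  exists v; apply: (mulfI F0); rewrite mulrCA -uE [RHS]mulrCA -vE; ring.
exists w; have X0 : ('X_i : R) ^+ a != 0 by rewrite expf_neq0 // -msize_gt0 msizeX.
by apply: (mulfI X0); rewrite uE wE; ring.
Qed.

Lemma minor_cross p A : (forall i j, divides p (minor A i j)) <->
  (forall i, divides p (cross Xv A i)).
Proof. exact: minors_cross. Qed.

(** The singular ideal contains all minors of [X] and [A], up to powers of the
    variable of the chart; and [F] divides the derivative along [A] of each of its
    multiples. *)
Lemma leaf_vec_leaf D n A d F : F != 0 -> F \is d.-homog -> (0 < d)%N ->
  represents D n A -> leaf_vec F n A -> leaf D d F.
Proof.
move=> F0 Fd d0 [tD hA chart] [_ FA leafA]; split.
  move=> g G Gg GI GF contained; apply: (leafA g G Gg GI GF); apply/minor_cross.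
  have G0 : G != 0.
    by apply: contraNneq F0 => E; have [r ->] := GF; rewrite E mul0r.
  have main i j : exists a, divides G ('X_i ^+ a * minor A i j).
    (* A monomial section of the dual of the twist: [X_i] if [n = 0], and
       [1 / X_i ^ (n - 1)] otherwise. *)
    have [b [q [bs bq]]] : exists b q, section (- twist D) i b /\
        b = tf ('X_i ^+ q) / Xf k i ^+ (n + q - 1).
      exists (tf ('X_i ^+ (1 - n)) / Xf k i ^+ (n + (1 - n) - 1)), (1 - n)%N.
      split=> //; exists (n + (1 - n) - 1)%N, (1 - n)%N, ('X_i ^+ (1 - n)).
      split=> //; first by rewrite tD; lia.
      exact: homog_Xn.
    have Xj := homog_X k j.
    have [|t [r [p [T [pr Tp tE]]]] E] := contained i (D (tf 'X_j / Xf k i ^+ 1) * b).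
      exists [:: (tf 'X_j / Xf k i ^+ 1, b)]; last by rewrite big_seq1.
      move=> ab; rewrite inE => /eqP -> /=; split=> //.
      by exists 1%N, 1%N, 'X_j; split=> //; lia.
    exists (q + r)%N; exists (T * 'X_i ^+ (2 + (n + q - 1))).
    apply/eqP; rewrite -tofrac_eq; apply/eqP.
    move: E; rewrite chart // (sum_minor A i Xj) vderX mulr1n -/(minor A i j) bq tE.
    rewrite mulf_div mulrA => /eqP; rewrite eqr_div ?mulf_neq0 ?expf_neq0 ?Xf_neq0 //.
    rewrite -!exprD !XfX -!tofracM tofrac_eq => /eqP E; congr tf.
    by rewrite exprD [RHS]mulrA -E mulrC mulrA.
  move=> i j; have [->|ij] := eqVneq i j.
    by rewrite /minor subrr; apply: divides0.
  have [a Ga] := main i j; have [b Gb] := main j i.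
  apply: (divides_two_charts G0 ij Ga).
  rewrite (_ : _ * _ = - ('X_j ^+ b * minor A j i)); first exact: dividesN.
  by rewrite /minor; ring.
move=> i _ [_ [r [p [T [pr Tp ->]]]] ->].
rewrite mulrA -tofracM chart; last by apply: homogM Fd Tp _; lia.
have FTr : F * T \is r.-homog by apply: homogM Fd Tp _; lia.
have [T' T'h T'E] : exists2 T', T' \is (r + n - d).-homog &
    \sum_j minor A i j * (F * T)^`M(j) = F * T'.
  apply: homog_cofactor Fd (homog_sum_minor i hA FTr) _.
  rewrite (sum_minor A i FTr) vderM; apply: dividesB.
    apply/dividesMl/dividesD; first exact/dividesMr/divides_refl.
    exact: dividesMl.
  by rewrite -mulr_natr -!mulrA; apply/dividesMr/divides_refl.
exists (tf T' / Xf k i ^+ r.+1); last by rewrite T'E tofracM mulrA.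
by exists r.+1, (r + n - d)%N, T'; split=> //; rewrite tD; lia.
Qed.

(** Tangency is tested on the local equation [F / X_i ^ d], and the sections of the
    singular ideal are combinations of minors. *)
Lemma leaf_leaf_vec D n A d F : F != 0 -> F \is d.-homog -> (0 < d)%N ->
  represents D n A -> leaf D d F -> leaf_vec F n A.
Proof.
move=> F0 Fd d0 [tD hA chart] [comp tang]; split=> //.
  have main i : exists a, divides F ('X_i ^+ a * vder A F).
    have [|t [r [p [T [pr Tp tE]]]] E] := tang i (tf F / Xf k i ^+ d).
      exists (1 / Xf k i ^+ d); last by rewrite mulrA mulr1.
      by exists d, 0%N, 1; rewrite tofrac1 dhomog1; split=> //; lia.
    exists r.+1; move: E; rewrite chart // tE (sum_minor A i Fd) mulrA => /eqP.
    rewrite eqr_div ?expf_neq0 ?Xf_neq0 // !XfX -!tofracM tofrac_eq => /eqP E.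
    exists (T * 'X_i ^+ d.+1 + 'X_i ^+ r * (A i *+ d)).
    rewrite mulrDr mulrA -E exprS; ring.
  have [a Fa] := main o0; have [b Fb] := main o1.
  exact: (divides_two_charts (i := o0) (j := o1) F0 _ Fa Fb).
move=> g G Gg GI GF /minor_cross Gw; apply: (comp g G Gg GI GF) => i _ [l lP ->].
apply: curve_ideal_sum => ab /lP[[r [p [H [pr Hp ->]]]] [r' [p' [B [pr' Bp ->]]]]].
have {pr} pr : p = r by lia.
rewrite {}pr in Hp; rewrite chart // mulf_div -tofracM -exprD.
have [N0|N0] := eqVneq (\sum_j minor A i j * H^`M(j)) 0.
  by rewrite N0 mul0r tofrac0 mul0r; exists 0; [apply: section0 | rewrite mulr0].
have GN : divides G (\sum_j minor A i j * H^`M(j)).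
  by apply: divides_sum => j _; apply: dividesMr.
have Nh := homog_sum_minor i hA Hp; have gle := homog_divides_le Gg Nh N0 GN.
have [N' N'h ->] := homog_cofactor Gg Nh GN.
exists (tf (N' * B) / Xf k i ^+ (r.+1 + r')); last by rewrite mulrA -tofracM mulrA.
exists (r.+1 + r')%N, (r + n - g + p')%N, (N' * B); split=> //.
  by move: pr'; rewrite tD; lia.
exact: dhomogM.
Qed.

End Derivations.

(** * The vector field of a foliation *)

Section FoliationVector.
Variable k : closedFieldType.
Local Notation R := {mpoly k[3]}.
Local Notation K := (hfrac k).
Local Notation tf := (@tofrac R).
Implicit Types (F G H : R) (s t : K).

Lemma inverse_rule (L : fieldType) (x y u v : L) : x != 0 -> y != 0 ->
  y / x * v + x / y * u = 0 -> y ^+ 2 * v = - (x ^+ 2 * u).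
Proof.
move=> x0 y0 E; apply/eqP; rewrite -addr_eq0 -(mulr0 (x * y)) -E.
by apply/eqP; field; rewrite x0 y0.
Qed.

Lemma transition_rule (L : fieldType) (x y z t u v : L) : x != 0 -> y != 0 ->
  t = z / x * v + x / y * u ->
  x * (y ^+ 2 * t) = z * (y ^+ 2 * v) + y * (x ^+ 2 * u).
Proof. by move=> x0 y0 ->; field; rewrite x0 y0. Qed.

Lemma chart_step (L : fieldType) (a b w y c x : L) : x != 0 -> b != 0 ->
  a / b * (w / x ^+ 2) + y / x * (c / (x * b)) = (a * w + y * c) / (x * (x * b)).
Proof. by move=> x0 b0; field; rewrite x0 b0. Qed.

Variable D : foliation k.
Local Notation X := (@Xf k).

(** These will be the minors of [X] and of the field that represents [D]. *)
Let w i j : K := X i ^+ 2 * D (X j / X i).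

Let rX i j : ratfun (X j / X i).
Proof. by rewrite -[X i]expr1; apply/ratfun_chart/homog_X. Qed.

Let D1 : D 1 = 0.
Proof. by have := der_const D 1; rewrite /const mpolyC1 tofrac1. Qed.

Let w_anti i j : w j i = - w i j.
Proof.
apply: inverse_rule; [exact: Xf_neq0 | exact: Xf_neq0 |].
rewrite -(der_mul D (rX i j) (rX j i)).
by rewrite mulrA divfK ?Xf_neq0 // divff ?Xf_neq0.
Qed.

Let w_cycle : X o0 * w o1 o2 + X o1 * w o2 o0 + X o2 * w o0 o1 = 0.
Proof.
have E : D (X o2 / X o1) =
    X o2 / X o0 * D (X o0 / X o1) + X o0 / X o1 * D (X o2 / X o0).
  by rewrite -(der_mul D (rX o0 o2) (rX o1 o0)) mulrA divfK ?Xf_neq0.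
have := transition_rule (Xf_neq0 k o0) (Xf_neq0 k o1) E.
rewrite -/(w o1 o2) -/(w o1 o0) -/(w o0 o2) => ->.
rewrite (w_anti o0 o1) (w_anti o0 o2) !mulrN.
by rewrite addrK addNr.
Qed.

(** Regularity on the two charts [U_i] and [U_j] bounds the poles of [w i j] by
    coprime denominators, so [w i j] is a form. *)
Let w_poly i j : exists W : R, [/\ w i j = tf W,
  forall N : nat, N%:Z = twist D + 2 -> W \is N.-homog
  & twist D + 2 < 0 -> W = 0].
Proof.
have [->|ij] := eqVneq i j.
  exists 0; rewrite /w divff ?Xf_neq0 // D1 mulr0 tofrac0.
  by split=> // N _; rewrite rpred0.
have sec i' j' : section (twist D) i' (D (X j' / X i')).
  apply: der_regular; exists 1%N, 1%N, 'X_j'; rewrite expr1.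
  by split; [lia | exact: homog_X |].
have [r [p [P [pr Pp PE]]]] := sec i j; have [r' [p' [P' [_ _ P'E]]]] := sec j i.
have E : 'X_j ^+ r' * ('X_i ^+ 2 * P) = 'X_i ^+ r * (- ('X_j ^+ 2 * P')).
  apply/eqP; rewrite -tofrac_eq mulrN tofracN !tofracM -!XfX -addr_eq0; apply/eqP.
  have := w_anti i j; rewrite /w PE P'E => /eqP; rewrite -addr_eq0 => /eqP {}E.
  have Xr : X i ^+ r != 0 by rewrite expf_neq0 ?Xf_neq0.
  have Xr' : X j ^+ r' != 0 by rewrite expf_neq0 ?Xf_neq0.
  transitivity (X i ^+ r * X j ^+ r' * (X j ^+ 2 * (tf P' / X j ^+ r') +
    X i ^+ 2 * (tf P / X i ^+ r))); last by rewrite E mulr0.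
  rewrite mulrDr addrC; congr (_ + _).
    by rewrite -[RHS]mulrA; congr (_ * _);
      rewrite mulrCA [X in _ = _ * X]mulrCA (mulfV Xr') mulr1.
  rewrite [X i ^+ r * _]mulrC -[RHS]mulrA; congr (_ * _).
  by rewrite mulrCA [X in _ = _ * X]mulrCA (mulfV Xr) mulr1.
have [W0 W0E] : divides ('X_i ^+ r) ('X_i ^+ 2 * P).
  apply: (@prime_pow_divides _ _ ('X_j ^+ r') _ _ (prime_X k i)).
    by move/(prime_dvdX (prime_X k i)); apply: X_ndvd_X.
  by rewrite E; eexists.
have Ph : 'X_i ^+ 2 * P \is (2 + p).-homog.
  by apply: dhomogM Pp; apply: homog_Xn.
have Xh := homog_Xn k i r.
have [W Wh WE] := homog_cofactor Xh Ph (ex_intro _ W0 W0E).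
exists W; split=> [|N NE|neg].
- rewrite /w PE mulrA XfX -tofracM WE tofracM -XfX mulrC mulKf //.
  by rewrite expf_neq0 ?Xf_neq0.
- by rewrite (_ : N = 2 + p - r)%N //; lia.
- apply/eqP; apply: contraT => W_neq0; have : 'X_i ^+ 2 * P != 0.
    by rewrite WE mulf_neq0 // expf_neq0 // -msize_gt0 msizeX.
  by move=> /(homog_divides_le Xh Ph) /(_ (ex_intro _ W0 W0E)); lia.
Qed.

Section Chart.
Variable W : 'I_3 -> 'I_3 -> R.
Hypothesis wW : forall i j, w i j = tf (W i j).

Let chart_monomial i l (m : 'X_{1..3}) : mdeg m = l ->
  D (tf 'X_[m] / X i ^+ l) = tf (\sum_j W i j * ('X_[m])^`M(j)) / X i ^+ l.+1.
Proof.
elim: l m => [|l IH] m ml.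
  have -> : m = 0%MM by apply/eqP; rewrite -mdeg_eq0 ml.
  rewrite mpolyX0 tofrac1 expr0 divr1 D1 big1 ?tofrac0 ?mul0r // => j _.
  by rewrite -mpolyC1 mderivC mulr0.
have [j mj] : exists j, (0 < m j)%N.
  apply: NNPP => no; move: ml; rewrite mdegE big1 // => j _.
  by apply/eqP; rewrite -leqn0 leqNgt; apply/negP => mj; apply: no; exists j.
have mE : m = (m - U_(j) + U_(j))%MM.
  apply/mnmP => h; rewrite mnmDE mnmBE mnm1E; case: eqP => [<-|_] /=; lia.
set m' := (m - U_(j))%MM in mE; have m'l : mdeg m' = l.
  by have := congr1 mdeg mE; rewrite mdegD mdeg1 ml; lia.
rewrite mE mpolyXD.
have -> : \sum_j0 W i j0 * ('X_[m'] * 'X_j)^`M(j0) =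
    'X_[m'] * W i j + 'X_j * \sum_j0 W i j0 * ('X_[m'])^`M(j0).
  rewrite mulr_sumr (_ : _ * W i j = \sum_j0 'X_[m'] * W i j0 * (j == j0)%:R).
    by rewrite -big_split; apply: eq_bigr => h _; rewrite mderivM mderivXU /=; ring.
  rewrite (bigD1 j) //= eqxx mulr1 big1 ?addr0 // => h hj.
  by rewrite eq_sym (negPf hj) mulr0.
have m'h : ('X_[m'] : R) \is l.-homog by rewrite dhomogX /= m'l.
rewrite tofracM exprSr -mulf_div (der_mul D (ratfun_chart i m'h) (rX i j)) IH //.
have -> : D (X j / X i) = tf (W i j) / X i ^+ 2.
  by rewrite -wW /w mulrAC divff ?mul1r // expf_neq0 ?Xf_neq0.
rewrite tofracD !tofracM [X i ^+ l.+2]exprS [X i ^+ l.+1]exprS.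
apply: chart_step; first exact: Xf_neq0.
by rewrite expf_neq0 ?Xf_neq0.
Qed.

Lemma foliation_chart i l H : H \is l.-homog ->
  D (tf H / X i ^+ l) = tf (\sum_j W i j * H^`M(j)) / X i ^+ l.+1.
Proof.
move=> /dhomogP Hl; pose S r := \sum_(m <- r) H@_m *: ('X_[m] : R).
suff main r : {subset r <= msupp H} ->
    D (tf (S r) / X i ^+ l) = tf (\sum_j W i j * (S r)^`M(j)) / X i ^+ l.+1.
  by rewrite (mpolyE H); apply: main.
rewrite /S; elim: r => [|m r IH] sub.
  rewrite !big_nil tofrac0 mul0r big1 => [|j _]; last by rewrite mderiv0 mulr0.
  rewrite tofrac0 mul0r; have := der_const D 0.
  by rewrite /const mpolyC0 tofrac0.
have hom m' : m' \in m :: r -> (H@_m' *: 'X_[m'] : R) \is l.-homog.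
  by move=> /sub /Hl /= ml; rewrite rpredZ // dhomogX /= ml.
have Sh : S r \is l.-homog.
  rewrite /S big_seq; apply: rpred_sum => m' m'r; apply: hom.
  by rewrite inE m'r orbT.
rewrite big_cons -/(S r) tofracD mulrDl.
rewrite (der_add D (ratfun_chart i (hom m (mem_head _ _))) (ratfun_chart i Sh)).
rewrite {2}/S IH => [|m' m'r]; last by apply: sub; rewrite inE m'r orbT.
rewrite -/(S r).
have -> : \sum_j W i j * (H@_m *: 'X_[m] + S r)^`M(j) =
   (H@_m)%:MP * (\sum_j W i j * ('X_[m])^`M(j)) + \sum_j W i j * (S r)^`M(j).
  rewrite mulr_sumr -big_split; apply: eq_bigr => j _.
  by rewrite mderivD mderivZ -mul_mpolyC /=; ring.
rewrite tofracD mulrDl tofracM; congr (_ + _).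
have ml : mdeg m = l by apply: Hl; apply: sub; rewrite mem_head.
have mh : ('X_[m] : R) \is l.-homog by rewrite dhomogX /= ml.
have rc : ratfun (const H@_m).
  exists 0%N, (H@_m)%:MP, 1; rewrite tofrac1 divr1 oner_eq0 dhomog1; split=> //.
  by rewrite -alg_mpolyC rpredZ // dhomog1.
rewrite -mul_mpolyC tofracM -mulrA (der_mul D rc (ratfun_chart i mh)).
by rewrite der_const mulr0 addr0 (chart_monomial i ml) mulrA.
Qed.

End Chart.

(** The surjection in the Euler sequence, on global sections: the forms [w i j] are
    antisymmetric and satisfy the cocycle relation [w_cycle], so by exactness of
    the Koszul complex they are the minors of [X] and a vector of forms. *)
Theorem vec_of_foliation : exists n A, represents D n A.
Proof.
have [W WP] := fin_all_exists (fun i => fin_all_exists (w_poly i)).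
have wW i j : w i j = tf (W i j) by have [] := WP i j.
have chart := foliation_chart wW.
have W_anti i j : W j i = - W i j.
  by apply/eqP; rewrite -tofrac_eq tofracN -!wW w_anti.
have W_diag i : W i i = 0.
  apply/eqP; rewrite -tofrac_eq -wW tofrac0 /w divff ?Xf_neq0 //.
  by rewrite D1 mulr0.
have Wnz : exists i j, W i j != 0.
  apply: NNPP => no; have W0 i j : W i j = 0.
    by apply/eqP; apply: contraT => Wij; case: no; exists i, j.
  have Dchart l H : H \is l.-homog -> D (tf H / X o0 ^+ l) = 0.
    move=> Hl; rewrite chart // big1 => [|j _]; last by rewrite W0 mul0r.
    by rewrite tofrac0 mul0r.
  have [a ra] := der_neq0 D; case/negP; apply/eqP.
  have [l [G [H [Gl Hl H0 aE]]]] := ra; have := Dchart l G Gl.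
  have H0' : tf H != 0 by rewrite tofrac_eq0.
  have -> : tf G / X o0 ^+ l = a * (tf H / X o0 ^+ l) by rewrite aE mulrA divfK.
  rewrite (der_mul D ra (ratfun_chart o0 Hl)) Dchart // mulr0 add0r => /eqP.
  rewrite !mulf_eq0 invr_eq0 expf_eq0 (negPf H0') (negPf (Xf_neq0 k o0)) andbF /=.
  by move/eqP.
have [N NE] : exists N : nat, N%:Z = twist D + 2.
  case E: (twist D + 2) => [N|N]; first by exists N.
  have [i [j]] := Wnz; have [_ _ ->] := WP i j; first by rewrite eqxx.
  by rewrite E.
have Wh i j : W i j \is N.-homog by have [_ h _] := WP i j; apply: h.
pose v i := W (i + 1) (i + 2%:R).
have v0 : v o0 = W o1 o2 by congr W; apply: val_inj.
have v1 : v o1 = W o2 o0 by congr W; apply: val_inj.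
have v2 : v o2 = W o0 o1 by congr W; apply: val_inj.
have Xv0 : dot Xv v = 0.
  apply/eqP; rewrite -tofrac_eq dotE v0 v1 v2 tofrac0 !tofracD !tofracM -!wW.
  by rewrite -[X in _ == X]w_cycle.
have Wv (P : R -> Prop) : P 0 -> (forall x, P x -> P (- x)) ->
    (forall i, P (v i)) -> forall i j, P (W i j).
  move=> P0 PN Pv; have := Pv o0; have := Pv o1; have := Pv o2.
  rewrite v0 v1 v2 => p01 p20 p12.
  elim/ord3_ind; elim/ord3_ind; rewrite ?W_diag //;
    by rewrite W_anti; apply: PN.
have N0 : (0 < N)%N.
  rewrite lt0n; apply/eqP => N0; have [i [j]] := Wnz; case/negP; apply/eqP.
  apply: (Wv (fun x => x = 0)) => [//|x ->|{}i]; first by rewrite oppr0.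
  by apply: dot_Xv_const Xv0 i => i; have := Wh (i + 1) (i + 2%:R); rewrite {1}N0.
have [|A hA vA] := @koszul_homog k N.-1 v _ Xv0.
  by move=> i; rewrite prednK //; apply: Wh.
have WA i j : W i j = minor A i j.
  have := vA o0; have := vA o1; have := vA o2.
  rewrite v0 v1 v2 !crossE => e01 e20 e12; rewrite /minor /Xv in e01 e20 e12 *.
  elim/ord3_ind: i; elim/ord3_ind: j; rewrite ?W_diag ?subrr //;
    by rewrite W_anti ?e01 ?e20 ?e12 opprB.
exists N.-1, A; split=> //; first by lia.
move=> i l H Hl; rewrite chart //; congr (tf _ / _).
by apply: eq_bigr => j _; rewrite WA.
Qed.

End FoliationVector.

(** * Local algebras of the singular points *)

Section LocalRings.
Variable k : closedFieldType.
Local Notation R := {mpoly k[3]}.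
Local Notation K := (hfrac k).
Local Notation tf := (@tofrac R).
Local Notation X := (@Xf k).
Implicit Types (G H : R) (s t : K) (P Q : 'rV[k]_3).

Lemma local_ring0 P : local_ring P (0 : K).
Proof. by exists 0%N, 0, 1; rewrite rpred0 dhomog1 rmorph1 oner_eq0 tofrac0 mul0r. Qed.

Lemma local_ring_const P c : local_ring P (const c : K).
Proof.
exists 0%N, c%:MP, 1; rewrite dhomog1 rmorph1 oner_eq0 tofrac1 divr1; split=> //.
by rewrite -alg_mpolyC rpredZ // dhomog1.
Qed.

Lemma local_ring1 P : local_ring P (1 : K).
Proof. by have := local_ring_const P 1; rewrite /const mpolyC1 tofrac1. Qed.

Lemma tf_neq0 P H : H.@[P 0] != 0 -> tf H != 0.
Proof. by rewrite tofrac_eq0; apply: contraNneq => ->; rewrite meval0. Qed.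

Lemma local_ringD P s t : local_ring P s -> local_ring P t -> local_ring P (s + t).
Proof.
move=> [n [A [B [An Bn BP ->]]]] [n' [A' [B' [An' Bn' BP' ->]]]].
exists (n + n')%N, (A * B' + A' * B), (B * B'); split.
- by apply: rpredD; [apply: dhomogM | rewrite addnC; apply: dhomogM].
- exact: dhomogM.
- by rewrite mevalM mulf_neq0.
- by rewrite (addf_div _ _ (tf_neq0 BP) (tf_neq0 BP')) -!tofracM -tofracD.
Qed.

Lemma local_ringM P s t : local_ring P s -> local_ring P t -> local_ring P (s * t).
Proof.
move=> [n [A [B [An Bn BP ->]]]] [n' [A' [B' [An' Bn' BP' ->]]]].
exists (n + n')%N, (A * A'), (B * B'); split; rewrite ?dhomogM //.
- by rewrite mevalM mulf_neq0.
- by rewrite mulf_div -!tofracM.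
Qed.

Lemma common_denominator P m (u : 'I_m -> K) : (forall x, local_ring P (u x)) ->
  exists n H, [/\ H \is n.-homog, H.@[P 0] != 0
    & forall x, exists2 A, A \is n.-homog & u x = tf A / tf H].
Proof.
elim: m u => [|m IH] u uP.
  by exists 0%N, 1; rewrite dhomog1 rmorph1 oner_eq0; split=> // -[].
have [n [H [Hn HP uH]]] := IH (fun x => u (lift ord0 x)) (fun x => uP _).
have [n' [A [H' [An Hn' HP' uE]]]] := uP ord0.
exists (n + n')%N, (H * H'); split; rewrite ?dhomogM //.
  by rewrite mevalM mulf_neq0.
move=> x; case: (unliftP ord0 x) => [y ->|->].
  have [B Bn ->] := uH y; exists (B * H'); first exact: dhomogM.
  by rewrite !tofracM -mulf_div divff ?mulr1 ?(tf_neq0 HP').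
exists (A * H); first by rewrite addnC; apply: dhomogM.
by rewrite uE !tofracM [tf H * _]mulrC -mulf_div divff ?mulr1 ?(tf_neq0 HP).
Qed.

Variables (d : nat) (F : R).
Hypotheses (Fd : F \is d.-homog) (d0 : (0 < d)%N).
Local Notation I := (tjurina_ideal d F).

Lemma tjurina_idealD i P s t : I i P s -> I i P t -> I i P (s + t).
Proof.
move=> [a [b [aP bP ->]]] [a' [b' [aP' bP' ->]]].
exists (a + a'), (fun j => b j + b' j); split.
- exact: local_ringD.
- by move=> j; apply: local_ringD.
rewrite mulrDl addrACA -big_split; congr (_ + _).
by apply: eq_bigr => j _; rewrite mulrDl.
Qed.

Lemma tjurina_idealM i P s t : local_ring P s -> I i P t -> I i P (s * t).
Proof.
move=> sP [a [b [aP bP ->]]]; exists (s * a), (fun j => s * b j); split.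
- exact: local_ringM.
- by move=> j; apply: local_ringM.
rewrite mulrDr mulrA mulr_sumr; congr (_ + _).
by apply: eq_bigr => j _; rewrite mulrA.
Qed.

Lemma tjurina_ideal0 i P : I i P 0.
Proof.
exists 0, (fun=> 0); split; [exact: local_ring0 | by move=> _; apply: local_ring0 |].
by rewrite mul0r add0r big1 // => j _; rewrite mul0r.
Qed.

Lemma tjurina_ideal_sum i P (T : Type) (r : seq T) (p : pred T) (f : T -> K) :
  (forall x, p x -> I i P (f x)) -> I i P (\sum_(x <- r | p x) f x).
Proof.
move=> fI; elim/big_rec: _ => [|x s px sI]; first exact: tjurina_ideal0.
by apply: tjurina_idealD => //; apply: fI.
Qed.

(** By Euler's relation the derivative along [X_i] may be dropped from the
    generators in the chart [U_i], so the Jacobian ideal localizes into the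
    ideal that defines the Tjurina number. *)
Lemma jacobian_local i P n G H : P 0 i != 0 -> jacobian F G ->
  G \is n.-homog -> H \is n.-homog -> H.@[P 0] != 0 -> I i P (tf G / tf H).
Proof.
move=> Pi [a [b GE]] Gn Hn HP.
have XG : 'X_i * G = F * ('X_i * a + b i *+ d) +
    \sum_(j | j != i) F^`M(j) * ('X_i * b j - 'X_j * b i).
  have := euler_homog Fd; rewrite (bigD1 i) //= => /(canRL (addrK _)) E.
  rewrite GE mulrDr mulr_sumr (bigD1 i) //= ['X_i * (b i * _)]mulrCA E.
  rewrite mulrBr mulr_sumr mulrDr !mulrnAr [b i * F]mulrC.
  have -> : \sum_(j | j != i) F^`M(j) * ('X_i * b j - 'X_j * b i) =
      \sum_(j | j != i) 'X_i * (b j * F^`M(j)) - \sum_(j | j != i) b i * ('X_j * F^`M(j)).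
    by rewrite -sumrB; apply: eq_bigr => j _; ring.
  move: (F * b i *+ d) => fb; ring.
pose cut e (p : R) := if (e <= n.+1)%N then pihomog mdeg (n.+1 - e) p else 0.
have cuth e p : (cut e p * 'X_i ^+ e) \is n.+1.-homog.
  rewrite /cut; have [en|_] := boolP (e <= n.+1)%N; last first.
    by rewrite mul0r dhomog0.
  exact: homogM (pihomogP mdeg (n.+1 - e) p) (homog_Xn k i e) (subnK en).
have cutE e (p q : R) : p \is e.-homog -> pihomog mdeg n.+1 (p * q) = p * cut e q.
  by move=> pe; rewrite (pihomogM_homog _ _ pe) /cut; case: ifP; rewrite ?mulr0.
have XGE : 'X_i * G = F * cut d ('X_i * a + b i *+ d) +
    \sum_(j | j != i) F^`M(j) * cut d.-1 ('X_i * b j - 'X_j * b i).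
  have XGh : 'X_i * G \is n.+1.-homog by apply: homogM (homog_X _ i) Gn _.
  rewrite -(pihomog_dE XGh) XG pihomogD (cutE _ _ _ Fd) raddf_sum /=.
  by congr (_ + _); apply: eq_bigr => j _; rewrite (cutE d.-1) ?homog_mderiv.
have XH : 'X_i * H \is n.+1.-homog by apply: homogM (homog_X _ i) Hn _.
have XHP : ('X_i * H).@[P 0] != 0 by rewrite mevalM mevalXU mulf_neq0.
have X0 e : X i ^+ e != 0 by rewrite expf_neq0 ?Xf_neq0.
exists (tf (cut d ('X_i * a + b i *+ d) * 'X_i ^+ d) / tf ('X_i * H)),
  (fun j => tf (cut d.-1 ('X_i * b j - 'X_j * b i) * 'X_i ^+ d.-1) / tf ('X_i * H)).
split.
- by exists n.+1, (cut d ('X_i * a + b i *+ d) * 'X_i ^+ d), ('X_i * H).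
- by move=> j; exists n.+1, (cut d.-1 ('X_i * b j - 'X_j * b i) * 'X_i ^+ d.-1), ('X_i * H).
transitivity (tf ('X_i * G) / tf ('X_i * H)).
  by rewrite !tofracM -mulf_div divff ?Xf_neq0 // mul1r.
have term e c f : tf (c * 'X_i ^+ e) / tf ('X_i * H) * (tf f / X i ^+ e) =
    tf (f * c) / tf ('X_i * H).
  rewrite !tofracM -XfX mulf_div [tf c * _ * _]mulrAC -mulf_div divff // mulr1.
  by rewrite [tf c * _]mulrC.
rewrite XGE tofracD mulrDl term; congr (_ + _).
rewrite raddf_sum mulr_suml; apply: eq_bigr => j _.
by rewrite term.
Qed.

Definition independent (i : 'I_3) P m (u : 'I_m -> K) :=
  (forall x, local_ring P (u x)) /\
  forall c : 'I_m -> k, I i P (\sum_x const (c x) * u x) -> forall x, c x = 0.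

Lemma constM (c : k) G : const c * tf G = tf (c *: G).
Proof. by rewrite /const -tofracM mul_mpolyC. Qed.

(** Independent elements of the local algebras of several points give independent
    classes of forms modulo the Jacobian ideal: multiply the numerators at the
    point [P l] by forms [h l l'] that lie in the ideal of the point [P l'] and
    do not vanish at [P l]. *)
Lemma independent_count b r (P : 'I_r -> 'rV[k]_3) (ch : 'I_r -> 'I_3)
    (m : 'I_r -> nat) (u : forall l, 'I_(m l) -> K) :
  jacobian_codim_le F b -> (forall l, P l 0 (ch l) != 0) ->
  (forall l, independent (ch l) (P l) (u l)) ->
  (forall l l', l != l' -> exists e h, [/\ h \is e.-homog, h.@[P l 0] != 0
     & I (ch l') (P l') (tf h / X (ch l') ^+ e)]) ->
  (\sum_l m l)%N%:Z <= b.
Proof.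
move=> [N0 Nb] Pch uI sep.
have rep l : exists p : nat * R * ('I_(m l) -> R),
    [/\ p.1.2 \is p.1.1.-homog, p.1.2.@[P l 0] != 0 &
      forall x, p.2 x \is p.1.1.-homog /\ u l x = tf (p.2 x) / tf p.1.2].
  have [n [H [Hn HP uH]]] := common_denominator (proj1 (uI l)).
  have /fin_all_exists[A AP] : forall x, exists A : R,
      A \is n.-homog /\ u l x = tf A / tf H.
    by move=> x; have [A] := uH x; exists A.
  by exists (n, H, A).
have [nHA nHAP] := fin_all_exists rep.
pose n l := (nHA l).1.1; pose H l := (nHA l).1.2; pose A l := (nHA l).2.
have Hn l : H l \is (n l).-homog by have [] := nHAP l.
have HP l : (H l).@[P l 0] != 0 by have [] := nHAP l.
have An l x : A l x \is (n l).-homog by have [_ _ /(_ x)[]] := nHAP l.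
have uE l x : u l x = tf (A l x) / tf (H l) by have [_ _ /(_ x)[]] := nHAP l.
have sep' l l' : exists p : nat * R, l != l' -> [/\ p.2 \is p.1.-homog,
    p.2.@[P l 0] != 0 & I (ch l') (P l') (tf p.2 / X (ch l') ^+ p.1)].
  have [->|ll'] := eqVneq l l'; first by exists (0%N, 0).
  by have [e [h eh]] := sep l l' ll'; exists (e, h).
have [eh ehP] := fin_all_exists (fun l => fin_all_exists (sep' l)).
pose g l := \prod_(l' | l' != l) (eh l l').2.
pose e l := (\sum_(l' | l' != l) (eh l l').1)%N.
have gh l : g l \is (e l).-homog.
  rewrite /g /e; apply: (big_ind2 (fun (p : R) e => p \is e.-homog)).
  - exact: dhomog1.
  - by move=> p1 e1 p2 e2; apply: dhomogM.
  - by move=> l' ll'; have [] := ehP l l' (ltac:(by rewrite eq_sym)).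
have gP l : (g l).@[P l 0] != 0.
  rewrite /g rmorph_prod /=; apply/prodf_neq0 => l' ll'.
  by have [] := ehP l l' (ltac:(by rewrite eq_sym)).
pose N := (N0 + \sum_l (n l + e l))%N.
have leN l : (n l + e l <= N)%N.
  by rewrite /N (bigD1 l) //= addnCA leq_addr.
pose q l := (N - (n l + e l))%N.
pose num l x := A l x * g l * 'X_(ch l) ^+ q l.
pose den l := H l * g l * 'X_(ch l) ^+ q l.
have scale l (p : R) : p \is (n l).-homog -> p * g l * 'X_(ch l) ^+ q l \is N.-homog.
  move=> pn; apply: homogM (dhomogM pn (gh l)) (homog_Xn k (ch l) (q l)) _.
  by rewrite /q subnKC.
have denP l : (den l).@[P l 0] != 0.
  by rewrite /den !mevalM rmorphXn /= mevalXU !mulf_neq0 ?expf_neq0.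
have numE l x : tf (num l x) / tf (den l) = u l x.
  rewrite uE /num /den !tofracM -!mulf_div (divff (tf_neq0 (gP l))) mulr1.
  by rewrite divff ?mulr1 // -XfX expf_neq0 ?Xf_neq0.
have numI l l0 x : l != l0 -> I (ch l0) (P l0) (tf (num l x) / tf (den l0)).
  move=> ll0; have [hh hP hI] := ehP l l0 ll0.
  have [|f fh fE] := homog_cofactor hh (scale l (A l x) (An l x)).
    rewrite /g (bigD1 l0) //= 1?eq_sym //.
    by exists (A l x * \prod_(i | (i != l) && (i != l0)) (eh l i).2 * 'X_(ch l) ^+ q l); ring.
  have le_e : ((eh l l0).1 <= N)%N.
    apply: leq_trans (leN l); rewrite /e (bigD1 l0) 1?eq_sym //=; lia.
  rewrite /num fE; set h := (eh l l0).2; set a := (eh l l0).1.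
  have -> : tf (h * f) / tf (den l0) =
      tf (f * 'X_(ch l0) ^+ a) / tf (den l0) * (tf h / X (ch l0) ^+ a).
    move: (tf (den l0)) => dl0.
    rewrite XfX !tofracM mulf_div [tf f * _ * _]mulrAC -mulf_div divff ?mulr1.
      by rewrite [tf f * _]mulrC.
    by rewrite -XfX expf_neq0 ?Xf_neq0.
  apply: tjurina_idealM hI; exists N, (f * 'X_(ch l0) ^+ a), (den l0); split=> //.
    by apply: homogM fh (homog_Xn k (ch l0) a) _; rewrite subnK.
  exact: scale.
pose T : finType := {l : 'I_r & 'I_(m l)}.
have cardT : #|T| = (\sum_l m l)%N.
  by rewrite card_tagged sumnE big_map big_enum; apply: eq_bigr => l _; rewrite card_ord.
rewrite -cardT; apply: (Nb N _ (fun x => num (tag (enum_val x)) (tagged (enum_val x)))).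
- by rewrite /N leq_addr.
- by move=> x; apply: scale.
move=> c Jc; pose c' (l : 'I_r) (x : 'I_(m l)) := c (enum_rank (Tagged (fun l => 'I_(m l)) x : T)).
have sumE : \sum_x c x *: num (tag (enum_val x)) (tagged (enum_val x)) =
    \sum_l \sum_x c' l x *: num l x.
  rewrite sig_big_dep /= (reindex (@enum_rank T)) /=; last first.
    by apply/onW_bij/enum_rank_bij.
  by apply: eq_bigr => -[l x] _; rewrite enum_rankK.
suff c'0 : forall l x, c' l x = 0.
  by move=> x; rewrite -[x]enum_valK; case: (enum_val x) => l y; apply: c'0.
move=> l; apply: (proj2 (uI l)); rewrite sumE in Jc.
have Gh : \sum_l \sum_x c' l x *: num l x \is N.-homog.
  apply: rpred_sum => l1 _; apply: rpred_sum => x _; apply: rpredZ.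
  exact: scale.
have := jacobian_local (Pch l) Jc Gh (scale l (H l) (Hn l)) (denP l).
rewrite (bigD1 l) //= tofracD mulrDl => GI.
have -> : \sum_x const (c' l x) * u l x = tf (\sum_x c' l x *: num l x) / tf (den l).
  rewrite raddf_sum mulr_suml; apply: eq_bigr => x _.
  by rewrite -numE mulrA constM.
have restI : I (ch l) (P l)
    (tf (\sum_(i | i != l) \sum_x c' i x *: num i x) / tf (den l)).
  rewrite raddf_sum mulr_suml; apply: tjurina_ideal_sum => l1 ll1.
  rewrite raddf_sum mulr_suml; apply: tjurina_ideal_sum => x _.
  suff: I (ch l) (P l) (const (c' l1 x) * (tf (num l1 x) / tf (den l))).
    by rewrite mulrA constM.
  by apply: tjurina_idealM (numI _ _ _ ll1); apply: local_ring_const.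
have := tjurina_idealD GI (tjurina_idealM (local_ring_const (P l) (- 1)) restI).
by rewrite /const mpolyCN mpolyC1 tofracN tofrac1 mulN1r addrK.
Qed.

End LocalRings.

(** * The total Tjurina number *)

Lemma ex_max (P : nat -> Prop) (b : int) : P 0%N -> (forall n, P n -> n%:Z <= b) ->
  exists2 m, P m & forall n, P n -> (n <= m)%N.
Proof.
move=> P0 Pb; pose B := `|b|%N; have PB n : P n -> (n <= B)%N.
  by move=> /Pb; rewrite /B; lia.
have [|j [m Pm mj] jmin] := @ex_min (fun j => exists2 n, P n & (n + j = B)%N) B.
  by exists 0%N.
exists m => // n Pn; have := jmin (B - n)%N; have := PB n Pn => nB.
by move=> /(_ (ex_intro2 _ _ n Pn (subnKC nB))); lia.
Qed.

Lemma unit_multiple (L : fieldType) (y w a c : L) : w != 0 -> a != 0 -> c != 0 ->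
  y / c = a / w * (y * w / (a * c)).
Proof. by move=> w0 a0 c0; field; rewrite w0 a0 c0. Qed.

Section TotalTjurina.
Variable k : closedFieldType.
Local Notation R := {mpoly k[3]}.
Local Notation K := (hfrac k).
Local Notation tf := (@tofrac R).
Local Notation X := (@Xf k).
Implicit Types (G H : R) (s t : K) (P Q : 'rV[k]_3).

Variables (d : nat) (F : R).
Hypotheses (Fd : F \is d.-homog) (d0 : (0 < d)%N).
Local Notation I := (tjurina_ideal d F).

Variable b : int.
Hypothesis Fb : jacobian_codim_le F b.

Lemma independent_le i P m (u : 'I_m -> K) : P 0 i != 0 ->
  independent d F i P u -> m%:Z <= b.
Proof.
move=> Pi uI; have := @independent_count k d F Fd d0 b 1 (fun=> P) (fun=> i)
  (fun=> m) (fun=> u) Fb (fun=> Pi) (fun=> uI).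
by rewrite big_ord1; apply=> l l'; rewrite !ord1 eqxx.
Qed.

Lemma tjurina_independent i P m : tjurina d F i P m <->
  exists2 u : 'I_m -> K, independent d F i P u &
    forall s, local_ring P s -> exists c : 'I_m -> k,
      I i P (s - \sum_l const (c l) * u l).
Proof. by split=> [[u [uP uI us]]|[u [uP uI] us]]; exists u. Qed.

(** Independent families have at most [b] members, and a largest one spans the
    local algebra. *)
Lemma tjurina_exists i P : P 0 i != 0 -> exists m, tjurina d F i P m.
Proof.
move=> Pi; pose fam m := exists u : 'I_m -> K, independent d F i P u.
have [||m [u uI] umax] := @ex_max fam b.
- by exists (fun=> 0); split=> [[]//|c _ []].
- by move=> m [u uI]; apply: independent_le Pi uI.
exists m; apply/tjurina_independent; exists u => // s sP.
apply: NNPP => no; have := umax m.+1; rewrite ltnn => /(_ _) contra.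
suff /contra : fam m.+1 by [].
exists (fun x => oapp u s (unlift ord0 x)); split.
  by move=> x; case: unliftP => [y|] _ //=; apply: (proj1 uI).
move=> c; rewrite big_ord_recl unlift_none /=.
under eq_bigr do rewrite liftK /=.
have [c0|c0] := eqVneq (c ord0) 0.
  rewrite c0 /const mpolyC0 tofrac0 mul0r add0r => cI x.
  case: (unliftP ord0 x) => [y ->|-> //]; exact: (proj2 uI (fun y => c (lift ord0 y)) cI).
move=> cI; case: no; exists (fun y => - ((c ord0)^-1 * c (lift ord0 y))).
have := tjurina_idealM (local_ring_const P (c ord0)^-1) cI.
have cM (x y : k) : const (x * y) = const x * const y :> K.
  by rewrite /const mpolyCM tofracM.
rewrite mulrDr mulrA -cM mulVf // {1}/const mpolyC1 tofrac1 mul1r -sumrN mulr_sumr.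
rewrite (eq_bigr (fun y => - (const (- ((c ord0)^-1 * c (lift ord0 y))) * u y))) //.
move=> y _; rewrite mulrA -cM -mulNr; congr (_ * _).
by rewrite /const mpolyCN tofracN opprK.
Qed.

Lemma separating_line P Q i : Q 0 i != 0 -> ~ same_point Q P ->
  exists h : R, [/\ h \is 1.-homog, h.@[P 0] != 0 & h.@[Q 0] = 0].
Proof.
move=> Qi QP; pose q (j : 'I_3) : R := (Q 0 j)%:MP.
have qe (T : 'rV[k]_3) j : (cross q Xv j).@[T 0] = cross (Q 0) (T 0) j.
  by rewrite /cross mevalB !mevalM !mevalC !mevalXU.
have [j PQj] : exists j, cross (Q 0) (P 0) j != 0.
  apply: NNPP => no; apply: QP; exists (P 0 i / Q 0 i).
  apply/matrixP => a j; rewrite ord1 mxE mulrAC.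
  have PQ0 l : cross (Q 0) (P 0) l = 0.
    by apply/eqP; apply: contraT => h; case: no; exists l.
  by rewrite -[P 0 i * _]mulrC -(cross_minors PQ0) mulrAC divff ?mul1r.
exists (cross q Xv j); split; rewrite ?qe //; last by rewrite /cross mulrC subrr.
by rewrite /cross /q !mul_mpolyC; apply: rpredB; apply/rpredZ/homog_X.
Qed.

(** The powers of a linear form vanishing at [Q] are dependent in the local
    algebra, which is finite dimensional; the first one that occurs in a relation
    lies in the ideal, as the remaining factor is a unit. *)
Lemma form_power_ideal Q i h : Q 0 i != 0 -> h \is 1.-homog -> h.@[Q 0] = 0 ->
  exists j, I i Q (tf (h ^+ j) / X i ^+ j).
Proof.
move=> Qi h1 hQ; pose B := `|b|%N; pose u (x : 'I_B.+1) : K := tf (h ^+ x) / X i ^+ x.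
have hX j : h ^+ j \is j.-homog by rewrite -[X in X.-homog]mul1n; apply: dhomogMn.
have uQ x : local_ring Q (u x).
  exists (val x), (h ^+ x), ('X_i ^+ x); split; [exact: hX | exact: homog_Xn | |].
    by rewrite rmorphXn /= mevalXU expf_neq0.
  by rewrite /u XfX.
have [c [cI cn0]] : exists c : 'I_B.+1 -> k, I i Q (\sum_x const (c x) * u x) /\
    exists x, c x != 0.
  apply: NNPP => no; suff : B.+1%:Z <= b by rewrite /B; lia.
  apply: (@independent_le i Q B.+1 u Qi); split; first exact: uQ.
  move=> c cI x; apply/eqP; apply: contraT => cx; case: no.
  by exists c; split=> //; exists x.
pose P j := exists2 x : 'I_B.+1, val x = j & c x != 0.
have [x1 cx1] := cn0.
have [j0 [x0 <- cx0] j0min] := @ex_min P x1 (ex_intro2 _ _ x1 erefl cx1).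
have cmin (x : 'I_B.+1) : (x < x0)%N -> c x = 0.
  move=> xx0; apply/eqP; apply: contraT => cx.
  by have := j0min x (ex_intro2 _ _ x erefl cx); rewrite leqNgt xx0.
have x0B : (x0 <= B)%N by rewrite -ltnS.
pose W : R := \sum_(x : 'I_B.+1 | (x0 <= x)%N) c x *: (h ^+ (x - x0) * 'X_i ^+ (B - x)).
have WQ : W.@[Q 0] != 0.
  rewrite rmorph_sum (bigD1 x0) //= big1 ?addr0 => [|x /andP[x0x xx0]].
    rewrite mevalZ mevalM subnn expr0 meval1 mul1r rmorphXn /= mevalXU.
    by rewrite mulf_neq0 ?expf_neq0.
  rewrite mevalZ mevalM rmorphXn /= hQ expr0n subn_eq0 (_ : (x <= x0)%N = false).
    by rewrite mul0r mulr0.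
  by apply/negbTE; rewrite -ltnNge ltn_neqAle x0x andbT eq_sym.
have Wh : W \is (B - x0).-homog.
  apply: rpred_sum => x x0x; apply: rpredZ.
  apply: homogM (hX (x - x0)%N) (homog_Xn k i (B - x)) _.
  by have := ltn_ord x; lia.
have X0 e : X i ^+ e != 0 by rewrite expf_neq0 ?Xf_neq0.
have sumE : \sum_x const (c x) * u x = tf (h ^+ x0 * W) / X i ^+ B.
  rewrite (bigID (fun x : 'I_B.+1 => (x0 <= x)%N)) /= addrC big1 ?add0r => [|x].
    rewrite /W mulr_sumr raddf_sum mulr_suml; apply: eq_bigr => x x0x /=.
    rewrite /u mulrA constM -scalerAr mulrA -exprD subnKC //.
    rewrite -!constM -!mulrA; congr (_ * _).
    have XB : X i ^+ B = X i ^+ x * X i ^+ (B - x).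
      by rewrite -exprD subnKC // -ltnS.
    by rewrite tofracM -XfX XB -mulf_div divff // mulr1.
  by rewrite -ltnNge => /cmin ->; rewrite /const mpolyC0 tofrac0 mul0r.
exists x0; rewrite sumE in cI.
have -> : tf (h ^+ x0) / X i ^+ x0 =
    tf ('X_i ^+ (B - x0)) / tf W * (tf (h ^+ x0 * W) / X i ^+ B).
  have XB : X i ^+ B = X i ^+ (B - x0) * X i ^+ x0 by rewrite -exprD subnK.
  rewrite tofracM -XfX XB.
  exact: unit_multiple (tf_neq0 WQ) (X0 _) (X0 _).
apply: tjurina_idealM cI; exists (B - x0)%N, ('X_i ^+ (B - x0)), W; split=> //.
exact: homog_Xn.
Qed.

Lemma separating_form P Q i : Q 0 i != 0 -> ~ same_point Q P ->
  exists e (h : R), [/\ h \is e.-homog, h.@[P 0] != 0 & I i Q (tf h / X i ^+ e)].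
Proof.
move=> Qi QP; have [h [h1 hP hQ]] := separating_line Qi QP.
have [e hI] := form_power_ideal Qi h1 hQ; exists e, (h ^+ e); split=> //.
  by rewrite -[X in X.-homog]mul1n; apply: dhomogMn.
by rewrite rmorphXn /= expf_neq0.
Qed.

Definition singular_points r (P : 'I_r -> 'rV[k]_3) (ch : 'I_r -> 'I_3) :=
  (forall l, P l 0 (ch l) != 0 /\ singular_at d F (ch l) (P l)) /\
  (forall l l', same_point (P l) (P l') -> l = l').

Lemma singular_points_count r (P : 'I_r -> 'rV[k]_3) (ch : 'I_r -> 'I_3) (m : 'I_r -> nat)
    (u : forall l, 'I_(m l) -> K) : singular_points P ch ->
  (forall l, independent d F (ch l) (P l) (u l)) -> (\sum_l m l)%N%:Z <= b.
Proof.
move=> [Psing Pinj] uI; apply: (independent_count Fd d0 Fb _ uI).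
  by move=> l; have [] := Psing l.
move=> l l' ll'; apply: separating_form; first by have [] := Psing l'.
by move=> /Pinj E; rewrite E eqxx in ll'.
Qed.

Lemma singular_points_le r (P : 'I_r -> 'rV[k]_3) (ch : 'I_r -> 'I_3) :
  singular_points P ch -> r%:Z <= b.
Proof.
move=> sing; have := @singular_points_count r P ch (fun=> 1%N) (fun _ _ => 1) sing.
rewrite sum1_card card_ord; apply=> l; split; first by move=> _; apply: local_ring1.
move=> c; rewrite big_ord1 mulr1 => cI x; rewrite ord1; apply/eqP.
apply: contraT => c0; have [_ []] := proj1 sing l.
have := tjurina_idealM (local_ring_const (P l) (c ord0)^-1) cI.
by rewrite /const -tofracM -mpolyCM mulVf // mpolyC1 tofrac1.
Qed.

(** Constants are independent in the local algebra of a singular point, so there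
    are at most [b] singular points; a largest family of them is complete. *)
Theorem total_tjurina_exists : exists tau, total_tjurina d F tau.
Proof.
have [||r [P [ch sing]] rmax] :=
    @ex_max (fun r => exists (P : 'I_r -> 'rV[k]_3) ch, singular_points P ch) b.
- by exists (fun=> 0), (fun=> ord0); split=> -[].
- by move=> r [P [ch /singular_points_le]].
have [t tP] := fin_all_exists (fun l => tjurina_exists (proj1 (proj1 sing l))).
exists (\sum_l t l)%N, r, P, ch, t; split=> //.
- exact: (proj1 sing).
- exact: (proj2 sing).
move=> Q i Qi Qs; apply: NNPP => no; have := rmax r.+1; rewrite ltnn => contra.
suff /contra : exists (P' : 'I_r.+1 -> 'rV[k]_3) ch', singular_points P' ch' by [].
exists (fun x => oapp P Q (unlift ord0 x)), (fun x => oapp ch i (unlift ord0 x)).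
split=> [x|x y].
  by case: unliftP => [l|] _ //=; apply: (proj1 sing).
case: (unliftP ord0 x) => [l ->|->]; case: (unliftP ord0 y) => [l' ->|->] //.
- by rewrite ?liftK /= => /(proj2 sing) ->.
- by rewrite ?liftK ?unlift_none /= => h; case: no; exists l.
rewrite ?liftK ?unlift_none /= => -[c PE]; case: no; exists l'.
have c0 : c != 0.
  have [+ _] := proj1 sing l'; rewrite PE mxE mulf_eq0 negb_or.
  by case/andP.
by exists c^-1; rewrite PE scalerA mulVf // scale1r.
Qed.

Theorem total_tjurina_le tau : total_tjurina d F tau -> tau%:Z <= b.
Proof.
move=> [r [P [ch [t [Psing Pinj _ tP ->]]]]].
have [u uI] : exists u : forall l, 'I_(t l) -> K,
    forall l, independent d F (ch l) (P l) (u l).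
  apply: (fin_all_exists (P := fun l u => independent d F (ch l) (P l) u)) => l.
  by have /tjurina_independent[u uI _] := tP l; exists u.
exact: (singular_points_count (conj Psing Pinj) uI).
Qed.

End TotalTjurina.

Theorem proposition3p3 (k : closedFieldType) (d : nat) (F : {mpoly k[3]})
    (hF : curve d F) (hred : reduced F) :
  exists m tau : nat,
    [/\ least_leaf_degree d F m%:Z,
        total_tjurina d F tau,
        m%:Z <= d%:Z - 1,
        tau%:Z <= (d%:Z - 1) * (d%:Z - m%:Z - 1) + m%:Z ^+ 2
      & (d <= 2 * m)%N -> irreducible F ->
        tau%:Z <= (d%:Z - 1) * (d%:Z - m%:Z - 1) + m%:Z ^+ 2
                  - 'C(2 * m + 2 - d, 2)%:Z].
Proof.
have [d0 F0 Fd] := hF.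
have Fs : squarefree F by move=> p [_ pU _] /hred; apply/negP.
have [A0 lA0] := hamiltonian_leaf_vec F0 Fd Fs.
have [m [A lA] m_min'] :=
  @ex_min (fun n => exists A, leaf_vec F n A) _ (ex_intro _ A0 lA0).
have m_min l B : leaf_vec F l B -> (m <= l)%N.
  by move=> lB; apply: m_min'; exists B.
have bound := jacobian_codim_leaf F0 Fd Fs d0 lA m_min.
have md := leaf_degree_le F0 Fd Fs m_min.
have [tau tauP] := total_tjurina_exists Fd d0 bound.
exists m, tau; split=> //.
- split.
    have [hA _ _] := lA.
    have [D rD] := foliation_of_vec hA (leaf_vec_neq0 F0 Fd d0 lA).
    exists D; first exact: leaf_vec_leaf rD lA.
    exact: represents_degree rD.
  move=> D lD; have [n [B rB]] := vec_of_foliation D.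
  rewrite (represents_degree rB) lez_nat.
  exact/m_min/(leaf_leaf_vec F0 Fd d0 rB lD).
- by lia.
- exact: total_tjurina_le bound _ tauP.
move=> dm FI; apply: (total_tjurina_le Fd d0) tauP.
exact: jacobian_codim_irreducible F0 Fd Fs d0 m A lA m_min dm FI.
Qed.
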